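(* Let $m_1,\dots,m_N>0$, $\omega>0$, $T=2\pi/\omega$, $\varpi\in\mathbb{R}$ with $\omega+\varpi\ne0$, and let $\bar x$ be a planar (horizontal) central configuration normalized so that $\bar x(t)=e^{\mathbb{J}(\omega+\varpi)t}\bar x$ is a relative equilibrium solution of Newton's equations. Let $G$ be a finite subgroup of $O(2)\times\Sigma_N\times O(3)$, and suppose that $\bar y(t)=e^{-\mathbb{J}\varpi t}\bar x(t)=e^{\mathbb{J}\omega t}\bar x$ belongs to $\Lambda^G$. As long as $\lambda_\varpi^G=1$, $\bar y(t)=e^{\mathbb{J}\omega t}\bar x$ is the sole absolute minimizer of $\mathcal{A}_\varpi$ in $\Lambda^G$.
   Context: Configurations $x=(x_1,\dots,x_N)\in(\mathbb{R}^3)^N$ are taken with center of mass at the origin (i.e. modulo translations). $\mathbb{R}^3=\mathbb{C}\times\mathbb{R}$; $e^{\mathbb{J}\phi}(h,z)=(e^{i\phi}h,z)$ on each body, $\mathbb{J}(h,z)=(ih,0)$. Newton's equations: $\ddot x_i=\sum_{j\ne i}m_j\frac{x_j-x_i}{\|x_j-x_i\|^3}$. $|v|^2=\sum_im_i\|v_i\|^2$, $U(x)=\sum_{i<j}\frac{m_im_j}{\|x_i-x_j\|}$. $\Lambda$ is the space of $T$-periodic $H^1$ loops of configurations. $g=(\tau,\sigma,\rho)\in G$ acts on $\Lambda$ by $(gy)_j(t)=\rho\,y_{\sigma^{-1}(j)}(\tau^{-1}(t))$, $\tau$ being an isometry of $\mathbb{R}/T\mathbb{Z}$; $\Lambda^G$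 is the set of invariant loops. $\mathcal{A}_\varpi(y)=\int_0^T\left(\frac12|\dot y+\varpi\mathbb{J}y|^2+U(y)\right)dt$ is the action of $x(t)=e^{\mathbb{J}\varpi t}y(t)$. Let $\bar r_{ij}=\|\bar x_i-\bar x_j\|$ and $(\Delta x)_i=\sum_{j\ne i}\frac{m_j}{\bar r_{ij}^3}(x_i-x_j)$. Then $\lambda_\varpi^G$ is the smallest $\lambda$ such that there is a nonzero solution $x(t)=e^{\mathbb{J}\varpi t}y(t)$ of $-\ddot x=\lambda\Delta x$ with $y\in\Lambda^G$.
   Formalization: ''Sole'' is read up to a constant isometry of space and a possible reversal of time, applied to the motion in the inertial frame: literal uniqueness always fails, since minus the minimizer also lies in the space of invariant loops and has the same action. *)

(* Defs.v *)
From HB Require Import structures.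
From mathcomp Require Import all_boot all_order all_algebra all_fingroup.
From mathcomp Require Import all_classical all_reals all_analysis.

Set Implicit Arguments.
Unset Strict Implicit.
Unset Printing Implicit Defensive.

Import Order.TTheory GRing.Theory Num.Theory.
Import numFieldNormedType.Exports.

Local Open Scope classical_set_scope.
Local Open Scope ring_scope.

(* A configuration of N points of R^3 is the 3 x N matrix whose i-th column is
   the position of the i-th body; rows 0 and 1 are the horizontal plane C of
   R^3 = C x R and row 2 is the vertical axis. *)
Notation config R N := 'M[R]_(3, N).

(* The norm that the library puts on matrices is the sup norm, so the Euclidean
   norm is defined here. *)
Definition enorm (R : realType) (v : 'cV[R]_3) : R :=
  Num.sqrt (\sum_(k < 3) v k 0 ^+ 2).

Definition mutual_distance (R : realType) (N : nat) (x : config R N) (i j : 'I_N) : R :=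
  enorm (col i x - col j x).

Definition centered (R : realType) (N : nat) (m : 'I_N -> R)
    (x : config R N) : Prop :=
  \sum_(i < N) m i *: col i x = 0.

Definition horizontal (R : realType) (N : nat) (x : config R N) : Prop :=
  row ord_max x = 0.

Definition collision_free (R : realType) (N : nat) (x : config R N) : Prop :=
  forall i j : 'I_N, i != j -> col i x != col j x.

Definition J (R : realType) : 'M[R]_3 :=
  \matrix_(i < 3, j < 3)
    nth 0 (nth [::] [:: [:: 0; -1; 0];
                        [:: 1;  0; 0];
                        [:: 0;  0; 0]] i) j.

Definition expJ (R : realType) (phi : R) : 'M[R]_3 :=
  \matrix_(i < 3, j < 3)
    nth 0 (nth [::] [:: [:: cos phi; - sin phi; 0];
                        [:: sin phi;   cos phi; 0];
                        [:: 0;         0;       1]] i) j.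

Definition rotating (R : realType) (N : nat) (phi : R) (y : R -> config R N) :
    R -> config R N :=
  fun t => expJ (phi * t) *m y t.

Definition mass_sqnorm (R : realType) (N : nat) (m : 'I_N -> R)
    (v : config R N) : R :=
  \sum_(i < N) m i * enorm (col i v) ^+ 2.

(* Inversion on \bar R sends 0 to +oo, so U = +oo at collisions. *)
Definition U (R : realType) (N : nat) (m : 'I_N -> R) (x : config R N) :
    \bar R :=
  (\sum_(i < N) \sum_(j < N | (i < j)%N)
      (m i * m j)%:E / (mutual_distance x i j)%:E)%E.

Definition acceleration (R : realType) (N : nat) (m : 'I_N -> R)
    (x : config R N) (i : 'I_N) : 'cV[R]_3 :=
  \sum_(j < N | j != i) (m j / mutual_distance x i j ^+ 3) *: (col j x - col i x).

Definition twice_derivable (R : realType) (N : nat)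
    (x : R -> config R N) : Prop :=
  forall t : R, derivable x t 1 /\ derivable (derive1 x) t 1.

Definition newton_solution (R : realType) (N : nat) (m : 'I_N -> R)
    (x : R -> config R N) : Prop :=
  [/\ forall t, collision_free (x t), twice_derivable x
    & forall t i, col i (derive1 (derive1 x) t) = acceleration m (x t) i].

(* The constant c is the Lagrange multiplier; for centered x the right-hand side
   is -c times the position relative to the center of mass. *)
Definition central_configuration (R : realType) (N : nat) (m : 'I_N -> R)
    (x : config R N) : Prop :=
  collision_free x /\
  exists c : R, forall i, acceleration m x i = - c *: col i x.

Definition square_integrable (R : realType) (T : R) (f : R -> R) : Prop :=
  measurable_fun `[0, T] f /\
  (@lebesgue_measure R).-integrable `[0, T] (fun t => (f t ^+ 2)%:E).

(* v is an L^2 derivative of y on [0, T]: y is absolutely continuous with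
   derivative v almost everywhere. *)
Definition L2_derivative (R : realType) (N : nat) (T : R)
    (y v : R -> config R N) : Prop :=
  forall k i, square_integrable T (fun t => v t k i) /\
    forall t, 0 <= t <= T ->
      y t k i = y 0 k i + \int[lebesgue_measure]_(s in `[0, t]) v s k i.

(* The space of T-periodic H^1 loops, each represented by its continuous
   representative. *)
Definition Lambda (R : realType) (N : nat) (m : 'I_N -> R) (T : R) :
    set (R -> config R N) :=
  [set y | [/\ forall t, y (t + T) = y t,
               forall t, centered m (y t)
             & exists v, L2_derivative T y v]].

(* For y in Lambda, the derivative of y on [0, T], which is unique up to a
   negligible set; an arbitrary representative is chosen. *)
Definition L2_deriv (R : realType) (N : nat) (T : R) (y : R -> config R N) :
    R -> config R N :=
  get [set v | L2_derivative T y v].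

Definition action_functional (R : realType) (N : nat) (m : 'I_N -> R)
    (T varpi : R) (y : R -> config R N) : \bar R :=
  (\int[lebesgue_measure]_(t in `[0%R, T])
     ((2^-1 * mass_sqnorm m (L2_deriv T y t + varpi *: (J R *m y t)))%:E
      + U m (y t)))%E.

Definition orthogonal_mx (R : realType) (n : nat) (A : 'M[R]_n) : Prop :=
  A^T *m A = 1%:M.

Record symmetry (R : realType) (N : nat) := Symmetry {
  sym_time : 'M[R]_2;
  sym_body : 'S_N;
  sym_space : 'M[R]_3 }.

Definition sym_one (R : realType) (N : nat) : symmetry R N :=
  Symmetry 1%:M 1%g 1%:M.

(* Permutations are multiplied in diagrammatic order, (s * s') i = s' (s i),
   hence the exchange that makes the second component sigma \o sigma'. *)
Definition sym_mul (R : realType) (N : nat) (g h : symmetry R N) :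
    symmetry R N :=
  Symmetry (sym_time g *m sym_time h) (sym_body h * sym_body g)%g
    (sym_space g *m sym_space h).

Definition sym_inv (R : realType) (N : nat) (g : symmetry R N) :
    symmetry R N :=
  Symmetry (invmx (sym_time g)) (sym_body g)^-1%g (invmx (sym_space g)).

Definition finite_subgroup (R : realType) (N : nat)
    (G : set (symmetry R N)) : Prop :=
  [/\ finite_set G,
      forall g, G g -> orthogonal_mx (sym_time g) /\ orthogonal_mx (sym_space g),
      G (sym_one R N),
      forall g h, G g -> G h -> G (sym_mul g h)
    & forall g, G g -> G (sym_inv g)].

Definition circle_point (R : realType) (T t : R) : 'cV[R]_2 :=
  \col_(k < 2) (if k == 0 then cos (2 * pi * t / T) else sin (2 * pi * t / T)).

(* O(2) acts on R/TZ by isometries through the identification of R/TZ with the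
   unit circle; some real representative modulo T of the image of t is chosen. *)
Definition time_act (R : realType) (T : R) (tau : 'M[R]_2) (t : R) : R :=
  get [set s | circle_point T s = tau *m circle_point T t].

Definition loop_act (R : realType) (N : nat) (T : R) (g : symmetry R N)
    (y : R -> config R N) : R -> config R N :=
  fun t => sym_space g *m
    col_perm (sym_body g)^-1%g (y (time_act T (invmx (sym_time g)) t)).

Definition acts_on_loops (R : realType) (N : nat) (m : 'I_N -> R) (T : R)
    (G : set (symmetry R N)) : Prop :=
  forall g y, G g -> Lambda m T y -> Lambda m T (loop_act T g y).

Definition LambdaG (R : realType) (N : nat) (m : 'I_N -> R) (T : R)
    (G : set (symmetry R N)) : set (R -> config R N) :=
  [set y | Lambda m T y /\ forall g, G g -> loop_act T g y = y].

Definition Delta (R : realType) (N : nat) (m : 'I_N -> R)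
    (xbar x : config R N) : config R N :=
  \matrix_(k < 3, i < N)
    \sum_(j < N | j != i) m j / mutual_distance xbar i j ^+ 3 * (x k i - x k j).

Definition eigenvalues (R : realType) (N : nat) (m : 'I_N -> R) (T varpi : R)
    (G : set (symmetry R N)) (xbar : config R N) : set R :=
  [set lambda | exists y : R -> config R N,
     let x := rotating varpi y in
     [/\ LambdaG m T G y, exists t, x t != 0, twice_derivable x
       & forall t, - derive1 (derive1 x) t = lambda *: Delta m xbar (x t)]].

Definition is_lambdaG (R : realType) (N : nat) (m : 'I_N -> R) (T varpi : R)
    (G : set (symmetry R N)) (xbar : config R N) (lambda : R) : Prop :=
  eigenvalues m T varpi G xbar lambda /\
  lbound (eigenvalues m T varpi G xbar) lambda.

Definition absolute_minimizer (X : Type) (R : realType) (A : X -> \bar R)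
    (S : set X) (y : X) : Prop :=
  S y /\ forall z, S z -> (A y <= A z)%E.

(* In the inertial frame, where y reads x(t) = e^(J varpi t) y(t), the two loops
   describe the same motion up to an isometry S of R^3 and a possible reversal
   of time.  The symmetries of the problem make such an identification
   unavoidable: for y = e^(J omega t) xbar in Lambda^G, the loop - y is in
   Lambda^G too and has the same action. *)
Definition same_motion (R : realType) (N : nat) (varpi : R)
    (y y' : R -> config R N) : Prop :=
  exists (S : 'M[R]_3) (b : bool), orthogonal_mx S /\
    forall t, rotating varpi y' t = S *m rotating varpi y ((-1) ^+ b * t).

(* Main.v *)
Require Import Defs.
From HB Require Import structures.
From mathcomp Require Import all_boot all_order all_algebra all_fingroup.
From mathcomp Require Import all_classical all_reals all_analysis.
From mathcomp Require Import measurable_realfun.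
From mathcomp Require Import ring lra.

Set Implicit Arguments.
Unset Strict Implicit.
Unset Printing Implicit Defensive.

Import Order.TTheory GRing.Theory Num.Theory.
Import numFieldNormedType.Exports.

Local Open Scope classical_set_scope.
Local Open Scope ring_scope.

(** Every pair term 1/r of U, seen as a function of r^2, lies above its tangent at the
mutual distance of [xbar], with a slack that vanishes only at that distance
([inv_tangent]).  Summed over the pairs this gives
U(x) >= 3/2 U(xbar) - 1/2 <Delta x, x> + [shape_gap] x, and integrated along a loop
([action_lower_bound])
  action(y) >= 3/2 U(xbar) T + 1/2 Q(y) + int [shape_gap] (y t),
where Q(y) = int (|y' + varpi J y|^2 - <Delta y, y>) is the form [qform]; the relative
equilibrium has action 3/2 U(xbar) T ([action_ybar]).  Minimality is thus the
inequality Q >= 0 on invariant loops.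

Q compares the two quadratic forms of the eigenvalue problem -x'' = lambda Delta x, and
its sign is decided by the smallest eigenvalue being 1, as follows.  Q splits along Fourier
modes.  On one mode it is a finite-dimensional form; if it were negative somewhere,
the minimum of its Rayleigh quotient over the amplitudes of invariant loops would be
an eigenvalue below 1 ([mode_action_ge0]).  This needs the symmetries to commute with
Delta and with the square of d/dt + varpi J, which follows from their fixing the
relative equilibrium ([compatible_of_invariant]).  On loops without low modes Q is
coercive, because such loops are uniformly small compared with the norm of their
derivative ([high_modes_small]).  So only finitely many modes matter, and a loop with
Q(y) = 0 is a trigonometric polynomial, hence smooth, that solves -x'' = Delta x in the
inertial frame ([qform_ge0], [qform_eq0]).

Let y be another minimizer.  Then Q(y) = 0, and the mutual distances of y are
at all times those of [xbar].  The center of mass being fixed, x(t) has the same Gram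
matrix as [xbar]; since Delta acts on the right of configurations, x(t) is then an
eigenvector of Delta as [xbar] is, with eigenvalue (omega + varpi)^2
([Delta_congruent]), and the equation becomes that of a harmonic oscillator.  Hence
x(t) = cos(W t) a + sin(W t) b with W = omega + varpi, where the constancy of the Gram
matrix forces a^T a = b^T b = xbar^T xbar and a^T b to be skew.  As [xbar] is planar,
a^T b can only be xbar^T (J xbar) up to sign ([planar_skew_gram]), so that the pair
(a, b) is congruent to (xbar, J xbar) or (xbar, - J xbar): the motion is the relative
equilibrium up to an isometry and a reversal of time ([rigid_harmonic_motion]). *)

(** * Integrals over intervals *)

Section IntervalIntegral.
Context {R : realType}.
Implicit Types (f g F : R -> R) (a b c t s x : R).
Notation mu := (@lebesgue_measure R).
Local Notation int a b f := (Rintegral mu [set` `[a, b]] f).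

Definition itv_integrable a b f : Prop := mu.-integrable `[a, b] (EFin \o f).

Lemma continuous_itv_integrable a b f : continuous f -> itv_integrable a b f.
Proof.
move=> cf; apply: continuous_compact_integrable; first exact: segment_compact.
exact: continuous_subspaceT.
Qed.

Lemma itv_integrableD a b f g : itv_integrable a b f -> itv_integrable a b g ->
  itv_integrable a b (fun t => f t + g t).
Proof. by move=> fi gi; rewrite /itv_integrable; apply: (integrableD _ fi gi). Qed.

Lemma itv_integrableZ a b k f : itv_integrable a b f ->
  itv_integrable a b (fun t => k * f t).
Proof. by move=> fi; apply: (integrableZl _ k fi). Qed.

Lemma itv_integrableN a b f : itv_integrable a b f ->
  itv_integrable a b (fun t => - f t).
Proof.
move=> fi; rewrite (_ : (fun t => - f t) = (fun t => -1 * f t)).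
  exact: itv_integrableZ.
by apply/funext => t; rewrite mulN1r.
Qed.

Lemma itv_integrableB a b f g : itv_integrable a b f -> itv_integrable a b g ->
  itv_integrable a b (fun t => f t - g t).
Proof. by move=> fi gi; exact: itv_integrableD fi (itv_integrableN gi). Qed.

Lemma itv_integrable_sum a b (I : Type) (r : seq I) (P : pred I)
    (F : I -> R -> R) :
  (forall i, P i -> itv_integrable a b (F i)) ->
  itv_integrable a b (fun t => \sum_(i <- r | P i) F i t).
Proof.
move=> Fi; elim: r => [|i r IHr].
  under eq_fun do rewrite big_nil.
  exact: continuous_itv_integrable (@cst_continuous _ _ 0).
under eq_fun do rewrite big_cons.
by case: (boolP (P i)) => // Pi; apply: itv_integrableD => //; exact: Fi.
Qed.

Lemma itv_integrableS a b c d f : a <= c -> d <= b ->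
  itv_integrable a b f -> itv_integrable c d f.
Proof.
by move=> ac db; apply: integrableS => //; apply: subset_itvScc; rewrite bnd_simp.
Qed.

Lemma int_split a b c f : a <= c <= b -> itv_integrable a b f ->
  int a b f = int a c f + int c b f.
Proof.
move=> /andP[ac cb] fi; apply/eqP; rewrite addrC -subr_eq; apply/eqP.
rewrite Rintegral_itvB ?bnd_simp// Rintegral_itv_obnd_cbnd//.
by apply: (integrableS _ _ _ fi) => //; apply: subset_itvScc; rewrite bnd_simp.
Qed.

Lemma eq_int a b f g : (forall t, a <= t <= b -> f t = g t) ->
  int a b f = int a b g.
Proof. by move=> fg; apply: eq_Rintegral => t /[!inE]/=; rewrite in_itv/=; exact: fg. Qed.

Lemma int_ge0 a b f : (forall t, a <= t <= b -> 0 <= f t) -> 0 <= int a b f.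
Proof. by move=> f0; apply: Rintegral_ge0 => t /=; rewrite in_itv/=; exact: f0. Qed.

Lemma le_int a b f g : itv_integrable a b f -> itv_integrable a b g ->
  (forall t, a <= t <= b -> f t <= g t) -> int a b f <= int a b g.
Proof.
by move=> fi gi fg; apply: le_Rintegral => // t /=; rewrite in_itv/=; exact: fg.
Qed.

Lemma int_cst a b k : a <= b -> int a b (fun=> k) = k * (b - a).
Proof.
move=> ab; rewrite Rintegral_cst//= lebesgue_measure_itv/= lte_fin.
case: ltP => // ba; rewrite (_ : b = a) ?subrr//.
by apply/eqP; rewrite eq_le ab ba.
Qed.

Lemma intD a b f g : itv_integrable a b f -> itv_integrable a b g ->
  int a b (fun t => f t + g t) = int a b f + int a b g.
Proof. by move=> fi gi; rewrite RintegralD. Qed.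

Lemma intB a b f g : itv_integrable a b f -> itv_integrable a b g ->
  int a b (fun t => f t - g t) = int a b f - int a b g.
Proof. by move=> fi gi; rewrite RintegralB. Qed.

Lemma intZ a b k f : itv_integrable a b f ->
  int a b (fun t => k * f t) = k * int a b f.
Proof. by move=> fi; rewrite RintegralZl. Qed.

Lemma int_sum a b (I : Type) (r : seq I) (P : pred I) (F : I -> R -> R) :
  (forall i, P i -> itv_integrable a b (F i)) ->
  int a b (fun t => \sum_(i <- r | P i) F i t) =
  \sum_(i <- r | P i) int a b (F i).
Proof.
move=> Fi; elim: r => [|i r IHr].
  rewrite big_nil; under eq_Rintegral do rewrite big_nil.
  by rewrite Rintegral_cst// mul0r.
under eq_Rintegral do rewrite big_cons.
rewrite big_cons.
case: (boolP (P i)) => // Pi; rewrite RintegralD ?IHr//; first exact: Fi.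
exact: itv_integrable_sum.
Qed.

Lemma int_norm_le a b f : itv_integrable a b f ->
  `|int a b f| <= int a b (fun t => `|f t|).
Proof. by move=> fi; exact: le_normr_Rintegral. Qed.

Lemma itv_integrable_norm a b f : itv_integrable a b f ->
  itv_integrable a b (fun t => `|f t|).
Proof. by move=> fi; exact: integrable_norm. Qed.

Lemma is_derive_continuous F f :
  (forall x, is_derive x 1 F (f x)) -> continuous F.
Proof.
move=> dF x; apply/differentiable_continuous/derivable1_diffP.
by have [] := dF x.
Qed.

Lemma is_derive_at_continuous F x d : is_derive x 1 F d -> {for x, continuous F}.
Proof. by move=> dF; apply/differentiable_continuous/derivable1_diffP; have [] := dF. Qed.

Lemma FTC2_itv a b F f : a <= b -> continuous f ->
  (forall x, a <= x <= b -> is_derive x 1 F (f x)) -> int a b f = F b - F a.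
Proof.
move=> ab cf dF; move: (ab); rewrite le_eqVlt => /predU1P[<-|ltab].
  by rewrite subrr set_itv1 Rintegral_set1.
rewrite /Rintegral (@continuous_FTC2 _ f F)//.
- exact: continuous_subspaceT.
- split.
  + move=> x; rewrite in_itv/= => /andP[ax xb].
    by have [] := dF x; rewrite // !ltW.
  + apply: cvg_at_right_filter; apply: is_derive_at_continuous (dF a _).
    by rewrite lexx.
  + apply: cvg_at_left_filter; apply: is_derive_at_continuous (dF b _).
    by rewrite lexx andbT.
- move=> x; rewrite in_itv/= => /andP[ax xb].
  by rewrite derive1E; have [] := dF x; rewrite // !ltW.
Qed.

Lemma exists_primitive f (M : R) : continuous f ->
  exists F, forall x, `|x| <= M -> is_derive x 1 F (f x).
Proof.
move=> cf; exists (fun x => int (- (M + 1)) x f) => x.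
rewrite ler_norml => /andP[Mx xM].
have x1 : x < M + 1 by lra.
have x2 : - (M + 1) < x by lra.
have [d1 d2] := continuous_FTC1_closed x1 (continuous_itv_integrable _ _ cf) x2 (cf x).
by rewrite derive1E in d2; exact: DeriveDef d1 d2.
Qed.

(** Both sides are differences of values of one primitive F; the difference of F over
a full period does not depend on the starting point. *)
Lemma int_periodic_reparam (T : R) f (e : bool) c : 0 <= T -> continuous f ->
  (forall t, f (t + T) = f t) ->
  int 0 T (fun s => f ((-1) ^+ e * s + c)) = int 0 T f.
Proof.
move=> T0 cf pf.
(* all points at which F is evaluated below lie in [-M, M] *)
pose M : R := `|c| + `|T| + `|T|.
have [F dF] := exists_primitive M cf.
have T_ge0 := normr_ge0 T.
have dF1 (x : R) : `|x| <= `|c| + `|T| ->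
    is_derive x 1 (fun x => F (x + T) - F x) 0.
  move=> xc; have h := ler_normD x T.
  rewrite -(subrr (f x)) -{1}(pf x).
  apply: is_deriveB; last by apply: dF; rewrite /M; lra.
  rewrite -[f (x + T)]mulr1.
  have d2 : is_derive x 1 (fun x : R => x + T) 1.
    have := is_deriveD (is_derive_id x 1) (is_derive_cst T x 1).
    by rewrite addr0.
  by apply: (@is_derive1_comp _ F (fun x => x + T)); apply: dF; rewrite /M; lra.
have per x : `|x| <= `|c| + `|T| -> F (x + T) - F x = F T - F 0.
  move=> xc.
  have h y z : y <= z -> `|y| <= `|c| + `|T| -> `|z| <= `|c| + `|T| ->
      F (y + T) - F y = F (z + T) - F z.
    rewrite !ler_norml => yz /andP[y1 y2] /andP[z1 z2].
    have := @MVT_segment _ (fun x => F (x + T) - F x) (fun=> 0) y z yz.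
    case.
    - move=> w; rewrite in_itv/= => /andP[w1 w2]; apply: dF1.
      by rewrite ler_norml; lra.
    - apply/subspace_continuousP => w /=; rewrite in_itv/= => /andP[w1 w2].
      apply: cvg_within_filter; apply: is_derive_at_continuous (dF1 w _).
      by rewrite ler_norml; lra.
    - by move=> w _; rewrite mul0r => /eqP; rewrite subr_eq0 => /eqP ->.
  have c00 : `|0 : R| <= `|c| + `|T| by rewrite normr0 addr_ge0.
  have := h 0 x; have := h x 0; rewrite add0r => h1 h2.
  by have [/h2->//|/ltW/h1->] := leP 0 x.
have cM x : `|x| <= `|c| + `|T| -> `|x| <= M by rewrite /M; lra.
have -> : int 0 T f = F T - F 0.
  apply: FTC2_itv => // x /andP[x0 xT]; apply: dF; apply: cM.
  by rewrite ger0_norm//; have := normr_ge0 c; have := ler_norm T; lra.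
have cM2 x : 0 <= x <= T -> `|(-1) ^+ e * x + c| <= M.
  move=> /andP[x0 xT]; apply: cM.
  have := ler_normD ((-1) ^+ e * x) c; rewrite normrMsign (ger0_norm x0).
  by have := ler_norm T; lra.
have dG x : 0 <= x <= T ->
    is_derive x 1 (fun s => (-1) ^+ e * F ((-1) ^+ e * s + c))
      (f ((-1) ^+ e * x + c)).
  move=> /cM2 /dF dFx.
  have d2 : is_derive x 1 (fun x : R => (-1) ^+ e * x + c) ((-1) ^+ e).
    have := is_deriveD (is_deriveZ ((-1) ^+ e) (is_derive_id x 1)) (is_derive_cst c x 1).
    by rewrite addr0 /GRing.scale/= mulr1.
  have := is_deriveZ ((-1) ^+ e) (@is_derive1_comp _ F (fun s => (-1) ^+ e * s + c) _ _ _ dFx d2).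
  by rewrite /GRing.scale/= mulrCA -expr2 sqrr_sign mulr1.
rewrite (FTC2_itv (F := fun s => (-1) ^+ e * F ((-1) ^+ e * s + c)))//; last first.
  move=> x; apply: continuous_comp; last exact: cf.
  apply: continuousD; last exact: cst_continuous.
  by apply: continuousM => //; exact: cst_continuous.
rewrite mulr0 add0r; case: e {cM2 dG} => /=.
  rewrite expr1 !mulN1r opprK addrC -(per (c - T)).
    by rewrite subrK [- T + c]addrC.
  by rewrite -normrN; have := ler_normB c T; rewrite normrN.
by rewrite expr0 !mul1r [T + c]addrC per// lerDl.
Qed.

End IntervalIntegral.

(** * Periodic functions with a square integrable derivative *)

Lemma normM_le_sqrD (R : realType) (x y : R) : `|x * y| <= `|x ^+ 2 + y ^+ 2|.
Proof.
rewrite [leRHS]ger0_norm; last by rewrite addr_ge0// sqr_ge0.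
by rewrite ler_norml; apply/andP; split; nra.
Qed.

(** Halving [a, b] n times divides the bound on the total increment by 2^n, because W
is additive. *)
Lemma bisection_constant (R : realType) (H : R -> R) (W : R -> R -> R) (a b : R) :
  a <= b ->
  (forall s t, a <= s -> s <= t -> t <= b -> `|H t - H s| <= (t - s) * W s t) ->
  (forall s m t, a <= s -> s <= m -> m <= t -> t <= b ->
     W s m + W m t = W s t) ->
  H b = H a.
Proof.
move=> ab HW Wadd.
have bound n : forall s t, a <= s -> s <= t -> t <= b ->
    `|H t - H s| <= (t - s) / 2 ^+ n * W s t.
  elim: n => [|n IHn] s t as_ st tb; first by rewrite expr0 divr1 HW.
  pose mid := (s + t) / 2.
  have sm : s <= mid by rewrite /mid; lra.
  have mt : mid <= t by rewrite /mid; lra.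
  have h1 := IHn s mid as_ sm (le_trans mt tb).
  have h2 := IHn mid t (le_trans as_ sm) mt tb.
  rewrite -(Wadd s mid t)//.
  have -> : H t - H s = (H t - H mid) + (H mid - H s) by lra.
  apply: le_trans (ler_normD _ _) _.
  have -> : (t - s) / 2 ^+ n.+1 = (mid - s) / 2 ^+ n.
    by rewrite exprS invfM /mid; field; rewrite expf_neq0.
  have -> : (mid - s) / 2 ^+ n * (W s mid + W mid t) =
     (t - mid) / 2 ^+ n * W mid t + (mid - s) / 2 ^+ n * W s mid.
    by rewrite /mid; field; rewrite expf_neq0.
  exact: lerD.
apply/eqP; rewrite -subr_eq0 -normr_le0.
have cvg0 : (b - a) / 2 ^+ n * W a b @[n --> \oo] --> (0 : R).
  rewrite (_ : (fun n => _) = (fun n => ((b - a) * W a b) * (2^-1) ^+ n)).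
    rewrite -[X in _ --> X](mulr0 ((b - a) * W a b)).
    apply: cvgMr; apply: cvg_expr; rewrite ger0_norm; lra.
  by apply/funext => n; rewrite exprVn mulrAC.
apply: (ler_cvg_to (cvg_cst _) cvg0); apply: nearW => n.
exact: bound.
Qed.

Section PeriodicSobolev.
Context {R : realType} (T : R).
Hypothesis T_gt0 : 0 < T.
Implicit Types (f g h v w : R -> R) (a b c t s x : R).
Notation mu := (@lebesgue_measure R).
Local Notation int a b f := (Rintegral mu [set` `[a, b]] f).
Local Notation sq := (square_integrable T).

Let T_ge0 : 0 <= T. Proof. exact: ltW. Qed.

Lemma square_integrable_continuous f : continuous f -> sq f.
Proof.
move=> cf; split.
  by apply: measurable_funTS; exact: continuous_measurable_fun.
apply: (@continuous_itv_integrable _ 0 T (fun t => f t ^+ 2)) => x.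
rewrite (_ : (fun t => f t ^+ 2) = (fun t => f t * f t)); last exact/funext.
by apply: continuousM; exact: cf.
Qed.

Lemma square_integrableM f g : sq f -> sq g ->
  itv_integrable 0 T (fun t => f t * g t).
Proof.
move=> [mf f2] [mg g2].
have i2 : itv_integrable 0 T (fun t => f t ^+ 2 + g t ^+ 2).
  exact: itv_integrableD.
apply: (le_integrable _ _ _ i2) => //=.
  by apply/measurable_EFinP; exact: measurable_funM.
by move=> t _; rewrite lee_fin; exact: normM_le_sqrD.
Qed.

Lemma square_integrable_int f : sq f -> itv_integrable 0 T f.
Proof.
move=> sf; have s1 := square_integrable_continuous (@cst_continuous _ _ (1 : R)).
have := square_integrableM sf s1.
by under eq_fun do rewrite mulr1.
Qed.

Lemma square_integrableD f g : sq f -> sq g -> sq (fun t => f t + g t).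
Proof.
move=> sf sg; have fg := square_integrableM sf sg.
case: sf sg => mf f2 [mg g2]; split; first exact: measurable_funD.
have -> : (fun t => ((f t + g t) ^+ 2)%:E) =
    EFin \o (fun t => (f t ^+ 2 + 2 * (f t * g t)) + g t ^+ 2).
  by apply/funext => t /=; congr EFin; ring.
by apply: itv_integrableD => //; apply: itv_integrableD => //; exact: itv_integrableZ.
Qed.

Lemma square_integrableZ k f : sq f -> sq (fun t => k * f t).
Proof.
case=> mf f2; split; first by apply: measurable_funM.
have -> : (fun t => ((k * f t) ^+ 2)%:E) = EFin \o (fun t => k ^+ 2 * f t ^+ 2).
  by apply/funext => t /=; congr EFin; ring.
exact: itv_integrableZ.
Qed.

Lemma square_integrableB f g : sq f -> sq g -> sq (fun t => f t - g t).
Proof.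
move=> sf sg; have := square_integrableD sf (square_integrableZ (-1) sg).
by under eq_fun do rewrite mulN1r.
Qed.

Lemma square_integrable_sum (I : Type) (r : seq I) (P : pred I) (F : I -> R -> R) :
  (forall i, P i -> sq (F i)) -> sq (fun t => \sum_(i <- r | P i) F i t).
Proof.
move=> Fi; elim: r => [|i r IHr].
  under eq_fun do rewrite big_nil.
  exact: square_integrable_continuous (@cst_continuous _ _ 0).
under eq_fun do rewrite big_cons.
by case: (boolP (P i)) => // Pi; apply: square_integrableD => //; exact: Fi.
Qed.

Definition ip f g := int 0 T (fun t => f t * g t).

Lemma ipC f g : ip f g = ip g f.
Proof. by apply: eq_int => t _; rewrite mulrC. Qed.

Lemma ip0l g : ip (fun=> 0) g = 0.
Proof. by rewrite /ip; under eq_Rintegral do rewrite mul0r; rewrite int_cst// mul0r. Qed.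

Lemma ip0r g : ip g (fun=> 0) = 0.
Proof. by rewrite ipC ip0l. Qed.

Lemma ipDl f g h : sq f -> sq g -> sq h ->
  ip (fun t => f t + g t) h = ip f h + ip g h.
Proof.
move=> sf sg sh; rewrite /ip -intD; [|exact: square_integrableM..].
by apply: eq_int => t _; rewrite mulrDl.
Qed.

Lemma ipZl k f h : sq f -> sq h -> ip (fun t => k * f t) h = k * ip f h.
Proof.
move=> sf sh; rewrite /ip -intZ; last exact: square_integrableM.
by apply: eq_int => t _; rewrite mulrA.
Qed.

Lemma ipBl f g h : sq f -> sq g -> sq h ->
  ip (fun t => f t - g t) h = ip f h - ip g h.
Proof.
move=> sf sg sh; rewrite /ip -intB; [|exact: square_integrableM..].
by apply: eq_int => t _; rewrite mulrBl.
Qed.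

Lemma ipDr f g h : sq f -> sq g -> sq h ->
  ip h (fun t => f t + g t) = ip h f + ip h g.
Proof. by move=> *; rewrite ipC ipDl// ipC [ip g _]ipC. Qed.

Lemma ipBr f g h : sq f -> sq g -> sq h ->
  ip h (fun t => f t - g t) = ip h f - ip h g.
Proof. by move=> *; rewrite ipC ipBl// ipC [ip g _]ipC. Qed.

Lemma ipZr k f h : sq f -> sq h -> ip h (fun t => k * f t) = k * ip h f.
Proof. by move=> *; rewrite ipC ipZl// ipC. Qed.

Lemma ip_ge0 f : 0 <= ip f f.
Proof. by apply: int_ge0 => t _; rewrite -expr2 sqr_ge0. Qed.

Lemma eq_ip f f' g g' : (forall t, 0 <= t <= T -> f t = f' t) ->
  (forall t, 0 <= t <= T -> g t = g' t) -> ip f g = ip f' g'.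
Proof. by move=> ff gg; apply: eq_int => t tT; rewrite ff ?gg. Qed.

(** The Sobolev space H^1 of the circle: f is the continuous representative, and v a
choice of its derivative, which is determined only up to a null set. *)
Record H1 f v : Prop := MkH1 {
  H1_periodic : forall t, f (t + T) = f t;
  H1_deriv : sq v;
  H1_int : forall t, 0 <= t <= T -> f t = f 0 + int 0 t v }.

Lemma H1D f g v w : H1 f v -> H1 g w ->
  H1 (fun t => f t + g t) (fun t => v t + w t).
Proof.
move=> [fp sv fi] [gp sw gi]; split; first by move=> t; rewrite fp gp.
  exact: square_integrableD.
move=> t /andP[t0 tT].
have tT' : 0 <= t <= T by rewrite t0.
rewrite (fi t tT') (gi t tT') intD; first by rewrite addrACA.
  by apply: itv_integrableS (square_integrable_int sv).
by apply: itv_integrableS (square_integrable_int sw).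
Qed.

Lemma H1Z k f v : H1 f v -> H1 (fun t => k * f t) (fun t => k * v t).
Proof.
move=> [fp sv fi]; split; first by move=> t; rewrite fp.
  exact: square_integrableZ.
move=> t /andP[t0 tT]; have tT' : 0 <= t <= T by rewrite t0.
rewrite (fi t tT') intZ; first by rewrite mulrDr.
by apply: itv_integrableS (square_integrable_int sv).
Qed.

Lemma H1B f g v w : H1 f v -> H1 g w ->
  H1 (fun t => f t - g t) (fun t => v t - w t).
Proof.
move=> fv gw; have := H1D fv (H1Z (-1) gw).
by under eq_fun do rewrite mulN1r; under [X in H1 _ X]eq_fun do rewrite mulN1r.
Qed.

Lemma H1_C1 f v : (forall t, f (t + T) = f t) -> continuous v ->
  (forall x, is_derive x 1 f (v x)) -> H1 f v.
Proof.
move=> fp cv df; split=> //; first exact: square_integrable_continuous.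
by move=> t /andP[t0 tT]; rewrite (@FTC2_itv _ _ _ f)// addrC subrK.
Qed.

Lemma H1_increment f v s t : H1 f v -> 0 <= s -> s <= t -> t <= T ->
  f t - f s = int s t v.
Proof.
move=> [_ sv fi] s0 st tT.
have t01 : 0 <= t <= T by rewrite (le_trans s0 st).
have s01 : 0 <= s <= T by rewrite s0 (le_trans st tT).
rewrite (fi t t01) (fi s s01) opprD addrACA subrr add0r.
rewrite (@int_split _ 0 t s) ?s0//; first by rewrite addrAC subrr add0r.
by apply: itv_integrableS (square_integrable_int sv).
Qed.

(** Expanding int (L v - int v)^2 >= 0 with L = t - s. *)
Lemma int_cauchy_schwarz v s t : sq v -> 0 <= s -> s <= t -> t <= T ->
  (int s t v) ^+ 2 <= (t - s) * ip v v.
Proof.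
move=> sv s0 st tT; have v2 : itv_integrable s t (fun x => v x * v x).
  by apply: itv_integrableS (square_integrableM sv sv).
have vi : itv_integrable s t v.
  by apply: itv_integrableS (square_integrable_int sv).
have sub : int s t (fun x => v x * v x) <= ip v v.
  rewrite /ip (@int_split _ 0 T s) ?s0 ?(le_trans st)//; last first.
    exact: square_integrableM.
  rewrite (@int_split _ s T t) ?st//; last first.
    by apply: itv_integrableS (square_integrableM sv sv).
  rewrite addrCA lerDl addr_ge0//; apply: int_ge0 => x _; exact: sqr_ge0.
move: (st); rewrite le_eqVlt => /predU1P[<-|lt_st].
  by rewrite subrr mul0r set_itv1 Rintegral_set1 expr0n.
have L0 : 0 < t - s by rewrite subr_gt0.
set c := int s t v; pose L := t - s.
have : 0 <= int s t (fun x => (L * v x - c) ^+ 2).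
  by apply: int_ge0 => x _; exact: sqr_ge0.
have -> : int s t (fun x => (L * v x - c) ^+ 2) =
    int s t (fun x => (L ^+ 2 * (v x * v x) - (2 * L * c) * v x) + c ^+ 2).
  by apply: eq_int => x _; ring.
have i1 : itv_integrable s t (fun x => L ^+ 2 * (v x * v x)) by exact: itv_integrableZ.
have i2 : itv_integrable s t (fun x => (2 * L * c) * v x) by exact: itv_integrableZ.
rewrite intD; last 2 first.
- exact: itv_integrableB.
- exact: continuous_itv_integrable (@cst_continuous _ _ _).
rewrite int_cst// intB// !intZ// -/c -/L.
set A := int s t _ in sub *.
have {}sub : A <= ip v v := sub.
move: A sub => A sub; clear i2; move: c => c.
have -> : L ^+ 2 * A - 2 * L * c * c + c ^+ 2 * L = L * (L * A - c ^+ 2) by ring.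
rewrite pmulr_rge0// subr_ge0 => /le_trans; apply.
by rewrite ler_pM2l.
Qed.

(** Integration by parts when one factor is only H^1: the defect H of the formula
satisfies |H(t) - H(s)| <= 2 C (t - s) int_s^t |v|, a bound that bisection
improves indefinitely. *)
Lemma H1_ibp f v g g' (C : R) : H1 f v -> continuous f ->
  (forall t, g (t + T) = g t) -> continuous g' ->
  (forall x, is_derive x 1 g (g' x)) -> (forall x, `|g' x| <= C) ->
  ip v g = - ip f g'.
Proof.
move=> fv cf gp cg' dg gC; have sv := H1_deriv fv.
have cg := is_derive_continuous dg.
have sg := square_integrable_continuous cg.
have sg' := square_integrable_continuous cg'.
have sf := square_integrable_continuous cf.
have vg := square_integrableM sv sg.
have fg' := square_integrableM sf sg'.
have vi := square_integrable_int sv.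
have ni := itv_integrable_norm vi.
have C0 : 0 <= C := le_trans (normr_ge0 _) (gC 0).
pose H t := int 0 t (fun x => v x * g x) + int 0 t (fun x => f x * g' x) - f t * g t.
suff : H T = H 0.
  rewrite /H set_itv1 !Rintegral_set1 add0r -/(ip v g) -/(ip f g').
  rewrite -[T in f T]add0r -[T in g T]add0r (H1_periodic fv) gp => /eqP.
  by rewrite subr_eq subrK addr_eq0 => /eqP.
apply: (@bisection_constant _ H (fun s t => 2 * C * int s t (fun x => `|v x|))) => //; last first.
  move=> s m t s0 sm mt tT; rewrite -mulrDr -int_split ?sm ?mt//.
  exact: itv_integrableS ni.
move=> s t s0 st tT.
have sub (h : R -> R) : itv_integrable 0 T h -> itv_integrable s t h.
  exact: itv_integrableS.
have sub0 (h : R -> R) : itv_integrable 0 T h -> itv_integrable 0 t h.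
  exact: itv_integrableS.
have gst x : s <= x <= t -> `|g x - g t| <= C * (t - s).
  move=> /andP[sx xt].
  have [c _ e] := MVT_segment xt (fun x _ => dg x) (continuous_subspaceT cg).
  rewrite -normrN opprB e normrM; apply: ler_pM => //.
  by rewrite ger0_norm; lra.
have fst x : s <= x <= t -> `|f x - f s| <= int s t (fun x => `|v x|).
  move=> /andP[sx xt].
  rewrite (H1_increment fv s0 sx (le_trans xt tT)).
  apply: le_trans (int_norm_le _) _.
    by apply: itv_integrableS vi => //; exact: le_trans tT.
  rewrite (@int_split _ s t x) ?sx//; last exact: sub.
  by rewrite lerDl int_ge0.
have -> : H t - H s =
    int s t (fun x => v x * (g x - g t)) + int s t (fun x => (f x - f s) * g' x).
  have e1 : int s t (fun x => v x * (g x - g t)) =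
      int s t (fun x => v x * g x) - g t * (f t - f s).
    rewrite (H1_increment fv s0 st tT) -intZ; last exact: sub.
    rewrite -intB; [|exact: sub|by apply: itv_integrableZ; exact: sub].
    by apply: eq_int => x _; ring.
  have e2 : int s t (fun x => (f x - f s) * g' x) =
      int s t (fun x => f x * g' x) - f s * (g t - g s).
    rewrite -(@FTC2_itv _ s t g g')// -intZ; last exact: continuous_itv_integrable.
    rewrite -intB; [|exact: sub|]; last first.
      by apply: itv_integrableZ; exact: continuous_itv_integrable.
    by apply: eq_int => x _; ring.
  rewrite /H e1 e2 (@int_split _ 0 t s) ?s0//; last exact: sub0.
  rewrite (@int_split _ 0 t s (fun x => f x * g' x)) ?s0//; last exact: sub0.
  do 4 (set I := (\int[_]_(x in _) _); move: I => ?).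
  ring.
have i1 : itv_integrable s t (fun x => v x * (g x - g t)).
  apply: sub; apply: square_integrableM => //; apply: square_integrableB => //.
  exact: square_integrable_continuous (@cst_continuous _ _ _).
have i2 : itv_integrable s t (fun x => (f x - f s) * g' x).
  apply: sub; apply: square_integrableM => //; apply: square_integrableB => //.
  exact: square_integrable_continuous (@cst_continuous _ _ _).
set V := int s t (fun x => `|v x|) in fst *.
have b1 : `|int s t (fun x => v x * (g x - g t))| <= C * (t - s) * V.
  apply: le_trans (int_norm_le i1) _; rewrite -intZ; last exact: sub.
  apply: le_int; [exact: itv_integrable_norm|by apply: itv_integrableZ; exact: sub|].
  by move=> x xst; rewrite normrM mulrC ler_wpM2r// gst.
have b2 : `|int s t (fun x => (f x - f s) * g' x)| <= V * C * (t - s).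
  apply: le_trans (int_norm_le i2) _; rewrite -int_cst//.
  apply: le_int; [exact: itv_integrable_norm| |].
    exact: continuous_itv_integrable (@cst_continuous _ _ _).
  by move=> x xst; rewrite normrM; apply: ler_pM => //; exact: fst.
apply: le_trans (ler_normD _ _) _; apply: le_trans (lerD b1 b2) _.
by rewrite le_eqVlt; apply/orP; left; apply/eqP; ring.
Qed.

End PeriodicSobolev.

(** * Trigonometric functions and periodicity *)

Lemma is_derive_cos_affine (R : realType) (k u x : R) :
  is_derive x 1 (fun s => cos (k * s + u)) (- (k * sin (k * x + u))).
Proof.
have d : is_derive x 1 (fun s : R => k * s + u) k.
  have := is_deriveD (is_deriveZ k (is_derive_id x 1)) (is_derive_cst u x 1).
  by rewrite addr0 /GRing.scale/= mulr1.
have := @is_derive1_comp _ cos (fun s => k * s + u) _ _ _ (is_derive_cos _) d.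
by rewrite mulNr mulrC.
Qed.

Lemma is_derive_sin_affine (R : realType) (k u x : R) :
  is_derive x 1 (fun s => sin (k * s + u)) (k * cos (k * x + u)).
Proof.
have d : is_derive x 1 (fun s : R => k * s + u) k.
  have := is_deriveD (is_deriveZ k (is_derive_id x 1)) (is_derive_cst u x 1).
  by rewrite addr0 /GRing.scale/= mulr1.
have := @is_derive1_comp _ sin (fun s => k * s + u) _ _ _ (is_derive_sin _) d.
by rewrite mulrC.
Qed.

Lemma is_derive_cosM (R : realType) (k x : R) :
  is_derive x 1 (fun s => cos (k * s)) (- (k * sin (k * x))).
Proof.
have := is_derive_cos_affine k 0 x; rewrite addr0.
by under eq_fun do rewrite addr0.
Qed.

Lemma is_derive_sinM (R : realType) (k x : R) :
  is_derive x 1 (fun s => sin (k * s)) (k * cos (k * x)).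
Proof.
have := is_derive_sin_affine k 0 x; rewrite addr0.
by under eq_fun do rewrite addr0.
Qed.

Lemma continuous_cosM (R : realType) (k : R) : continuous (fun s => cos (k * s)).
Proof. exact: is_derive_continuous (is_derive_cosM k). Qed.

Lemma continuous_sinM (R : realType) (k : R) : continuous (fun s => sin (k * s)).
Proof. exact: is_derive_continuous (is_derive_sinM k). Qed.

(** Since sin x = 2 sin (x/2) cos (x/2), the mean value theorem at x/2 gives
sin x >= x cos^2 (x/2) >= x/2, the last step because cos x >= 0. *)
Lemma sin_ge_half (R : realType) (x : R) : 0 <= x <= pi / 2 -> x / 2 <= sin x.
Proof.
move=> /andP[x0 xpi]; pose y := x / 2; have pi0 := pi_gt0 R.
have y0 : 0 <= y by rewrite /y; lra.
have ypi : y <= pi by rewrite /y; lra.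
have [c] := MVT_segment y0 (fun x _ => is_derive_sin x) (continuous_subspaceT (@continuous_sin R)).
rewrite in_itv/= => /andP[c0 cy]; rewrite sin0 !subr0 => sy.
have cc : cos y <= cos c.
  move: cy; rewrite le_eqVlt => /predU1P[->//|cy]; apply/ltW.
  by rewrite ltr_cos// in_itv/= ?c0 ?y0 ?ypi// (le_trans (ltW cy)).
have cosy0 : 0 <= cos y by apply: cos_ge0_pihalf; rewrite /y; lra.
have cosx0 : 0 <= cos x by apply: cos_ge0_pihalf; lra.
have xE : x = y *+ 2 by rewrite /y -mulr_natr; lra.
have cx : cos x = cos y ^+ 2 *+ 2 - 1 by rewrite {1}xE cos_mulr2n.
rewrite {2}xE sin_mulr2n sy -mulr_natr.
have h1 : cos y * (cos c * y) >= cos y ^+ 2 * y.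
  by rewrite mulrA expr2 ler_wpM2r// ler_wpM2l.
have h2 : 2^-1 <= cos y ^+ 2 by move: cx; rewrite -mulr_natr; lra.
have h3 : 2^-1 * y <= cos y ^+ 2 * y by rewrite ler_wpM2r.
by rewrite -/y; move: h1 h3; rewrite /y; lra.
Qed.

Lemma periodic_int (R : realType) (X : Type) (T : R) (f : R -> X) :
  (forall t, f (t + T) = f t) -> forall (n : int) t, f (t + n%:~R * T) = f t.
Proof.
move=> fp; have pos n t : f (t + n%:R * T) = f t.
  elim: n t => [|n IHn] t; first by rewrite mul0r addr0.
  by rewrite mulrS mulrDl mul1r addrA addrAC fp IHn.
case=> n t; first exact: pos.
by rewrite NegzE mulrNz mulNr -(pos n.+1 (t - _)) subrK.
Qed.

Lemma periodic_reduction (R : realType) (T t : R) : 0 < T ->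
  exists n : int, 0 <= t + n%:~R * T <= T.
Proof.
move=> T0; exists (- Num.floor (t / T)).
have fl := floor_le_tmp (t / T); have lf := floorD1_gt (t / T).
rewrite mulrNz mulNr; apply/andP; split.
  by rewrite subr_ge0 -ler_pdivlMr//.
rewrite lerBlDr -[X in X + _]mul1r -mulrDl -ler_pdivrMr// addrC.
by move/ltW: lf; rewrite intrD.
Qed.

(** * Fourier modes *)

Section Fourier.
Context {R : realType} (omega T : R).
Hypothesis omega_gt0 : 0 < omega.
Hypothesis T_def : T = 2 * pi / omega.
Implicit Types (f g h v w : R -> R) (a b c t s x : R).
Notation mu := (@lebesgue_measure R).
Local Notation int a b f := (Rintegral mu [set` `[a, b]] f).
Local Notation sq := (square_integrable T).
Local Notation H1 := (H1 T).
Local Notation ip := (ip T).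

Lemma period_gt0 : 0 < T.
Proof. by rewrite T_def divr_gt0// mulr_gt0// pi_gt0. Qed.
Local Notation T_gt0 := period_gt0.
Let T_ge0 : 0 <= T. Proof. exact: ltW T_gt0. Qed.

Lemma omegaT : omega * T = pi *+ 2.
Proof. by rewrite T_def mulrC mulfVK ?gt_eqF// mulr_natl. Qed.

Lemma half_omegaT : omega / 2 * T = pi.
Proof. by rewrite mulrAC omegaT -[pi *+ 2]mulr_natr mulfK. Qed.

Lemma cos_periodic (n : nat) u t :
  cos (n%:R * omega * (t + T) + u) = cos (n%:R * omega * t + u).
Proof.
rewrite mulrDr -[_ * omega * T]mulrA omegaT addrAC [n%:R * (pi *+ 2)]mulr_natl.
by rewrite (periodicn (@cosD2pi R)).
Qed.

Lemma sin_periodic (n : nat) u t :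
  sin (n%:R * omega * (t + T) + u) = sin (n%:R * omega * t + u).
Proof.
rewrite mulrDr -[_ * omega * T]mulrA omegaT addrAC [n%:R * (pi *+ 2)]mulr_natl.
by rewrite (periodicn (@sinD2pi R)).
Qed.

Definition cosn (n : nat) := fun t => cos (n%:R * omega * t).
Definition sinn (n : nat) := fun t => sin (n%:R * omega * t).

Lemma cosn_periodic n t : cosn n (t + T) = cosn n t.
Proof. by have := cos_periodic n 0 t; rewrite !addr0. Qed.

Lemma sinn_periodic n t : sinn n (t + T) = sinn n t.
Proof. by have := sin_periodic n 0 t; rewrite !addr0. Qed.

Lemma continuous_cosn n : continuous (cosn n).
Proof. exact: continuous_cosM. Qed.

Lemma continuous_sinn n : continuous (sinn n).
Proof. exact: continuous_sinM. Qed.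

Lemma sq_cosn n : sq (cosn n).
Proof. by apply: square_integrable_continuous; exact: continuous_cosn. Qed.

Lemma sq_sinn n : sq (sinn n).
Proof. by apply: square_integrable_continuous; exact: continuous_sinn. Qed.

(** Two points at distance at most T/2 are joined directly, the others along the
complementary arc, through the end points 0 and T. *)
Lemma H1_square_bound f v s t : H1 f v -> 0 <= s -> s <= t -> t <= T ->
  (f t - f s) ^+ 2 <= 2 * T * `|sin (omega / 2 * (t - s))| * ip v v.
Proof.
move=> fv s0 st tT; have V0 := ip_ge0 T v; have pi2 := pi_ge2 R.
pose d := t - s; have d0 : 0 <= d by rewrite /d; lra.
have dT : d <= T by rewrite /d; lra.
have key x : 0 <= x -> x <= T / 2 ->
    2 * x <= 2 * T * `|sin (omega / 2 * x)|.
  move=> x0 xT; have w0 : 0 < omega / 2 by rewrite divr_gt0.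
  have h : 0 <= omega / 2 * x <= pi / 2.
    rewrite mulr_ge0//=; last exact: ltW.
    by rewrite -half_omegaT -[_ * T / 2]mulrA ler_pM2l.
  have := sin_ge_half h => sh.
  apply: le_trans (_ : 2 * T * (omega / 2 * x / 2) <= _); last first.
    by rewrite ler_wpM2l ?mulr_ge0//; exact: le_trans sh (ler_norm _).
  rewrite (_ : 2 * T * _ = omega / 2 * T * x); last by field.
  by rewrite half_omegaT ler_wpM2r.
have [dle|dge] := leP d (T / 2).
  rewrite (H1_increment fv s0 st tT).
  apply: le_trans (int_cauchy_schwarz (H1_deriv fv) s0 st tT) _.
  rewrite ler_wpM2r// -/d; apply: le_trans (key _ d0 dle).
  by lra.
have fT : f T = f 0 by rewrite -(H1_periodic fv 0) add0r.
have e : f t - f s = - ((f T - f t) + (f s - f 0)) by rewrite fT; ring.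
have tT' : 0 <= t by lra.
have sT' : s <= T by lra.
have i1 : (f T - f t) ^+ 2 <= (T - t) * ip v v.
  by rewrite (H1_increment fv)//; apply: int_cauchy_schwarz (H1_deriv fv) _ _ _.
have i2 : (f s - f 0) ^+ 2 <= s * ip v v.
  rewrite (H1_increment fv)//; rewrite -[s in s * _]subr0.
  exact: int_cauchy_schwarz (H1_deriv fv) _ _ _.
have k : 2 * (T - d) <= 2 * T * `|sin (omega / 2 * d)|.
  have -> : omega / 2 * d = pi - omega / 2 * (T - d) by rewrite -half_omegaT; ring.
  rewrite sinB sinpi cospi mul0r sub0r mulN1r opprK.
  by apply: key; lra.
apply: le_trans (_ : 2 * (T - d) * ip v v <= _); last by rewrite ler_wpM2r.
rewrite e sqrrN.
move: (ip v v) V0 i1 i2 => V V0; rewrite /d.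
move: (f T - f t) (f s - f 0) => A B i1 i2.
have : 0 <= (A - B) ^+ 2 by exact: sqr_ge0.
nra.
Qed.

(** The sine plays the part of the distance on the circle: it makes the bound of
[H1_square_bound] periodic in s and t, so that it extends to all of R. *)
Lemma H1_circle_holder f v s t : H1 f v ->
  (f t - f s) ^+ 2 <= 2 * T * `|sin (omega / 2 * (t - s))| * ip v v.
Proof.
move=> fv.
have sinp x : `|sin (omega / 2 * (x + T))| = `|sin (omega / 2 * x)|.
  by rewrite mulrDr half_omegaT sinDpi normrN.
have sinN x y : `|sin (omega / 2 * (x - y))| = `|sin (omega / 2 * (y - x))|.
  by rewrite -opprB mulrN sinN normrN.
have [n /andP[t0 tT]] := periodic_reduction t T_gt0.
have [k /andP[s0 sT]] := periodic_reduction s T_gt0.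
have -> : f t = f (t + n%:~R * T) by rewrite (periodic_int (H1_periodic fv)).
have -> : f s = f (s + k%:~R * T) by rewrite (periodic_int (H1_periodic fv)).
have -> : `|sin (omega / 2 * (t - s))| =
    `|sin (omega / 2 * ((t + n%:~R * T) - (s + k%:~R * T)))|.
  rewrite -(@periodic_int _ _ T (fun x => `|sin (omega / 2 * x)|) sinp (n - k)).
  by congr (`|sin (_ * _)|); rewrite rmorphB/=; ring.
move: (t + _) (s + _) t0 tT s0 sT => {}t {}s t0 tT s0 sT.
have [st|/ltW ts] := leP s t; first exact: H1_square_bound.
by rewrite -sqrrN opprB sinN; exact: H1_square_bound.
Qed.

Lemma H1_continuous f v : H1 f v -> continuous f.
Proof.
move=> fv s.
pose psi (t : R) : R := 2 * T * `|sin (omega / 2 * (t - s))| * ip v v.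
have cpsi : continuous psi.
  move=> t; apply: cvgMl; apply: cvgMr; apply: cvg_norm.
  have := is_derive_at_continuous (is_derive_sin_affine (omega / 2) (- (omega / 2 * s)) t).
  by rewrite /continuous_at /prop_for; under eq_fun do rewrite -mulrBr; rewrite -mulrBr.
pose phi (t : R) : R := Num.sqrt (psi t).
have cphi : continuous phi.
  by move=> t; exact: (cvg_comp _ _ (cpsi t) (@sqrt_continuous R (psi t))).
have phis : phi s = 0 by rewrite /phi /psi subrr mulr0 sin0 normr0 mulr0 mul0r sqrtr0.
apply/cvgrPdist_lt => e e0.
have /cvgrPdist_lt/(_ e e0) := cphi s; rewrite phis.
apply: filterS => t; rewrite sub0r normrN ger0_norm ?sqrtr_ge0//.
apply: le_lt_trans; rewrite -sqrtr_sqr; apply: ler_wsqrtr.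
by rewrite -sqrrN opprB; exact: H1_circle_holder.
Qed.

Lemma sq_H1 f v : H1 f v -> sq f.
Proof. by move=> fv; apply: square_integrable_continuous; exact: H1_continuous fv. Qed.

Lemma is_derive_cosn n x : is_derive x 1 (cosn n) (- (n%:R * omega) * sinn n x).
Proof. by rewrite mulNr; exact: is_derive_cosM. Qed.

Lemma is_derive_sinn n x : is_derive x 1 (sinn n) (n%:R * omega * cosn n x).
Proof. exact: is_derive_sinM. Qed.

Lemma continuousZ_fun (k : R) f : continuous f -> continuous (fun t => k * f t).
Proof. by move=> cf x; apply: continuousM; [exact: cst_continuous|exact: cf]. Qed.

Lemma H1_cosn n : H1 (cosn n) (fun t => - (n%:R * omega) * sinn n t).
Proof.
apply: H1_C1; [exact: cosn_periodic| |exact: is_derive_cosn].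
by apply: continuousZ_fun; exact: continuous_sinn.
Qed.

Lemma H1_sinn n : H1 (sinn n) (fun t => n%:R * omega * cosn n t).
Proof.
apply: H1_C1; [exact: sinn_periodic| |exact: is_derive_sinn].
by apply: continuousZ_fun; exact: continuous_cosn.
Qed.

Lemma ip_deriv_cosn n f v : H1 f v -> ip v (cosn n) = n%:R * omega * ip f (sinn n).
Proof.
move=> fv; have n0 : 0 <= n%:R * omega by rewrite mulr_ge0// ltW.
have bound x : `|- (n%:R * omega) * sinn n x| <= n%:R * omega.
  by rewrite mulNr normrN normrM ger0_norm// ler_piMr// sin_max.
have ca := @continuousZ_fun (- (n%:R * omega)) _ (@continuous_sinn n).
rewrite (H1_ibp T_gt0 fv (H1_continuous fv) (cosn_periodic n) ca (is_derive_cosn n) bound).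
by rewrite ipZr ?mulNr ?opprK//; [exact: sq_sinn|exact: sq_H1 fv].
Qed.

Lemma ip_deriv_sinn n f v : H1 f v ->
  ip v (sinn n) = - (n%:R * omega * ip f (cosn n)).
Proof.
move=> fv; have n0 : 0 <= n%:R * omega by rewrite mulr_ge0// ltW.
have bound x : `|n%:R * omega * cosn n x| <= n%:R * omega.
  by rewrite normrM ger0_norm// ler_piMr// cos_max.
have ca := @continuousZ_fun (n%:R * omega) _ (@continuous_cosn n).
rewrite (H1_ibp T_gt0 fv (H1_continuous fv) (sinn_periodic n) ca (is_derive_sinn n) bound).
by rewrite ipZr//; [exact: sq_cosn|exact: sq_H1 fv].
Qed.

(** Integration by parts moves the frequency from one factor to the other. *)
Lemma ibp_modes n m :
  [/\ n%:R * ip (sinn n) (cosn m) = - (m%:R * ip (cosn n) (sinn m)),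
      n%:R * ip (sinn n) (sinn m) = m%:R * ip (cosn n) (cosn m),
      n%:R * ip (cosn n) (cosn m) = m%:R * ip (sinn n) (sinn m)
    & n%:R * ip (cosn n) (sinn m) = - (m%:R * ip (sinn n) (cosn m))].
Proof.
have w0 : omega != 0 by rewrite gt_eqF.
have e1 := ip_deriv_cosn m (H1_cosn n).
have e2 := ip_deriv_sinn m (H1_cosn n).
have e3 := ip_deriv_cosn m (H1_sinn n).
have e4 := ip_deriv_sinn m (H1_sinn n).
rewrite !ipZl in e1 e2 e3 e4; try exact: sq_cosn; try exact: sq_sinn.
by split; apply: (mulfI w0); lra.
Qed.

(** Two integrations by parts turn n^2 <., .> into m^2 <., .>. *)
Lemma ip_modes_neq n m : n != m ->
  [/\ ip (cosn n) (cosn m) = 0, ip (sinn n) (sinn m) = 0,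
      ip (sinn n) (cosn m) = 0 & ip (cosn n) (sinn m) = 0].
Proof.
move=> nm.
have h : (n%:R ^+ 2 - m%:R ^+ 2 : R) != 0.
  rewrite subr_eq0 eqf_sqr negb_or eqr_nat nm/= -subr_eq0 opprK -natrD pnatr_eq0 addn_eq0.
  by case: n m nm => [|n] [|m].
have [a1 a2 a3 a4] := ibp_modes n m.
split; apply: (mulfI h); rewrite mulr0 mulrBl !expr2 -!mulrA.
- by rewrite a3 mulrCA a2 subrr.
- by rewrite a2 mulrCA a3 subrr.
- by rewrite a1 mulrN mulrCA a4 mulrN opprK subrr.
- by rewrite a4 mulrN mulrCA a1 mulrN opprK subrr.
Qed.

Lemma sinn0 : sinn 0 = cst 0.
Proof. by apply/funext => t; rewrite /sinn !mul0r sin0. Qed.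

Lemma cosn0 : cosn 0 = cst 1.
Proof. by apply/funext => t; rewrite /cosn !mul0r cos0. Qed.

Lemma ip_cosn_cosn0 : ip (cosn 0) (cosn 0) = T.
Proof.
rewrite cosn0 /ip (_ : (fun t => _) = cst (1 : R)); last by apply/funext => t/=; rewrite mulr1.
by rewrite int_cst// mul1r subr0.
Qed.

Lemma ip_cosn_sinn n m : ip (cosn n) (sinn m) = 0.
Proof.
have [->|/ip_modes_neq[]//] := eqVneq n m.
have [_ _ _ a4] := ibp_modes m m.
case: m a4 => [_|m]; first by rewrite sinn0 (ip0r T_gt0).
rewrite [ip (sinn _) _]ipC => /eqP; rewrite -subr_eq0 opprK -mulr2n mulrn_eq0/= mulf_eq0 pnatr_eq0/=.
by move=> /eqP.
Qed.

Lemma ip_modes_diag n : (0 < n)%N ->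
  ip (cosn n) (cosn n) = T / 2 /\ ip (sinn n) (sinn n) = T / 2.
Proof.
move=> n0; have [_ a2 _ _] := ibp_modes n n.
have nR : n%:R != 0 :> R by rewrite pnatr_eq0 -lt0n.
have e : ip (sinn n) (sinn n) = ip (cosn n) (cosn n) by apply: (mulfI nR).
suff : ip (cosn n) (cosn n) + ip (sinn n) (sinn n) = T by rewrite e; move: (ip _ _) => A h; split; lra.
rewrite /ip -intD.
- rewrite (_ : (fun t => _) = cst (1 : R)) ?int_cst ?mul1r ?subr0//.
  by apply/funext => t/=; rewrite -!expr2 cos2Dsin2.
- exact: square_integrableM (sq_cosn n) (sq_cosn n).
- exact: square_integrableM (sq_sinn n) (sq_sinn n).
Qed.

(** The constant mode has square norm T and the others T/2, whence the factor
2 - (n == 0). *)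
Definition fcos (n : nat) f := (2 - (n == 0%N)%:R) / T * ip f (cosn n).
Definition fsin (n : nat) f := 2 / T * ip f (sinn n).
Definition mode (n : nat) a b := fun t => a * cosn n t + b * sinn n t.

Lemma H1_mode n a b : H1 (mode n a b) (mode n (n%:R * omega * b) (- (n%:R * omega * a))).
Proof.
have := H1D (H1Z a (H1_cosn n)) (H1Z b (H1_sinn n)).
congr (H1 _ _); apply/funext => t; rewrite /mode; ring.
Qed.

Lemma sq_mode n a b : sq (mode n a b).
Proof. exact: sq_H1 (H1_mode n a b). Qed.

Definition orth (n : nat) f := ip f (cosn n) = 0 /\ ip f (sinn n) = 0.

Lemma orth_sub_mode_self n f v : H1 f v ->
  orth n (fun t => f t - mode n (fcos n f) (fsin n f) t).
Proof.
move=> fv; have sf := sq_H1 fv.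
have sc := sq_cosn n; have ss := sq_sinn n.
have sac := square_integrableZ (fcos n f) sc.
have sbs := square_integrableZ (fsin n f) ss.
have Tn0 : T != 0 by rewrite gt_eqF// T_gt0.
rewrite /orth !ipBl//; try exact: sq_mode.
rewrite !ipDl// !ipZl// ip_cosn_sinn [ip (sinn n) (cosn n)]ipC ip_cosn_sinn !mulr0 addr0 add0r.
rewrite /fcos /fsin; case: n {sc ss sac sbs} => [|n].
  have -> : (0%N == 0%N)%:R = 1 :> R by [].
  rewrite ip_cosn_cosn0 sinn0; split.
    by move: (ip f (cosn 0)) => A; field.
  by rewrite !(ip0r T_gt0) mulr0 subrr.
have [-> ->] := ip_modes_diag (ltn0Sn n).
have -> : (n.+1 == 0%N)%:R = 0 :> R by [].
by move: (ip f (cosn n.+1)) (ip f (sinn n.+1)) => A B; split; field.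
Qed.

Lemma orth_mode_neq n m a b : n != m -> orth m (mode n a b).
Proof.
move=> nm; have [h1 h2 h3 h4] := ip_modes_neq nm.
have scm := sq_cosn m; have ssm := sq_sinn m.
have scn := square_integrableZ a (sq_cosn n).
have ssn := square_integrableZ b (sq_sinn n).
split; rewrite ipDl// !ipZl//; try exact: sq_cosn; try exact: sq_sinn.
  by rewrite h1 h3 !mulr0 addr0.
by rewrite h2 h4 !mulr0 addr0.
Qed.

Lemma orthB n f g : sq f -> sq g -> orth n f -> orth n g -> orth n (fun t => f t - g t).
Proof.
have scn := sq_cosn n; have ssn := sq_sinn n.
by move=> sf sg [f1 f2] [g1 g2]; split; rewrite ipBl// ?f1 ?f2 ?g1 ?g2 subrr.
Qed.

Lemma orth_deriv n f v : H1 f v -> orth n f -> orth n v.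
Proof.
by move=> fv [f1 f2]; split; rewrite ?(ip_deriv_cosn _ fv) ?(ip_deriv_sinn _ fv) ?f1 ?f2 mulr0 ?oppr0.
Qed.

Lemma orth_ip_mode n f a b : sq f -> orth n f -> ip f (mode n a b) = 0.
Proof.
move=> sf [f1 f2]; have scn := sq_cosn n; have ssn := sq_sinn n.
have s1 := square_integrableZ a scn; have s2 := square_integrableZ b ssn.
by rewrite ipDr// !ipZr// f1 f2 !mulr0 addr0.
Qed.

Lemma ip_mode_mode0 a b a' b' : ip (mode 0 a b) (mode 0 a' b') = T * (a * a').
Proof.
have e c d : mode 0 c d = cst c.
  by apply/funext => t; rewrite /mode sinn0 cosn0 mulr0 mulr1 addr0.
rewrite !e /ip (_ : (fun t => _) = cst (a * a'))//.
by rewrite int_cst// subr0 mulrC.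
Qed.

Lemma ip_mode_mode n a b a' b' : (0 < n)%N ->
  ip (mode n a b) (mode n a' b') = T / 2 * (a * a' + b * b').
Proof.
move=> n0; have [e1 e2] := ip_modes_diag n0.
have scn := sq_cosn n; have ssn := sq_sinn n.
have s1 := square_integrableZ a scn; have s2 := square_integrableZ b ssn.
have s1' := square_integrableZ a' scn; have s2' := square_integrableZ b' ssn.
have sm := square_integrableD s1' s2'.
rewrite ipDl// !ipZl// !ipDr// !ipZr// e1 e2 ip_cosn_sinn ipC ip_cosn_sinn.
by rewrite !mulr0 addr0 add0r; ring.
Qed.

End Fourier.

(** * Functions without low modes are small *)

Lemma eq_is_derive (R : realType) (f g : R -> R) (x d e : R) :
  is_derive x 1 f d -> f =1 g -> d = e -> is_derive x 1 g e.
Proof. by move=> df /funext <- <-. Qed.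

Section KernelBound.
Context {R : realType} (omega T : R).
Hypothesis omega_gt0 : 0 < omega.
Hypothesis T_def : T = 2 * pi / omega.
Implicit Types (f g h v w : R -> R) (a b c t s x : R).
Notation mu := (@lebesgue_measure R).
Local Notation int a b f := (Rintegral mu [set` `[a, b]] f).
Local Notation sq := (square_integrable T).
Local Notation H1 := (H1 T).
Local Notation ip := (ip T).
Local Notation orth := (orth omega T).

Let T_gt0 : 0 < T := period_gt0 omega_gt0 T_def.
Let T_ge0 : 0 <= T. Proof. exact: ltW T_gt0. Qed.

(** This is cos^2 (omega (s - t) / 2), whose powers concentrate at s = t modulo T. *)
Definition bump t s := (1 + cos (omega * s - omega * t)) / 2.

Lemma is_derive_bump t s :
  is_derive s 1 (bump t) (- (omega * sin (omega * s - omega * t)) / 2).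
Proof.
have h := is_derive_cos_affine omega (- (omega * t)) s.
apply: eq_is_derive (is_deriveZ 2^-1 (is_deriveD (is_derive_cst (1 : R) s 1) h)) _ _.
  by move=> x; exact: mulrC.
by rewrite /GRing.scale/= add0r mulrC.
Qed.

Lemma is_derive_bumpX t n s :
  is_derive s 1 (fun s => bump t s ^+ n * sin (omega * s - omega * t))
    (omega * (bump t s ^+ n - (2 * n.+1%:R) * (bump t s ^+ n * (1 - bump t s)))).
Proof.
have hs := is_derive_sin_affine omega (- (omega * t)) s.
have sc : sin (omega * s - omega * t) ^+ 2 = 4 * (bump t s * (1 - bump t s)).
  by rewrite sin2cos2 /bump; field.
have cb : cos (omega * s - omega * t) = 2 * bump t s - 1 by rewrite /bump; field.
have hb := is_deriveX n (is_derive_bump t s).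
apply: eq_is_derive (is_deriveM hb hs) _ _.
  by move=> x; rewrite /= exprfctE.
rewrite /GRing.scale/= exprfctE cb; case: n {hb} => [|n] /=.
  by rewrite expr0 !mul0r mulr0 addr0; ring.
rewrite !exprS -[n.+2%:R]natr1.
transitivity (omega * (bump t s * bump t s ^+ n * (2 * bump t s - 1)
   - n.+1%:R * bump t s ^+ n * sin (omega * s - omega * t) ^+ 2 / 2)).
  by field.
by rewrite sc; field.
Qed.

Lemma continuous_bumpX t n : continuous (fun s => bump t s ^+ n).
Proof.
apply: is_derive_continuous => s.
exact: eq_is_derive (is_deriveX n (is_derive_bump t s)) (fun x => congr1 (fun f => f x) (exprfctE _ _)) erefl.
Qed.

Lemma bumpX_tailE t n : (fun s => bump t s ^+ n * (1 - bump t s)) =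
  (fun s => bump t s ^+ n - bump t s ^+ n.+1).
Proof. by apply/funext => s; rewrite exprSr mulrBr mulr1. Qed.

Lemma itv_integrable_bumpX_tail t n :
  itv_integrable 0 T (fun s => bump t s ^+ n * (1 - bump t s)).
Proof.
rewrite bumpX_tailE; apply: itv_integrableB.
  exact: continuous_itv_integrable (@continuous_bumpX t n).
exact: continuous_itv_integrable (@continuous_bumpX t n.+1).
Qed.

(** The difference of the two integrands is up to a factor the derivative of a periodic
function.  The equality measures the concentration: 1 - bump has mean 1/(2(n+1)) with
respect to the n-th power of the bump. *)
Lemma int_bumpX_tail t n :
  (2 * n.+1%:R) * int 0 T (fun s => bump t s ^+ n * (1 - bump t s)) =
  int 0 T (fun s => bump t s ^+ n).
Proof.
have c1 := @continuous_bumpX t n; have c2 := @continuous_bumpX t n.+1.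
have i1 := continuous_itv_integrable 0 T c1.
have i3 := itv_integrable_bumpX_tail t n.
have i4 := itv_integrableZ (2 * n.+1%:R) i3.
apply/eqP; rewrite eq_sym -subr_eq0 -intZ// -intB//.
have w0 : omega != 0 by rewrite gt_eqF.
apply/eqP/(mulfI w0); rewrite mulr0 -intZ; last exact: itv_integrableB.
have cG' : continuous (fun s =>
    omega * (bump t s ^+ n - (2 * n.+1%:R) * (bump t s ^+ n * (1 - bump t s)))).
  have c3 : continuous (fun s => bump t s ^+ n * (1 - bump t s)).
    by rewrite bumpX_tailE => s; apply: cvgB; [exact: c1|exact: c2].
  apply: continuousZ_fun => s; apply: cvgB; first exact: c1.
  exact: continuousZ_fun c3 s.
rewrite (FTC2_itv T_ge0 cG' (fun s _ => is_derive_bumpX t n s)).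
have p s : bump t (s + T) = bump t s.
  rewrite /bump mulrDr (omegaT omega_gt0 T_def) addrAC.
  by have := @cosD2pi R => ->.
rewrite -[T]add0r p mulrDr (omegaT omega_gt0 T_def) addrAC.
by have := @sinD2pi R => ->; rewrite subrr.
Qed.

Lemma int_bumpX_gt0 t n : 0 < int 0 T (fun s => bump t s ^+ n).
Proof.
elim: n => [|n IHn].
  by under eq_Rintegral do rewrite expr0; rewrite int_cst// mul1r subr0.
have i1 := continuous_itv_integrable 0 T (@continuous_bumpX t n).
have -> : int 0 T (fun s => bump t s ^+ n.+1) =
    int 0 T (fun s => bump t s ^+ n) -
    int 0 T (fun s => bump t s ^+ n * (1 - bump t s)).
  rewrite -intB//; last exact: itv_integrable_bumpX_tail.
  by apply: eq_int => s _; rewrite exprS; ring.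
have := int_bumpX_tail t n.
move: (int _ _ _) IHn => A A0; move: (int _ _ _) => B e.
have h : 1 <= n.+1%:R :> R by rewrite ler1n.
rewrite -e in A0; rewrite -e subr_gt0.
have B0 : 0 < B by rewrite pmulr_rgt0 in A0 => //; lra.
by nra.
Qed.

Lemma orth_phase n f u : sq f -> orth n f ->
  ip f (fun s => cos (n%:R * omega * s + u)) = 0.
Proof.
move=> sf [f1 f2]; have sc := sq_cosn omega T n; have ss := sq_sinn omega T n.
have s1 := square_integrableZ (cos u) sc; have s2 := square_integrableZ (sin u) ss.
rewrite (_ : (fun s => _) =
    (fun s => cos u * cosn omega n s - sin u * sinn omega n s)); last first.
  by apply/funext => s; rewrite cosD /cosn /sinn; ring.
by rewrite ipBr// !ipZr// f1 f2 !mulr0 subrr.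
Qed.

(** The n-th power of the bump is a trigonometric polynomial of degree n.  The extra
cosine makes this an induction on n, each factor of the bump shifting j by at most
one. *)
Lemma orth_bumpX t f n : sq f ->
  forall j u, (forall k, (k <= j + n)%N -> orth k f) ->
  ip f (fun s => cos (j%:R * omega * s + u) * bump t s ^+ n) = 0.
Proof.
move=> sf; elim: n => [|n IHn] j u fo.
  under eq_ip do [over|rewrite expr0 mulr1; over].
  by apply: orth_phase => //; apply: fo; rewrite addn0.
have sj k (z : R) : sq (fun s => cos (k%:R * omega * s + z) * bump t s ^+ n).
  apply: square_integrable_continuous => s; apply: cvgM.
    exact: is_derive_continuous (is_derive_cos_affine _ _) s.
  exact: continuous_bumpX.
pose w := omega * t.
have [j' [u' [j'n cosE]]] : exists j' u', (j' <= j.+1)%N /\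
    forall s, cos (j'%:R * omega * s + u') = cos (j%:R * omega * s + u - (omega * s - w)).
  (* the frequency j - 1, or its opposite when j = 0 *)
  case: j {fo} => [|j].
    exists 1%N, (- w - u); split=> // s.
    by rewrite -[RHS]cosN; congr cos; rewrite /=; ring.
  exists j, (u + w); split; first by rewrite ltnW.
  by move=> s; congr cos; rewrite -natr1; ring.
rewrite (_ : (fun s => _) = (fun s => 2^-1 * (cos (j%:R * omega * s + u) * bump t s ^+ n)
    + (4^-1 * (cos (j.+1%:R * omega * s + (u - w)) * bump t s ^+ n)
     + 4^-1 * (cos (j'%:R * omega * s + u') * bump t s ^+ n)))); last first.
  apply/funext => s; rewrite exprS cosE.
  have -> : j.+1%:R * omega * s + (u - w) = (j%:R * omega * s + u) + (omega * s - w).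
    by rewrite -natr1; ring.
  rewrite -[bump t s * _]/((1 + cos (omega * s - w)) / 2 * bump t s ^+ n).
  move: (bump t s ^+ n) (j%:R * omega * s + u) (omega * s - w) => B a b.
  by rewrite cosD cosB; field.
have z1 := square_integrableZ 2^-1 (sj j u).
have z2 := square_integrableZ 4^-1 (sj j.+1 (u - w)).
have z3 := square_integrableZ 4^-1 (sj j' u').
rewrite ipDr//; last exact: square_integrableD.
rewrite ipDr// !ipZr// !IHn ?mulr0 ?addr0//.
- by move=> k kn; apply: fo; rewrite (leq_trans kn)// -addSnnS leq_add2r.
- by move=> k kn; apply: fo; rewrite -addSnnS.
- by move=> k kn; apply: fo; rewrite (leq_trans kn)// leq_add2l.
Qed.

(** With enough vanishing low modes, averaging f(t) - f(s) against a normalized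
power of the bump returns f(t) itself, and concentration makes the average small. *)
Lemma high_modes_small (delta : R) : 0 < delta ->
  exists n : nat, forall f v, H1 f v -> (forall k, (k <= n)%N -> orth k f) ->
  forall t, f t ^+ 2 <= delta * ip v v.
Proof.
move=> d0; pose A := 2 * T.
have A0 : 0 < A by rewrite mulr_gt0.
pose eta := Num.min 1 (delta / (4 * A)).
have d1 : 0 < delta / (4 * A) by rewrite divr_gt0// mulr_gt0.
have eta0 : 0 < eta by rewrite lt_min ltr01 d1.
have eta1 : eta <= 1 by rewrite ge_min lexx.
have etad : 4 * A * eta <= delta.
  by rewrite mulrC -ler_pdivlMr ?mulr_gt0// ge_min lexx orbT.
(* large enough for the mean 1/(2(n+1)) of 1 - bump, divided by eta^3, to be at most
   eta/2 *)
pose n := Num.truncn (eta ^- 4).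
have nP : eta ^- 4 <= n.+1%:R by apply/ltW; exact: truncnS_gt.
exists n => f v fv fo t.
have sf := sq_H1 omega_gt0 T_def fv; have cf := H1_continuous omega_gt0 T_def fv.
pose S : R := Num.sqrt (A * ip v v).
have S0 : 0 <= S := sqrtr_ge0 _.
have SE : S ^+ 2 = A * ip v v by rewrite sqr_sqrtr// mulr_ge0 ?ip_ge0 ?ltW.
have b01 s : 0 <= bump t s /\ bump t s <= 1.
  rewrite /bump; have := cos_le1 (omega * s - omega * t).
  by have := cos_geN1 (omega * s - omega * t); split; lra.
(* the Hoelder bound is S sqrt q with q = |sin|, q^2 = 1 - bump; sqrt q is at most eta
   if q <= eta^2 and at most q^2 / eta^3 otherwise *)
have pointwise s : `|f t - f s| <= S * (eta + (1 - bump t s) / eta ^+ 3).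
  have hol : (f t - f s) ^+ 2 <= S ^+ 2 * `|sin (omega / 2 * (t - s))|.
    by rewrite SE [A * _ * _]mulrAC; exact: (H1_circle_holder omega_gt0 T_def).
  have sE : `|sin (omega / 2 * (t - s))| ^+ 2 = 1 - bump t s.
    rewrite -normrX ger0_norm ?sqr_ge0// /bump.
    have := cos_mulr2n (omega / 2 * (s - t)).
    rewrite (_ : omega / 2 * (s - t) *+ 2 = omega * s - omega * t); last by field.
    move=> ->; rewrite -opprB mulrN sinN sqrrN sin2cos2.
    by move: (cos _) => z; field.
  rewrite -sE; move: (`|sin _|) (normr_ge0 (sin (omega / 2 * (t - s)))) hol => q q0 hol.
  have rhs0 : 0 <= S * (eta + q ^+ 2 / eta ^+ 3).
    by rewrite mulr_ge0// addr_ge0 ?divr_ge0 ?exprn_ge0// ltW.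
  rewrite -ler_sqr ?nnegrE// real_normK ?num_real//.
  apply: le_trans hol _; rewrite exprMn ler_wpM2l ?sqr_ge0//.
  have [qle|qgt] := leP q (eta ^+ 2).
    apply: le_trans qle _; rewrite ler_sqr ?nnegrE ?addr_ge0 ?divr_ge0 ?exprn_ge0 ?(ltW eta0)//.
    by rewrite lerDl divr_ge0 ?exprn_ge0// ltW.
  have e0 : eta != 0 by rewrite gt_eqF.
  pose p := q / eta ^+ 2.
  have p1 : 1 < p by rewrite ltr_pdivlMr ?exprn_gt0// mul1r.
  have -> : q = p * eta ^+ 2 by rewrite /p mulfVK// expf_neq0.
  have -> : (p * eta ^+ 2) ^+ 2 / eta ^+ 3 = p ^+ 2 * eta by field.
  have -> : (eta + p ^+ 2 * eta) ^+ 2 = (1 + p ^+ 2) ^+ 2 * eta ^+ 2 by ring.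
  by rewrite ler_wpM2r ?sqr_ge0//; nra.
set c := int 0 T (fun s => bump t s ^+ n).
have c0 : 0 < c := int_bumpX_gt0 t n.
have cK := @continuous_bumpX t n.
have iK := continuous_itv_integrable 0 T cK.
have sK := square_integrable_continuous T cK.
have fK : ip f (fun s => bump t s ^+ n) = 0.
  rewrite -[RHS](@orth_bumpX t f n sf 0 0 fo).
  by apply: eq_ip => // s _; rewrite !mul0r add0r cos0 mul1r.
have ftc : f t * c = int 0 T (fun s => (f t - f s) * bump t s ^+ n).
  have := intB (itv_integrableZ (f t) iK) (square_integrableM sf sK).
  rewrite -/(ip f _) fK subr0 intZ// => <-.
  by apply: eq_int => s _; rewrite mulrBl.
have iD : itv_integrable 0 T (fun s => (f t - f s) * bump t s ^+ n).
  apply: continuous_itv_integrable => s; apply: cvgM; last exact: cK.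
  by apply: cvgB; [exact: cvg_cst|exact: cf].
have iT := itv_integrable_bumpX_tail t n.
have bound : `|f t| * c <= S * (eta * c + (c / (2 * n.+1%:R)) / eta ^+ 3).
  have -> : c / (2 * n.+1%:R) = int 0 T (fun s => bump t s ^+ n * (1 - bump t s)).
    by rewrite /c -int_bumpX_tail mulrAC mulfV ?mul1r// mulf_neq0// pnatr_eq0.
  rewrite -[in `|f t| * c](ger0_norm (ltW c0)) -normrM ftc.
  apply: le_trans (int_norm_le iD) _.
  rewrite [X in _ <= S * (_ + X)]mulrC -!intZ//.
  rewrite -intD; [|exact: itv_integrableZ..].
  rewrite -intZ; last by apply: itv_integrableD; exact: itv_integrableZ.
  apply: le_int.
  - exact: itv_integrable_norm.
  - by apply: itv_integrableZ; apply: itv_integrableD; exact: itv_integrableZ.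
  move=> s _; have [b0 b1] := b01 s.
  have K0 : 0 <= bump t s ^+ n by rewrite exprn_ge0.
  rewrite normrM (ger0_norm K0).
  apply: le_trans (ler_wpM2r K0 (pointwise s)) _.
  by rewrite le_eqVlt; apply/orP; left; apply/eqP; ring.
have small : `|f t| <= S * (2 * eta).
  rewrite -(ler_pM2r c0); apply: le_trans bound _.
  rewrite -[X in _ <= X]mulrA ler_wpM2l//.
  have e0 : eta != 0 by rewrite gt_eqF.
  have n0 : 0 < n.+1%:R :> R by rewrite ltr0n.
  have : c / (2 * n.+1%:R) / eta ^+ 3 = (c * eta) * (eta ^- 4 / n.+1%:R / 2).
    by field; rewrite e0 gt_eqF.
  move=> ->; have : eta ^- 4 / n.+1%:R <= 1 by rewrite ler_pdivrMr// mul1r.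
  move: (_ / _) => z z1; have := mulr_gt0 c0 eta0.
  by nra.
rewrite -[f t ^+ 2]ger0_norm ?sqr_ge0// normrX.
apply: le_trans (_ : (S * (2 * eta)) ^+ 2 <= _).
  by rewrite ler_sqr ?nnegrE// mulr_ge0// mulr_ge0// ltW.
rewrite exprMn SE.
have -> : A * ip v v * (2 * eta) ^+ 2 = (4 * A * eta) * eta * ip v v by ring.
rewrite ler_wpM2r ?ip_ge0//; apply: le_trans etad.
by rewrite ler_piMr// !mulr_ge0// ltW.
Qed.

End KernelBound.

(** * Minorants and null functions *)

Section LowerIntegral.
Context {R : realType} (T : R).
Notation mu := (@lebesgue_measure R).
Local Notation int a b f := (Rintegral mu [set` `[a, b]] f).

(** The integral of a nonnegative function is a supremum over simple minorants, so
minorants can be compared with it without knowing that it is measurable. *)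
Lemma le_integral_minorant (g : R -> R) (F : R -> \bar R) :
  itv_integrable 0 T g ->
  (forall t, 0 <= t <= T -> (0 <= F t)%E) ->
  (forall t, 0 <= t <= T -> ((g t)%:E <= F t)%E) ->
  ((int 0 T g)%:E <= \int[mu]_(t in `[0%R, T]) F t)%E.
Proof.
move=> gi F0 gF.
have inD t : (`[0, T]%classic : set R) t -> 0 <= t <= T by rewrite /= in_itv.
have ggp : (int 0 T g <= int 0 T (fun t => Num.max (g t) 0)).
  apply: le_int => //.
    exact: (integrable_funrpos _ gi).
  by move=> t _; rewrite le_max lexx.
apply: (@le_trans _ _ (int 0 T (fun t => Num.max (g t) 0))%:E).
  by rewrite lee_fin.
have gpi : mu.-integrable `[0, T] (EFin \o (fun t => Num.max (g t) 0)).
  exact: (integrable_funrpos _ gi).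
rewrite /Rintegral fineK; last exact: integrable_fin_num.
rewrite ge0_integralE; last by move=> t _; rewrite lee_fin le_max lexx orbT.
rewrite ge0_integralE; last by move=> t /inD; exact: F0.
apply: le_ereal_sup => _ [h hg <-]; exists h => // t; apply: le_trans (hg t) _.
apply: lee_restrict => x /inD xT /=.
by rewrite EFin_max ge_max gF ?F0.
Qed.

(** A function with vanishing primitive is almost everywhere zero, by Lebesgue's
differentiation theorem. *)
Lemma ip_null (w h : R -> R) : 0 < T -> square_integrable T w ->
  square_integrable T h ->
  (forall t : R, 0 <= t <= T -> int 0 t w = 0) -> ip T w h = 0.
Proof.
move=> T0 sw sh w0; have wi := square_integrable_int sw.
pose f : R -> R := w \_ `[0, T].
have fi : mu.-integrable setT (EFin \o f).
  rewrite /f -restrict_EFin; apply/integrable_restrict => //=.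
  by rewrite setTI.
have Fz : (fun y => \int[mu]_(t in [set` `]-oo, y]]) f t) = cst 0.
  apply/funext => y /=; rewrite /f -Rintegral_mkcondr.
  have [y0|y0] := leP 0 y; last first.
    rewrite (_ : _ `&` _ = set0) ?Rintegral_set0// -subset0 => t /=.
    by rewrite !in_itv/= => -[ty /andP[t0 _]]; have := le_lt_trans (le_trans t0 ty) y0; rewrite ltxx.
  have my : 0 <= Num.min y T <= T by rewrite le_min y0 ltW// ge_min lexx orbT.
  rewrite (_ : _ `&` _ = [set` `[0, Num.min y T]]); first exact: w0.
  apply/seteqP; split=> t /=; rewrite !in_itv/= le_min.
    by move=> [-> /andP[-> ->]].
  by move=> /and3P[-> -> ->].
have fl : locally_integrable [set: R] f.
  by apply: open_integrable_locally => //; exact: openT.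
have H : {ae mu, forall x, 0 = f x}.
  have fy y : mu.-integrable [set` `]-oo, y]] (EFin \o f).
    exact: integrableS fi.
  have := FTC1Ny fy fl.
  rewrite /= Fz; apply: filterS; first exact: (ae_filter_ringOfSetsType mu).
  by move=> x /= [_ <-]; rewrite derive1E derive_cst.
rewrite /ip /Rintegral (@ae_eq_integral _ _ _ _ _ (cst 0%E)) ?integral0//.
  exact: (measurable_int mu (square_integrableM sw sh)).
move: H; apply: filterS; first exact: (ae_filter_ringOfSetsType mu).
move=> x h0; rewrite /= in_itv/= => /andP[x0 xT].
by move: h0; rewrite /f patchE mem_set/= ?in_itv/= ?x0// => <-; rewrite mul0r.
Qed.

End LowerIntegral.

(** * The mass scalar product and the operator Delta *)

Section MassGeometry.
Context {R : realType} {N : nat} (m : 'I_N -> R) (xbar : config R N).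
Hypothesis m_gt0 : forall i, 0 < m i.
Hypothesis xbar_free : collision_free xbar.
Implicit Types (x y z : config R N) (A : 'M[R]_3).

Definition mdot x y : R := \sum_(i < N) m i * (x^T *m y) i i.

Lemma mdotE x y : mdot x y = \sum_(i < N) \sum_(k < 3) m i * (x k i * y k i).
Proof.
apply: eq_bigr => i _; rewrite mxE mulr_sumr.
by apply: eq_bigr => k _; rewrite mxE.
Qed.

Lemma mdotC x y : mdot x y = mdot y x.
Proof. by rewrite !mdotE; do 2 (apply: eq_bigr => ? _); rewrite [X in _ * X]mulrC. Qed.

Lemma mdotDl x y z : mdot (x + y) z = mdot x z + mdot y z.
Proof. by rewrite /mdot -big_split; apply: eq_bigr => i _; rewrite linearD/= mulmxDl mxE mulrDr. Qed.

Lemma mdotZl k x z : mdot (k *: x) z = k * mdot x z.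
Proof. by rewrite /mdot mulr_sumr; apply: eq_bigr => i _; rewrite linearZ/= -scalemxAl mxE mulrCA. Qed.

Lemma mdotDr x y z : mdot z (x + y) = mdot z x + mdot z y.
Proof. by rewrite mdotC mdotDl mdotC [mdot y _]mdotC. Qed.

Lemma mdotZr k x z : mdot z (k *: x) = k * mdot z x.
Proof. by rewrite mdotC mdotZl mdotC. Qed.

Lemma mdotNr x z : mdot z (- x) = - mdot z x.
Proof. by rewrite -scaleN1r mdotZr mulN1r. Qed.

Lemma mdot_mulmx A x y : mdot (A *m x) y = mdot x (A^T *m y).
Proof. by apply: eq_bigr => i _; rewrite trmx_mul mulmxA. Qed.

Lemma mdot_ge0 x : 0 <= mdot x x.
Proof.
rewrite mdotE; apply: sumr_ge0 => i _; apply: sumr_ge0 => k _.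
by rewrite mulr_ge0 ?(ltW (m_gt0 i))// -expr2 sqr_ge0.
Qed.

Lemma mdot_eq0 x : mdot x x = 0 -> x = 0.
Proof.
rewrite mdotE => /eqP; rewrite psumr_eq0 => [|i _]; last first.
  by apply: sumr_ge0 => k _; rewrite mulr_ge0 ?(ltW (m_gt0 i))// -expr2 sqr_ge0.
move=> /allP h; apply/matrixP => k i; rewrite mxE.
have /eqP := h i (mem_index_enum i); move=> /eqP; rewrite psumr_eq0 => [|l _]; last first.
  by rewrite mulr_ge0 ?(ltW (m_gt0 i))// -expr2 sqr_ge0.
move=> /allP/(_ k (mem_index_enum k)); rewrite mulf_eq0 gt_eqF//= -expr2 expf_eq0/=.
by move=> /eqP.
Qed.

Lemma mass_sqnormE x : mass_sqnorm m x = mdot x x.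
Proof.
rewrite mdotE; apply: eq_bigr => i _; rewrite /enorm sqr_sqrtr.
  by rewrite mulr_sumr; apply: eq_bigr => k _; rewrite mxE expr2.
by apply: sumr_ge0 => k _; exact: sqr_ge0.
Qed.

Lemma centeredP x : centered m x <-> forall k, \sum_(i < N) m i * x k i = 0.
Proof.
rewrite /centered; split=> [h k|h].
  have := congr1 (fun v : 'cV_3 => v k 0) h; rewrite summxE mxE => e; rewrite -[RHS]e.
  by apply: eq_bigr => i _; rewrite !mxE.
apply/matrixP => k j; rewrite summxE mxE -[RHS](h k).
by apply: eq_bigr => i _; rewrite !mxE.
Qed.

Lemma centeredD x y : centered m x -> centered m y -> centered m (x + y).
Proof.
move=> /centeredP hx /centeredP hy; apply/centeredP => k.
by under eq_bigr do rewrite mxE mulrDr; rewrite big_split/= hx hy addr0.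
Qed.

Lemma centeredZ c x : centered m x -> centered m (c *: x).
Proof.
move=> /centeredP hx; apply/centeredP => k.
by under eq_bigr do rewrite mxE mulrCA; rewrite -mulr_sumr hx mulr0.
Qed.

Lemma centered0 : centered m (0 : config R N).
Proof. by apply/centeredP => k; rewrite big1// => i _; rewrite mxE mulr0. Qed.

Lemma centered_mulmx A x : centered m x -> centered m (A *m x).
Proof.
move=> hx; rewrite /centered; under eq_bigr do rewrite colE -mulmxA -colE scalemxAr.
by rewrite -mulmx_sumr hx mulmx0.
Qed.

Definition weight (i j : 'I_N) : R := m j / mutual_distance xbar i j ^+ 3.

(** Delta mixes the bodies but not the coordinates, hence acts on the right. *)
Definition Delta_mx : 'M[R]_N := \matrix_(j < N, i < N)
  (if j == i then \sum_(l < N | l != i) weight i l else - weight i j).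

Lemma DeltaE x : Delta m xbar x = x *m Delta_mx.
Proof.
apply/matrixP => k i; rewrite !mxE [in RHS](bigD1 i)//= mxE eqxx mulr_sumr -big_split/=.
by apply: eq_bigr => j /negbTE ji; rewrite mxE ji mulrBr mulrN [weight _ _ * x k i]mulrC [_ * x k j]mulrC.
Qed.

Lemma DeltaD x y : Delta m xbar (x + y) = Delta m xbar x + Delta m xbar y.
Proof. by rewrite !DeltaE mulmxDl. Qed.

Lemma DeltaZ c x : Delta m xbar (c *: x) = c *: Delta m xbar x.
Proof. by rewrite !DeltaE -scalemxAl. Qed.

Lemma Delta_mulmx A x : Delta m xbar (A *m x) = A *m Delta m xbar x.
Proof. by rewrite !DeltaE mulmxA. Qed.

Lemma mutual_distanceC x i j : mutual_distance x i j = mutual_distance x j i.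
Proof. by congr Num.sqrt; apply: eq_bigr => k _; rewrite !mxE -sqrrN opprB. Qed.

Lemma sqr_mutual_distance x i j :
  mutual_distance x i j ^+ 2 = \sum_(k < 3) (x k i - x k j) ^+ 2.
Proof.
rewrite sqr_sqrtr; last by apply: sumr_ge0 => k _; exact: sqr_ge0.
by apply: eq_bigr => k _; rewrite !mxE.
Qed.

Lemma mutual_distance_ge0 x i j : 0 <= mutual_distance x i j.
Proof. exact: sqrtr_ge0. Qed.

Lemma mutual_distance_gt0 i j : i != j -> 0 < mutual_distance xbar i j.
Proof.
move=> /xbar_free ij; rewrite lt_neqAle mutual_distance_ge0 andbT.
apply: contra_neq ij => /esym d0; apply/colP => k; rewrite !mxE; apply/eqP.
have := sqr_mutual_distance xbar i j; rewrite d0 expr0n/= => /esym/eqP.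
rewrite psumr_eq0 => [/allP/(_ k (mem_index_enum k))|l _]; last exact: sqr_ge0.
by rewrite /= expf_eq0/= subr_eq0.
Qed.

(** Each unordered pair collects the contributions of its two orderings. *)
Lemma mdot_Delta x y : mdot (Delta m xbar x) y =
  \sum_(i < N) \sum_(j < N | (i < j)%N)
    m i * m j / mutual_distance xbar i j ^+ 3 *
    \sum_(k < 3) (x k i - x k j) * (y k i - y k j).
Proof.
pose c i j := m i * m j / mutual_distance xbar i j ^+ 3.
have cC i j : c i j = c j i by rewrite /c mutual_distanceC [m i * _]mulrC.
pose F i j := c i j * \sum_(k < 3) (x k i - x k j) * y k i.
have e1 : mdot (Delta m xbar x) y = \sum_(i < N) \sum_(j < N | j != i) F i j.
  rewrite mdotE; apply: eq_bigr => i _.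
  under eq_bigr do rewrite mxE mulr_suml mulr_sumr.
  rewrite exchange_big/=; apply: eq_bigr => j ji; rewrite /F mulr_sumr.
  by apply: eq_bigr => k _; rewrite /c; ring.
have e2 : \sum_(i < N) \sum_(j < N | j != i) F i j =
    \sum_(i < N) \sum_(j < N | (i < j)%N) (F i j + F j i).
  under [RHS]eq_bigr do rewrite big_split/=.
  rewrite big_split/= [X in _ = _ + X](exchange_big_dep xpredT)//= -big_split/=.
  apply: eq_bigr => i _.
  rewrite (bigID (fun j : 'I_N => (i < j)%N))/=; congr (_ + _).
    by apply: eq_bigl => j; rewrite neq_ltn andb_orl [(i < j)%N && _]andbb; case: ltngtP.
  by apply: eq_bigl => j; rewrite -leqNgt neq_ltn; case: ltngtP.
rewrite e1 e2; apply: eq_bigr => i _; apply: eq_bigr => j _.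
rewrite /F [c j i]cC -mulrDr -/(c i j); congr (_ * _).
by rewrite -big_split/=; apply: eq_bigr => k _; ring.
Qed.

Lemma mdot_Delta_sym x y : mdot (Delta m xbar x) y = mdot x (Delta m xbar y).
Proof.
rewrite [RHS]mdotC !mdot_Delta; do 2 (apply: eq_bigr => ? _); congr (_ * _).
by apply: eq_bigr => k _; rewrite mulrC.
Qed.

Lemma mdot_Delta_self x : mdot (Delta m xbar x) x =
  \sum_(i < N) \sum_(j < N | (i < j)%N)
    m i * m j / mutual_distance xbar i j ^+ 3 * mutual_distance x i j ^+ 2.
Proof.
rewrite mdot_Delta; do 2 (apply: eq_bigr => ? _).
by rewrite sqr_mutual_distance; under eq_bigr do rewrite -expr2.
Qed.

(** The form of Delta vanishes only if all bodies coincide, and then they are at the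
center of mass. *)
Lemma mdot_Delta_gt0 x : centered m x -> x != 0 -> 0 < mdot (Delta m xbar x) x.
Proof.
move=> xc x0; have term_ge0 (i j : 'I_N) : 0 <= m i * m j / mutual_distance xbar i j ^+ 3
    * mutual_distance x i j ^+ 2.
  by rewrite mulr_ge0 ?sqr_ge0// divr_ge0 ?exprn_ge0 ?mutual_distance_ge0// mulr_ge0 ?ltW.
rewrite lt_neqAle mdot_Delta_self; apply/andP; split; last first.
  by apply: sumr_ge0 => i _; apply: sumr_ge0.
apply: contra_neq x0 => /esym/eqP.
rewrite psumr_eq0 => [/allP h|i _]; last exact: sumr_ge0.
have dist0 (i j : 'I_N) : (i < j)%N -> mutual_distance x i j ^+ 2 = 0.
  move=> ij; have := h i (mem_index_enum i); rewrite /= psumr_eq0//.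
  move=> /allP/(_ j (mem_index_enum j)); rewrite ij/= mulf_eq0 => /orP[|/eqP//].
  rewrite mulf_eq0 invr_eq0 expf_eq0/= mulf_eq0 !gt_eqF//.
  by apply: mutual_distance_gt0; rewrite neq_ltn ij.
have eqk k (i j : 'I_N) : x k i = x k j.
  wlog ij : i j / (i < j)%N.
    by move=> W; case: (ltngtP i j) => [/W//|/W->//|/val_inj->].
  have := dist0 i j ij; rewrite sqr_mutual_distance => /eqP.
  rewrite psumr_eq0 => [/allP/(_ k (mem_index_enum k))|l _]; last exact: sqr_ge0.
  by rewrite /= expf_eq0/= subr_eq0 => /eqP.
apply/matrixP => k i; rewrite mxE; apply/eqP.
have /centeredP/(_ k) := xc.
under eq_bigr do rewrite (eqk k _ i).
rewrite -mulr_suml => /eqP; rewrite mulf_eq0 => /orP[|//].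
rewrite psumr_eq0 => [/allP/(_ i (mem_index_enum i))|j _]; last exact: ltW.
by rewrite /= gt_eqF.
Qed.

(** Pairing with the translation e along the k-th axis computes the k-th coordinate of
the center of mass, and translations are in the kernel of Delta. *)
Lemma Delta_centered x : centered m (Delta m xbar x).
Proof.
apply/centeredP => k.
pose e : config R N := \matrix_(l, i) (l == k)%:R.
have := mdot_Delta x e; rewrite [RHS]big1 => [h|i _]; last first.
  by rewrite big1// => j _; rewrite big1 ?mulr0// => l _; rewrite !mxE subrr mulr0.
rewrite -[RHS]h mdotE; apply: eq_bigr => i _; rewrite (bigD1 k)//= big1 ?addr0.
  by rewrite [e _ _]mxE eqxx mulr1.
by move=> l /negbTE lk; rewrite [e _ _]mxE lk !mulr0.
Qed.

End MassGeometry.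

Section Rotation.
Context {R : realType}.

Lemma trJ : (J R)^T = - J R.
Proof.
apply/matrixP => i j; rewrite !mxE.
by case: i => [[|[|[|]]] ?]//; case: j => [[|[|[|]]] ?]//=; rewrite ?oppr0 ?opprK.
Qed.

End Rotation.

(** * Rayleigh quotients *)

Section Rayleigh.
Context {R : realType}.

(** Among the subspaces contained in P, one of maximal dimension is all of P. *)
Lemma submodule_vspace (V : vectType R) (P : V -> Prop) :
  P 0 -> (forall u v, P u -> P v -> P (u + v)) -> (forall c u, P u -> P (c *: u)) ->
  exists U : {vspace V}, forall v, v \in U <-> P v.
Proof.
move=> P0 PD PZ.
pose Q n := `[< exists U : {vspace V}, (forall v, v \in U -> P v) /\ \dim U = n >].
have exQ : exists n, Q n.
  exists 0%N; apply/asboolP; exists 0%VS; split; last by rewrite dimv0.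
  by move=> v; rewrite memv0 => /eqP ->.
have ubQ n : Q n -> (n <= \dim {:V})%N.
  by move=> /asboolP[U [_ <-]]; apply: dimvS; exact: subvf.
case: (ex_maxnP exQ ubQ) => n /asboolP[U [UP dU]] maxn.
exists U => v; split; first exact: UP.
move=> Pv; have : Q (\dim (U + <[v]>)).
  apply/asboolP; exists (U + <[v]>)%VS; split=> // w /memv_addP[u uU [z /vlineP[k ->] ->]].
  by apply: PD; [exact: UP|exact: PZ].
move=> /maxn; rewrite -dU => le.
have e : (U == U + <[v]>)%VS by rewrite eqEdim addvSl.
by rewrite (eqP e); apply: (subvP (addvSr _ _)); exact: memv_line.
Qed.

Lemma continuous_sum_fun (X : topologicalType) (I : Type) (r : seq I) (F : I -> X -> R) :
  (forall i, continuous (F i)) -> continuous (fun x => \sum_(i <- r) F i x).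
Proof.
move=> cF; elim: r => [|i r IHr].
  by under eq_fun do rewrite big_nil; exact: cst_continuous.
under eq_fun do rewrite big_cons.
by move=> x; apply: cvgD; [exact: cF|exact: IHr].
Qed.

Lemma continuous_quadratic d (A : 'I_d -> 'I_d -> R) :
  continuous (fun u : 'rV[R]_d => \sum_i \sum_j u 0 i * u 0 j * A i j).
Proof.
apply: continuous_sum_fun => i; apply: continuous_sum_fun => j u.
have c k : continuous (fun x : 'rV[R]_d => x 0 k) by exact: coord_continuous.
exact: cvgMl (cvgM (c i u) (c j u)).
Qed.

(** The form is nonnegative at u - (b / (a + 1)) w, where a = q w w and b = q u w; the 1
avoids a separate case for a = 0. *)
Lemma nonneg_form_radical (V : lmodType R) (q : V -> V -> R) (P : V -> Prop) (u w : V) :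
  (forall x y z, q (x + y) z = q x z + q y z) ->
  (forall c x z, q (c *: x) z = c * q x z) -> (forall x y, q x y = q y x) ->
  (forall x y, P x -> P y -> P (x + y)) -> (forall c x, P x -> P (c *: x)) ->
  (forall x, P x -> 0 <= q x x) -> P u -> P w -> q u u = 0 -> q u w = 0.
Proof.
move=> qD qZ qC PD PZ q0 Pu Pw quu.
have H c : 0 <= 2 * c * q u w + c ^+ 2 * q w w.
  have := q0 _ (PD _ _ Pu (PZ c _ Pw)).
  rewrite qD qZ [q u _]qC [q w _]qC !qD !qZ quu [q w u]qC; lra.
have ww := q0 _ Pw; set b := q u w in H *; set a := q w w in H ww *.
have h := H (- b / (a + 1)).
have a1 : 0 < a + 1 by lra.
have : 2 * (- b / (a + 1)) * b + (- b / (a + 1)) ^+ 2 * a =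
   - (b ^+ 2 * (a + 2)) / (a + 1) ^+ 2 by field; rewrite gt_eqF.
move=> e; rewrite e ler_pdivlMr ?exprn_gt0// mul0r oppr_ge0 in h.
have : b ^+ 2 <= 0.
  by rewrite -(ler_pM2r (_ : 0 < a + 2)) ?mul0r//; lra.
move=> b2; apply/eqP; rewrite -sqrf_eq0; apply/eqP/le_anti.
by rewrite b2 sqr_ge0.
Qed.

(** The quotient is continuous on the compact unit sphere and homogeneous of degree 0. *)
Lemma rayleigh_quotient_min d (A B : 'I_d -> 'I_d -> R) :
  (0 < d)%N ->
  let q (M : 'I_d -> 'I_d -> R) (u : 'rV[R]_d) := \sum_i \sum_j u 0 i * u 0 j * M i j in
  (forall u, u != 0 -> 0 < q B u) ->
  exists u lam, [/\ u != 0, q A u = lam * q B u &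
                   forall w, lam * q B w <= q A w].
Proof.
move=> d0 q Bpos.
have qZ M c u : q M (c *: u) = c ^+ 2 * q M u.
  rewrite /q mulr_sumr; apply: eq_bigr => i _; rewrite mulr_sumr.
  by apply: eq_bigr => j _; rewrite !mxE; ring.
pose S := [set u : 'rV[R]_d | `|u| = 1].
have S0 u : S u -> u != 0.
  by move=> Su; apply/eqP => u0; move: Su; rewrite /S/= u0 normr0 => /esym/eqP; rewrite oner_eq0.
have cS : compact S.
  apply: bounded_closed_compact.
    by exists 1; split=> // x x1 u /= ->; exact: ltW.
  apply: (continuous_closedP (Num.norm : 'rV[R]_d -> R)).1 [set 1] _.
    exact: norm_continuous.
  exact: closed_eq.
have exS : S !=set0.
  pose i0 := Ordinal d0.
  have e0 : (delta_mx 0 i0 : 'rV[R]_d) != 0.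
    by apply/eqP => /matrixP/(_ 0 i0); rewrite !mxE !eqxx => /eqP; rewrite oner_eq0.
  exists (`|delta_mx 0 i0 : 'rV[R]_d|^-1 *: delta_mx 0 i0).
  by rewrite /S/= normrZ normfV normr_id mulVf// normr_eq0.
pose f u := q A u / q B u.
have cf : {within S, continuous f}.
  apply/subspace_continuousP => u Su; apply: cvg_within_filter.
  apply: cvgM; first exact: continuous_quadratic.
  by apply: cvgV; [rewrite gt_eqF// Bpos// S0|exact: continuous_quadratic].
have [u Su minu] := EVT_min_rV exS cS cf; rewrite inE in Su.
have Bu : q B u != 0 by rewrite gt_eqF// Bpos// S0.
exists u, (f u); split; [exact: S0|by rewrite /f mulfVK|].
move=> w; have [->|w0] := eqVneq w 0.
  have q00 M : q M 0 = 0 by rewrite -(scale0r (0 : 'rV[R]_d)) qZ expr0n mul0r.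
  by rewrite !q00 mulr0.
have nw0 : `|w| != 0 by rewrite normr_eq0.
have : f u <= f (`|w|^-1 *: w).
  by apply: minu; rewrite inE /S/= normrZ normfV normr_id mulVf.
rewrite {2}/f !qZ -mulf_div divff ?mul1r ?expf_neq0 ?invr_eq0//.
by rewrite ler_pdivlMr ?Bpos.
Qed.

(** Let u minimize the Rayleigh quotient, with value lam.  The form al - lam be is
nonnegative and vanishes at u, so u is in its radical. *)
Lemma eigenvector_below_one (V : vectType R) (P : V -> Prop) (al be : V -> V -> R) :
  P 0 -> (forall u v, P u -> P v -> P (u + v)) -> (forall c u, P u -> P (c *: u)) ->
  (forall x y z, al (x + y) z = al x z + al y z) ->
  (forall c x z, al (c *: x) z = c * al x z) -> (forall x y, al x y = al y x) ->
  (forall x y z, be (x + y) z = be x z + be y z) ->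
  (forall c x z, be (c *: x) z = c * be x z) -> (forall x y, be x y = be y x) ->
  (forall v, P v -> v != 0 -> 0 < be v v) ->
  forall v, P v -> al v v < be v v ->
  exists u lam, [/\ P u, u != 0, lam < 1 & forall w, P w -> al u w = lam * be u w].
Proof.
move=> P0 PD PZ aD aZ aC bD bZ bC bpos v Pv vneg.
have [U UP] := submodule_vspace P0 PD PZ.
pose b := vbasis U; pose d := \dim U.
pose e (u : 'rV[R]_d) := \sum_i u 0 i *: b`_i.
have eP u : P (e u).
  apply/UP; apply: memv_suml => i _; apply: memvZ; apply: vbasis_mem.
  by apply: mem_nth; rewrite size_tuple.
have esurj w : P w -> exists u, w = e u.
  move=> /UP wU; exists (\row_i coord b i w).
  by rewrite {1}(coord_vbasis wU); apply: eq_bigr => i _; rewrite mxE.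
have e0 : e 0 = 0 by rewrite /e big1// => i _; rewrite mxE scale0r.
have einj u : e u = 0 -> u = 0.
  move=> eu; have /freeP/(_ (fun i => u 0 i)) := basis_free (vbasisP U).
  move=> /(_ eu) h; apply/rowP => i; rewrite mxE; exact: h.
have expand (q : V -> V -> R) u :
    (forall x y z, q (x + y) z = q x z + q y z) ->
    (forall c x z, q (c *: x) z = c * q x z) -> (forall x y, q x y = q y x) ->
    q (e u) (e u) = \sum_i \sum_j u 0 i * u 0 j * q b`_i b`_j.
  move=> qD qZ qC.
  have qs z (F : 'I_d -> V) : q (\sum_i F i) z = \sum_i q (F i) z.
    elim/big_rec2: _ => [|i x y _ <-]; last by rewrite qD.
    by rewrite -(scale0r (0 : V)) qZ mul0r.
  rewrite {1}/e qs; apply: eq_bigr => i _; rewrite qZ qC {1}/e qs mulr_sumr.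
  by apply: eq_bigr => j _; rewrite qZ qC mulrA.
have [uv uvE] := esurj v Pv.
have vn0 : v != 0.
  apply: contraTneq vneg => ->; rewrite -(scale0r (0 : V)) aZ bZ !mul0r ltxx //.
have d0 : (0 < d)%N.
  rewrite lt0n; apply: contra_neq vn0 => dz; rewrite uvE.
  rewrite (_ : uv = 0) ?e0//; apply/rowP => i.
  suff: False by [].
  by have := leq_ltn_trans (leq0n i) (ltn_ord i); rewrite dz.
have [|u [lam [u0 uE umin]]] := @rayleigh_quotient_min d
   (fun i j => al b`_i b`_j) (fun i j => be b`_i b`_j) d0.
  move=> u un0; rewrite -expand//; apply: bpos => //.
  by apply: contra_neq un0; exact: einj.
move: uE umin; rewrite -!expand// => uE umin.
have min w : P w -> lam * be w w <= al w w.
  by move=> /esurj[z ->]; have := umin z; rewrite -!expand.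
have eu0 : e u != 0 by apply: contra_neq u0; exact: einj.
exists (e u), lam; split=> //.
  rewrite ltNge; apply/negP => lam1; have := le_lt_trans (min v Pv) vneg.
  by rewrite gtr_pMl ?bpos// ltNge lam1.
move=> w Pw; apply/eqP; rewrite -subr_eq0; apply/eqP.
apply: (@nonneg_form_radical V (fun x y => al x y - lam * be x y) P) => //.
- by move=> x y z; rewrite aD bD; ring.
- by move=> c x z; rewrite aZ bZ; ring.
- by move=> x y; rewrite aC bC.
- by move=> x Px; rewrite subr_ge0; exact: min.
- by rewrite uE subrr.
Qed.

End Rayleigh.

(** * The linearized problem on one Fourier mode *)

(** An isometry of the circle lifts to t |-> (-1)^rev t + shift on the line, so that the
action on loops becomes an explicit formula for functions of a real variable. *)
Record loop_symmetry (R : realType) (N : nat) := LoopSymmetry {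
  ls_rho : 'M[R]_3;
  ls_perm : 'S_N;
  ls_rev : bool;
  ls_shift : R }.

Section Modes.
Context {R : realType} {N : nat} (m : 'I_N -> R) (xbar : config R N).
Hypothesis m_gt0 : forall i, 0 < m i.
Hypothesis xbar_free : collision_free xbar.
Context (varpi : R).
Local Notation E := (config R N).
Local Notation Dl := (Delta m xbar).
Local Notation mdot := (mdot m).
Implicit Types (x y : E) (u v w : E * E) (s : loop_symmetry R N) (k t : R).

Definition act s x : E := ls_rho s *m col_perm (ls_perm s) x.

Lemma actD s x y : act s (x + y) = act s x + act s y.
Proof. by rewrite /act linearD/= mulmxDr. Qed.

Lemma actZ s c x : act s (c *: x) = c *: act s x.
Proof. by rewrite /act linearZ/= -scalemxAr. Qed.

(** Computing with the amplitudes instead of the loop keeps each Fourier mode in a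
finite-dimensional space. *)
Definition vmode k v t : E := cos (k * t) *: v.1 + sin (k * t) *: v.2.

(** The operator d/dt + varpi J on amplitudes; it is d/dt in the inertial frame. *)
Definition Dmode k v : E * E :=
  (k *: v.2 + varpi *: (J R *m v.1), - k *: v.1 + varpi *: (J R *m v.2)).

Definition pDelta v : E * E := (Dl v.1, Dl v.2).

Definition pdot u v : R := mdot u.1 v.1 + mdot u.2 v.2.

(** The action of a loop symmetry on amplitudes, from the addition formulas. *)
Definition pact k s v : E * E :=
  let c := k * ls_shift s in
  (act s (cos c *: v.1 + sin c *: v.2),
   (-1) ^+ ls_rev s *: act s (cos c *: v.2 - sin c *: v.1)).

Lemma pdotC u v : pdot u v = pdot v u.
Proof. by rewrite /pdot mdotC [mdot u.2 _]mdotC. Qed.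

Lemma pdotDl u v w : pdot (u + v) w = pdot u w + pdot v w.
Proof. by rewrite /pdot !mdotDl addrACA. Qed.

Lemma pdotZl c u w : pdot (c *: u) w = c * pdot u w.
Proof. by rewrite /pdot !mdotZl mulrDr. Qed.

Lemma pdot_eq0 u : pdot u u = 0 -> u = 0.
Proof.
move=> /eqP; rewrite /pdot paddr_eq0 ?mdot_ge0//.
by case: u => a b /= /andP[/eqP/(mdot_eq0 m_gt0)-> /eqP/(mdot_eq0 m_gt0)->].
Qed.

Lemma mdotJ x y : mdot (J R *m x) y = - mdot x (J R *m y).
Proof. by rewrite mdot_mulmx trJ mulNmx mdotNr. Qed.

Lemma Dmode_antisym k u v : pdot (Dmode k u) v = - pdot u (Dmode k v).
Proof.
rewrite /pdot /Dmode/= !mdotDl !mdotDr !mdotZl !mdotZr !mdotJ; ring.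
Qed.

Lemma DmodeD k u v : Dmode k (u + v) = Dmode k u + Dmode k v.
Proof.
rewrite /Dmode; apply/pair_equal_spec; split => /=;
  by rewrite !mulmxDr !scalerDr addrACA.
Qed.

Lemma DmodeZ k c u : Dmode k (c *: u) = c *: Dmode k u.
Proof.
rewrite /Dmode; apply/pair_equal_spec; split => /=;
  by rewrite -!scalemxAr !scalerDr !scalerA ![c * _]mulrC.
Qed.

Lemma pDeltaD u v : pDelta (u + v) = pDelta u + pDelta v.
Proof. by rewrite /pDelta /= !DeltaD. Qed.

Lemma pDeltaZ c u : pDelta (c *: u) = c *: pDelta u.
Proof. by rewrite /pDelta /= !DeltaZ. Qed.

Lemma pDelta_sym u v : pdot (pDelta u) v = pdot u (pDelta v).
Proof. by rewrite /pdot/= !mdot_Delta_sym. Qed.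

Lemma pactD k s u v : pact k s (u + v) = pact k s u + pact k s v.
Proof.
rewrite /pact; apply/pair_equal_spec; split => /=.
  by rewrite -actD; congr act; rewrite !scalerDr addrACA.
rewrite -scalerDr -actD; congr (_ *: act _ _).
by rewrite !scalerDr opprD addrACA.
Qed.

Lemma pactZ k s c u : pact k s (c *: u) = c *: pact k s u.
Proof.
rewrite /pact; apply/pair_equal_spec; split => /=.
  by rewrite -actZ; congr act; rewrite scalerDr !scalerA ![c * _]mulrC.
rewrite [RHS]scalerA [c * _]mulrC -[RHS]scalerA -actZ; congr (_ *: act _ _).
by rewrite scalerBr !scalerA ![c * _]mulrC.
Qed.

(** What the linearized problem retains of the invariance of the relative equilibrium. *)
Definition compatible s :=
  (forall x, Dl (act s x) = act s (Dl x)) /\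
  (forall x, act s (J R *m x) = (-1) ^+ ls_rev s *: (J R *m act s x)).

Lemma pact_Dmode k s v : compatible s ->
  pact k s (Dmode k v) = (-1) ^+ ls_rev s *: Dmode k (pact k s v).
Proof.
case=> _ HJ; rewrite /pact /Dmode.
set c := cos _; set d := sin _.
have sgn2 : (-1) ^+ ls_rev s * (-1) ^+ ls_rev s = 1 :> R by rewrite -expr2 sqrr_sign.
have e1 : act s (c *: (k *: v.2 + varpi *: (J R *m v.1)) +
       d *: (- k *: v.1 + varpi *: (J R *m v.2))) =
   k *: act s (c *: v.2 - d *: v.1) +
   varpi *: act s (J R *m (c *: v.1 + d *: v.2)).
  rewrite -!actZ -actD; congr act; rewrite mulmxDr -!scalemxAr !scalerDr !scalerA scalerN !scalerA.
  rewrite [d * - k]mulrN scaleNr ![_ * c]mulrC ![_ * d]mulrC.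
  by rewrite addrACA.
have e2 : act s (c *: (- k *: v.1 + varpi *: (J R *m v.2)) -
       d *: (k *: v.2 + varpi *: (J R *m v.1))) =
   - k *: act s (c *: v.1 + d *: v.2) +
   varpi *: act s (J R *m (c *: v.2 - d *: v.1)).
  rewrite -!actZ -actD; congr act; rewrite mulmxBr -!scalemxAr !scalerDr !scalerN !scalerA.
  rewrite !mulNr !mulrN !scaleNr !opprD ![_ * c]mulrC ![_ * d]mulrC.
  by rewrite addrACA.
apply/pair_equal_spec; split => /=.
  rewrite e1 HJ !scalerDr !scalerA; congr (_ *: _ + _ *: _); last by rewrite mulrC.
  by rewrite mulrAC sgn2 mul1r.
by rewrite e2 HJ -!scalemxAr; congr (_ *: _); rewrite !scalerA.
Qed.

Lemma pact_pDelta k s v : compatible s -> pact k s (pDelta v) = pDelta (pact k s v).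
Proof.
case=> HD _; rewrite /pact /pDelta; apply/pair_equal_spec; split => /=.
  by rewrite -!DeltaZ -DeltaD HD.
by rewrite -!DeltaZ -[- Dl _]scaleN1r -DeltaZ -DeltaD -HD DeltaZ scaleN1r.
Qed.

Lemma vmode_act n (omega : R) s v t :
  let k := n%:R * omega in
  act s (vmode k v ((-1) ^+ ls_rev s * t + ls_shift s)) = vmode k (pact k s v) t.
Proof.
move=> k; rewrite /vmode /pact/=; set c := k * ls_shift s.
have -> : k * ((-1) ^+ ls_rev s * t + ls_shift s) = (-1) ^+ ls_rev s * (k * t) + c.
  by rewrite mulrDr mulrCA.
rewrite cosD sinD.
have -> : cos ((-1) ^+ ls_rev s * (k * t)) = cos (k * t).
  by case: (ls_rev s); rewrite ?expr1 ?expr0 ?mulN1r ?cosN ?mul1r.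
have -> : sin ((-1) ^+ ls_rev s * (k * t)) = (-1) ^+ ls_rev s * sin (k * t).
  by case: (ls_rev s); rewrite ?expr1 ?expr0 ?mulN1r ?sinN ?mul1r.
rewrite scalerA -!actZ -actD; congr act.
rewrite !scalerDr !scalerN !scalerA !scalerBl !scalerDl.
move: (cos (k * t)) (sin (k * t)) => C S.
rewrite [S * (-1) ^+ _]mulrC -!scaleNr.
rewrite -!addrA; congr (_ + _); rewrite addrCA [RHS]addrCA; congr (_ + _).
by rewrite addrC.
Qed.

Section Admissible.
Context (omega : R) (S : set (loop_symmetry R N)).
Hypothesis omega_gt0 : 0 < omega.
Hypothesis S_compatible : forall s, S s -> compatible s.

(** The amplitudes of the n-th mode of an invariant centered loop.  As sin 0 = 0, the sine
amplitude of the zero mode has no meaning and is fixed to be 0. *)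
Definition admissible (n : nat) v := [/\ centered m v.1, centered m v.2,
  n = 0%N -> v.2 = 0 & forall s, S s -> pact (n%:R * omega) s v = v].

Lemma admissible0 n : admissible n 0.
Proof.
split=> //=; try exact: centered0.
by move=> s _; rewrite -(scale0r (0 : E * E)) pactZ !scale0r.
Qed.

Lemma admissibleD n u v : admissible n u -> admissible n v -> admissible n (u + v).
Proof.
move=> [u1 u2 u3 u4] [v1 v2 v3 v4]; split=> /=; try exact: centeredD.
  by move=> n0; rewrite u3// v3// addr0.
by move=> s Ss; rewrite pactD u4// v4.
Qed.

Lemma admissibleZ n c u : admissible n u -> admissible n (c *: u).
Proof.
move=> [u1 u2 u3 u4]; split=> /=; try exact: centeredZ.
  by move=> n0; rewrite u3// scaler0.
by move=> s Ss; rewrite pactZ u4.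
Qed.

Lemma admissible_pDelta n u : admissible n u -> admissible n (pDelta u).
Proof.
move=> [u1 u2 u3 u4]; split=> /=; try exact: Delta_centered.
  by move=> n0; rewrite u3// -(scale0r (0 : E)) DeltaZ !scale0r.
by move=> s Ss; rewrite pact_pDelta ?u4//; exact: S_compatible.
Qed.

Lemma admissible_Dmode2 n u : admissible n u ->
  admissible n (Dmode (n%:R * omega) (Dmode (n%:R * omega) u)).
Proof.
move=> [u1 u2 u3 u4].
have c1 := centered_mulmx (J R) u1; have c2 := centered_mulmx (J R) u2.
have d1 : centered m (Dmode (n%:R * omega) u).1 by apply: centeredD; exact: centeredZ.
have d2 : centered m (Dmode (n%:R * omega) u).2 by apply: centeredD; exact: centeredZ.
split.
- by apply: centeredD; apply: centeredZ => //; exact: centered_mulmx.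
- by apply: centeredD; apply: centeredZ => //; exact: centered_mulmx.
- move=> n0; rewrite /= u3// n0 !mul0r oppr0 !scale0r !add0r.
  by rewrite mulmx0 scaler0 mulmx0 scaler0.
move=> s Ss; have cs := S_compatible Ss.
rewrite pact_Dmode// pact_Dmode// DmodeZ scalerA -expr2 sqrr_sign scale1r.
by rewrite u4.
Qed.

Hypothesis eigenvalues_ge1 : forall n u lam, admissible n u -> u != 0 ->
  Dmode (n%:R * omega) (Dmode (n%:R * omega) u) = - lam *: pDelta u -> 1 <= lam.

(** The residual of the eigenvalue equation is itself admissible, so it may serve as
test vector. *)
Lemma pdot_radical n u lam : admissible n u ->
  (forall w, admissible n w ->
    pdot (Dmode (n%:R * omega) u) (Dmode (n%:R * omega) w) = lam * pdot (pDelta u) w) ->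
  Dmode (n%:R * omega) (Dmode (n%:R * omega) u) = - lam *: pDelta u.
Proof.
move=> ua H; set k := n%:R * omega in H *.
pose z := Dmode k (Dmode k u) + lam *: pDelta u.
have za : admissible n z.
  apply: admissibleD; first exact: admissible_Dmode2.
  by apply: admissibleZ; exact: admissible_pDelta.
have z0 : z = 0.
  apply: pdot_eq0; rewrite {1}/z pdotDl pdotZl Dmode_antisym H//.
  by rewrite addNr.
by apply/eqP; rewrite scaleNr -addr_eq0 -/z z0.
Qed.

(** A negative direction would make the minimum of the Rayleigh quotient an eigenvalue
below 1. *)
Lemma mode_action_ge0 n u : admissible n u ->
  pdot (pDelta u) u <= pdot (Dmode (n%:R * omega) u) (Dmode (n%:R * omega) u).
Proof.
move=> ua; rewrite leNgt; apply/negP => neg; set k := n%:R * omega in neg *.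
have pos v : admissible n v -> v != 0 -> 0 < pdot (pDelta v) v.
  case: v => a b [/= ca cb _ _] ab0; rewrite /pdot/=.
  have nneg x : centered m x -> 0 <= mdot (Dl x) x.
    move=> cx; have [->|x0] := eqVneq x 0; last by rewrite ltW// mdot_Delta_gt0.
    by rewrite mdotC -(scale0r (0 : E)) mdotZl mul0r.
  have [a0|a0] := eqVneq a 0.
    apply: ltr_wpDl; first exact: nneg.
    by apply: mdot_Delta_gt0 => //; apply: contra_neq ab0 => ->; rewrite a0.
  by apply: ltr_wpDr; [exact: nneg|exact: mdot_Delta_gt0].
have [v [lam [va v0 lam1 vE]]] := eigenvector_below_one
  (al := fun u v : E * E => pdot (Dmode k u) (Dmode k v))
  (be := fun u v : E * E => pdot (pDelta u) v)
  (admissible0 n) (@admissibleD n) (@admissibleZ n)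
  (fun u v w => etrans (congr1 (pdot ^~ _) (DmodeD k u v)) (pdotDl _ _ _))
  (fun c u w => etrans (congr1 (pdot ^~ _) (DmodeZ k c u)) (pdotZl _ _ _))
  (fun u v => pdotC _ _)
  (fun u v w => etrans (congr1 (pdot ^~ _) (pDeltaD u v)) (pdotDl _ _ _))
  (fun c u w => etrans (congr1 (pdot ^~ _) (pDeltaZ c u)) (pdotZl _ _ _))
  (fun u v => etrans (pDelta_sym u v) (pdotC _ _)) pos ua neg.
by have := eigenvalues_ge1 va v0 (pdot_radical va vE); rewrite leNgt lam1.
Qed.

(** By [mode_action_ge0], equality puts u in the radical of a nonnegative form. *)
Lemma mode_action_eq0 n u : admissible n u ->
  pdot (pDelta u) u = pdot (Dmode (n%:R * omega) u) (Dmode (n%:R * omega) u) ->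
  Dmode (n%:R * omega) (Dmode (n%:R * omega) u) = - pDelta u.
Proof.
move=> ua e; set k := n%:R * omega in e *.
rewrite -scaleN1r; apply: pdot_radical => // w wa; rewrite mul1r.
apply/eqP; rewrite -subr_eq0; apply/eqP.
apply: (@nonneg_form_radical R (E * E)%type
  (fun u v => pdot (Dmode k u) (Dmode k v) - pdot (pDelta u) v) (admissible n)) => //.
- by move=> x y z; rewrite DmodeD pDeltaD !pdotDl; ring.
- by move=> c x z; rewrite DmodeZ pDeltaZ !pdotZl; ring.
- by move=> x y; rewrite pdotC pDelta_sym [pdot x _]pdotC.
- exact: admissibleD.
- exact: admissibleZ.
- by move=> x xa; rewrite subr_ge0; exact: mode_action_ge0.
- by rewrite -e subrr.
Qed.

End Admissible.
End Modes.

(** * The quadratic form on loops *)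

Section LoopForm.
Context {R : realType} {N : nat} (m : 'I_N -> R) (xbar : config R N).
Hypothesis m_gt0 : forall i, 0 < m i.
Hypothesis xbar_free : collision_free xbar.
Context (varpi omega T : R).
Hypothesis omega_gt0 : 0 < omega.
Hypothesis T_def : T = 2 * pi / omega.
Local Notation E := (config R N).
Local Notation Dl := (Delta m xbar).
Local Notation mdot := (mdot m).
Local Notation pdot := (pdot m).
Local Notation Dmode := (Dmode varpi).
Local Notation pDelta := (pDelta m xbar).
Local Notation sq := (square_integrable T).
Local Notation H1 := (H1 T).
Local Notation ip := (ip T).
Notation mu := (@lebesgue_measure R).
Local Notation int a b f := (Rintegral mu [set` `[a, b]] f).
Implicit Types (x : E) (y v f g h r w : R -> E) (u : E * E) (t : R) (n : nat).

Let T_gt0 : 0 < T := period_gt0 omega_gt0 T_def.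
Let T_ge0 : 0 <= T. Proof. exact: ltW T_gt0. Qed.

Definition vsq f := forall k i, sq (fun t => f t k i).
Definition vH1 y v := forall k i, H1 (fun t => y t k i) (fun t => v t k i).
Definition vorth n f := forall k i, orth omega T n (fun t => f t k i).

Definition vip f g : R := int 0 T (fun t => mdot (f t) (g t)).

Lemma vsq_integrable f g : vsq f -> vsq g ->
  itv_integrable 0 T (fun t => mdot (f t) (g t)).
Proof.
move=> sf sg; under eq_fun do rewrite mdotE.
apply: itv_integrable_sum => i _; apply: itv_integrable_sum => k _.
by apply: itv_integrableZ; exact: square_integrableM.
Qed.

Lemma vipE f g : vsq f -> vsq g ->
  vip f g = \sum_(i < N) \sum_(k < 3) m i * ip (fun t => f t k i) (fun t => g t k i).
Proof.
move=> sf sg; rewrite /vip.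
under eq_Rintegral do rewrite mdotE.
rewrite int_sum => [|i _]; last first.
  by apply: itv_integrable_sum => k _; apply: itv_integrableZ; exact: square_integrableM.
apply: eq_bigr => i _; rewrite int_sum => [|k _]; last first.
  by apply: itv_integrableZ; exact: square_integrableM.
by apply: eq_bigr => k _; rewrite intZ//; exact: square_integrableM.
Qed.

Lemma vsqD f g : vsq f -> vsq g -> vsq (fun t => f t + g t).
Proof.
move=> sf sg k i; under eq_fun do rewrite mxE; exact: square_integrableD.
Qed.

Lemma vsqZ c f : vsq f -> vsq (fun t => c *: f t).
Proof. by move=> sf k i; under eq_fun do rewrite mxE; exact: square_integrableZ. Qed.

Lemma vsq_mulmx (A : 'M[R]_3) f : vsq f -> vsq (fun t => A *m f t).
Proof.
move=> sf k i; under eq_fun do rewrite mxE.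
by apply: square_integrable_sum => l _; exact: square_integrableZ.
Qed.

Lemma vsq_Delta f : vsq f -> vsq (fun t => Dl (f t)).
Proof.
move=> sf k i; under eq_fun do rewrite DeltaE mxE.
apply: square_integrable_sum => l _; under eq_fun do rewrite mulrC.
exact: square_integrableZ.
Qed.

Lemma vipC f g : vip f g = vip g f.
Proof. by apply: eq_int => t _; rewrite mdotC. Qed.

Lemma vipDl f g h : vsq f -> vsq g -> vsq h ->
  vip (fun t => f t + g t) h = vip f h + vip g h.
Proof.
move=> sf sg sh; rewrite /vip -intD; [|exact: vsq_integrable..].
by apply: eq_int => t _; rewrite mdotDl.
Qed.

Lemma vipDr f g h : vsq f -> vsq g -> vsq h ->
  vip h (fun t => f t + g t) = vip h f + vip h g.
Proof. by move=> *; rewrite vipC vipDl// vipC [vip g _]vipC. Qed.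

Lemma vip_sqrD f g : vsq f -> vsq g -> vip f g = 0 ->
  vip (fun t => f t + g t) (fun t => f t + g t) = vip f f + vip g g.
Proof.
move=> sf sg fg; have sfg := vsqD sf sg.
by rewrite vipDl// !vipDr// fg [vip g f]vipC fg addr0 add0r.
Qed.

Lemma vip_ge0 f : 0 <= vip f f.
Proof. by apply: int_ge0 => t _; exact: mdot_ge0. Qed.

Lemma vH1_sq y v : vH1 y v -> vsq y.
Proof. by move=> yv k i; exact: (sq_H1 omega_gt0 T_def (yv k i)). Qed.

Lemma vH1_deriv_sq y v : vH1 y v -> vsq v.
Proof. by move=> yv k i; exact: (H1_deriv (yv k i)). Qed.

Definition vel y v t : E := v t + varpi *: (J R *m y t).

(** Twice the quadratic part of the lower bound for the action. *)
Definition qform y v : R := vip (vel y v) (vel y v) - vip (fun t => Dl (y t)) y.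

Lemma vel_sq y v : vH1 y v -> vsq (vel y v).
Proof.
move=> yv; apply: vsqD; first exact: vH1_deriv_sq yv.
by apply: vsqZ; apply: vsq_mulmx; exact: vH1_sq yv.
Qed.

Local Notation freq n := (n%:R * omega).

Lemma vmodeE n u t k i :
  vmode (freq n) u t k i = mode omega n (u.1 k i) (u.2 k i) t.
Proof. by rewrite !mxE /mode /cosn /sinn mulrC [X in _ + X]mulrC. Qed.

Definition dmode (c : R) u : E * E := (c *: u.2, - c *: u.1).

Lemma vH1_vmode n u : vH1 (vmode (freq n) u) (vmode (freq n) (dmode (freq n) u)).
Proof.
move=> k i; under eq_fun do rewrite vmodeE.
under [X in H1 _ X]eq_fun do rewrite vmodeE.
have := H1_mode omega_gt0 T_def n (u.1 k i) (u.2 k i).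
by rewrite /dmode /= !mxE mulNr.
Qed.

Lemma vmode_Dmode c u t : vmode c (Dmode c u) t =
  vmode c (dmode c u) t + varpi *: (J R *m vmode c u t).
Proof.
rewrite /vmode /Dmode /dmode/= mulmxDr -!scalemxAr !scalerDr !scalerA.
by rewrite ![varpi * _]mulrC addrACA.
Qed.

Lemma vmode_Delta c u t : Dl (vmode c u t) = vmode c (pDelta u) t.
Proof. by rewrite /vmode DeltaD !DeltaZ. Qed.

Lemma vorth_vip n f u : vsq f -> vorth n f -> vip f (vmode (freq n) u) = 0.
Proof.
move=> sf fo; rewrite vipE//; last exact: vH1_sq (vH1_vmode n u).
rewrite big1// => i _; rewrite big1// => k _.
rewrite (@eq_ip _ _ _ (fun t => f t k i) _ (mode omega n (u.1 k i) (u.2 k i)))//.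
  by rewrite orth_ip_mode ?mulr0.
by move=> t _; rewrite vmodeE.
Qed.

(** The square norm of the n-th cosine on [0, T]. *)
Definition mode_mass n : R := T / (2 - (n == 0%N)%:R).

Lemma mode_mass_gt0 n : 0 < mode_mass n.
Proof. by case: n => [|n]; rewrite divr_gt0//= ?subr_gt0 ?subr0 ?ltr1n. Qed.

Lemma vip_vmode n u u' : (n = 0%N -> u.2 = 0) -> (n = 0%N -> u'.2 = 0) ->
  vip (vmode (freq n) u) (vmode (freq n) u') = mode_mass n * pdot u u'.
Proof.
move=> z z'; rewrite vipE; [|exact: vH1_sq (vH1_vmode _ _)..].
have e k i : ip (fun t => vmode (freq n) u t k i) (fun t => vmode (freq n) u' t k i)
   = mode_mass n * (u.1 k i * u'.1 k i + u.2 k i * u'.2 k i).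
  rewrite (@eq_ip _ _ _ (mode omega n (u.1 k i) (u.2 k i)) _ (mode omega n (u'.1 k i) (u'.2 k i))); last 2 first.
  - by move=> t _; rewrite vmodeE.
  - by move=> t _; rewrite vmodeE.
  rewrite /mode_mass; case: n z z' => [|n] z z'.
    by rewrite ip_mode_mode0// z// z'// !mxE mulr0 addr0 (_ : 2 - _ = 1) ?divr1//=; ring.
  by rewrite (ip_mode_mode omega_gt0 T_def)//= subr0.
rewrite /pdot !mdotE -big_split/= mulr_sumr; apply: eq_bigr => i _.
rewrite -big_split/= mulr_sumr; apply: eq_bigr => k _.
by rewrite e; ring.
Qed.

Definition vproj n y : E * E :=
  (\matrix_(k, i) fcos omega T n (fun t => y t k i),
   \matrix_(k, i) fsin omega T n (fun t => y t k i)).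

Lemma fsin0 (f : R -> R) : fsin omega T 0 f = 0.
Proof. by rewrite /fsin sinn0 (ip0r T_gt0) mulr0. Qed.

Lemma orthD n (f g : R -> R) : sq f -> sq g -> orth omega T n f -> orth omega T n g ->
  orth omega T n (fun t => f t + g t).
Proof.
have scn := sq_cosn omega T n; have ssn := sq_sinn omega T n.
by move=> sf sg [f1 f2] [g1 g2]; split; rewrite ipDl// ?f1 ?f2 ?g1 ?g2 addr0.
Qed.

Lemma orthZ n c (f : R -> R) : sq f -> orth omega T n f -> orth omega T n (fun t => c * f t).
Proof.
have scn := sq_cosn omega T n; have ssn := sq_sinn omega T n.
by move=> sf [f1 f2]; split; rewrite ipZl// ?f1 ?f2 mulr0.
Qed.

Lemma orth_sum n (I : Type) (s : seq I) (F : I -> R -> R) :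
  (forall i, sq (F i)) -> (forall i, orth omega T n (F i)) ->
  orth omega T n (fun t => \sum_(i <- s) F i t).
Proof.
move=> sF oF; elim: s => [|i s IHs].
  by under eq_fun do rewrite big_nil; split; exact: ip0l.
under eq_fun do rewrite big_cons.
by apply: orthD => //; exact: square_integrable_sum.
Qed.

Lemma vorth_vel n r w : vH1 r w -> vorth n r -> vorth n (vel r w).
Proof.
move=> rw ro k i; have sr := vH1_sq rw.
have ow := orth_deriv omega_gt0 T_def (rw k i) (ro k i).
rewrite /vel; under eq_fun do rewrite mxE [X in _ + X]mxE [X in _ + _ * X]mxE.
apply: orthD.
- exact: (H1_deriv (rw k i)).
- apply: square_integrableZ; apply: square_integrable_sum => l _.
  by apply: square_integrableZ; exact: sr.
- exact: ow.
- apply: orthZ.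
    by apply: square_integrable_sum => l _; apply: square_integrableZ; exact: sr.
  apply: orth_sum => l; first by apply: square_integrableZ; exact: sr.
  by apply: orthZ; [exact: sr|exact: ro].
Qed.

(** The cross terms vanish because the derivative of a function without n-th mode has
no n-th mode either. *)
Lemma qform_mode_split n u r w : (n = 0%N -> u.2 = 0) -> vH1 r w -> vorth n r ->
  qform (fun t => vmode (freq n) u t + r t)
        (fun t => vmode (freq n) (dmode (freq n) u) t + w t) =
  mode_mass n * (pdot (Dmode (freq n) u) (Dmode (freq n) u) - pdot (pDelta u) u)
  + qform r w.
Proof.
move=> u0 rw ro; have sr := vH1_sq rw; have sDr := vel_sq rw.
have oDr := vorth_vel rw ro.
have sm u' : vsq (vmode (freq n) u') by exact: vH1_sq (vH1_vmode n u').
have D0 : n = 0%N -> (Dmode (freq n) u).2 = 0.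
  by move=> n0; rewrite /Dmode/= n0 !mul0r oppr0 scale0r add0r u0// mulmx0 scaler0.
have pD0 : n = 0%N -> (pDelta u).2 = 0.
  by move=> n0; rewrite /pDelta/= u0// DeltaE mul0mx.
have e1 : vel (fun t => vmode (freq n) u t + r t)
     (fun t => vmode (freq n) (dmode (freq n) u) t + w t) =
    (fun t => vmode (freq n) (Dmode (freq n) u) t + vel r w t).
  by apply/funext => t; rewrite vmode_Dmode /vel mulmxDr scalerDr addrACA.
have e2 : (fun t => Dl (vmode (freq n) u t + r t)) =
    (fun t => vmode (freq n) (pDelta u) t + Dl (r t)).
  by apply/funext => t; rewrite DeltaD vmode_Delta.
have e3 : vip (fun t => Dl (r t)) (vmode (freq n) u) = 0.
  rewrite -[RHS](vorth_vip (pDelta u) sr ro).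
  by apply: eq_int => t _; rewrite mdot_Delta_sym vmode_Delta.
have e4 : vip (vmode (freq n) (Dmode (freq n) u)) (vel r w) = 0.
  by rewrite vipC; exact: vorth_vip.
have e5 : vip (vmode (freq n) (pDelta u)) r = 0.
  by rewrite vipC; exact: vorth_vip.
have sDl := vsq_Delta sr.
rewrite /qform e1 e2 (vip_sqrD (sm _) sDr e4) (vip_vmode D0 D0).
rewrite (vipDl (sm _) sDl (vsqD (sm u) sr)) (vipDr (sm u) sr (sm _)) (vipDr (sm u) sr sDl).
rewrite (vip_vmode pD0 u0) e3 e5 addr0 add0r; ring.
Qed.

Lemma vproj_split n y v u : vH1 y v -> vproj n y = u ->
  exists r w, [/\ forall t, r t = y t - vmode (freq n) u t,
    vH1 r w, vorth n r, forall j, j != n -> vorth j y -> vorth j r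
    & qform y v = mode_mass n * (pdot (Dmode (freq n) u) (Dmode (freq n) u)
        - pdot (pDelta u) u) + qform r w].
Proof.
move=> yv uE.
pose r t := y t - vmode (freq n) u t.
pose w t := v t - vmode (freq n) (dmode (freq n) u) t.
have rE k i : (fun t => r t k i) = (fun t => y t k i -
    mode omega n (fcos omega T n (fun t => y t k i)) (fsin omega T n (fun t => y t k i)) t).
  by apply/funext => t; rewrite /r mxE [(- _ : E) k i]mxE vmodeE -uE !mxE.
have rw : vH1 r w.
  move=> k i; have := H1B (yv k i) (vH1_vmode n u k i).
  congr (H1 _ _); apply/funext => t; by rewrite !mxE.
have ro : vorth n r.
  by move=> k i; rewrite rE; exact: (orth_sub_mode_self omega_gt0 T_def _ (yv k i)).
have u0 : n = 0%N -> u.2 = 0.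
  by move=> n0; rewrite -uE; apply/matrixP => k i; rewrite !mxE n0 fsin0.
exists r, w; split=> //.
  move=> j jn yo k i; rewrite rE.
  apply: (orthB (sq_H1 omega_gt0 T_def (yv k i)) _ (yo k i)).
    exact: sq_mode.
  by apply: orth_mode_neq => //; rewrite eq_sym.
rewrite -(qform_mode_split u0 rw ro).
apply: (f_equal2 qform); apply/funext => t; by rewrite subrKC.
Qed.

(** Substitution of t for (-1)^e t + c, then the addition formulas. *)
Lemma fourier_reparam n (f : R -> R) (e : bool) (c : R) :
  continuous f -> (forall t, f (t + T) = f t) ->
  let g t := f ((-1) ^+ e * t + c) in
  ip g (cosn omega n) = cos (freq n * c) * ip f (cosn omega n)
                      + sin (freq n * c) * ip f (sinn omega n) /\
  ip g (sinn omega n) = (-1) ^+ e * (cos (freq n * c) * ip f (sinn omega n)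
                      - sin (freq n * c) * ip f (cosn omega n)).
Proof.
move=> cf fp g; have sf := square_integrable_continuous T cf.
have sc := sq_cosn omega T n; have ss := sq_sinn omega T n.
have sgn2 : (-1) ^+ e * (-1) ^+ e = 1 :> R by rewrite -expr2 sqrr_sign.
have cosb : continuous (fun t => cos (freq n * (t - c))).
  move=> t; have := is_derive_at_continuous (is_derive_cos_affine (freq n) (- (freq n * c)) t).
  by rewrite /prop_for /continuous_at mulrBr; under eq_fun do rewrite -mulrBr.
have sinb : continuous (fun t => sin (freq n * (t - c))).
  move=> t; have := is_derive_at_continuous (is_derive_sin_affine (freq n) (- (freq n * c)) t).
  by rewrite /prop_for /continuous_at mulrBr; under eq_fun do rewrite -mulrBr.
have cosp t : cos (freq n * (t + T - c)) = cos (freq n * (t - c)).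
  rewrite addrAC; have := cos_periodic omega_gt0 T_def n 0 (t - c).
  by rewrite !addr0.
have sinp t : sin (freq n * (t + T - c)) = sin (freq n * (t - c)).
  rewrite addrAC; have := sin_periodic omega_gt0 T_def n 0 (t - c).
  by rewrite !addr0.
split.
- have -> : ip g (cosn omega n) = int 0 T (fun t => f t * cos (freq n * (t - c))).
    rewrite -(@int_periodic_reparam _ T (fun t => f t * cos (freq n * (t - c))) e c T_ge0).
    + apply: eq_int => t _; rewrite /g addrK; congr (_ * _).
      by case: e {g sgn2}; rewrite ?expr0 ?expr1 ?mulN1r ?mulrN ?cosN ?mul1r.
    + by move=> t; apply: cvgM; [exact: cf|exact: cosb].
    + by move=> t; rewrite fp cosp.
  rewrite -!ipZr// -ipDr//; try exact: square_integrableZ.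
  by apply: eq_int => t _; rewrite mulrBr cosB /cosn /sinn; ring.
- have -> : ip g (sinn omega n) =
      int 0 T (fun t => f t * ((-1) ^+ e * sin (freq n * (t - c)))).
    rewrite -(@int_periodic_reparam _ T (fun t => f t * ((-1) ^+ e * sin (freq n * (t - c)))) e c T_ge0).
    + apply: eq_int => t _; rewrite /g addrK; congr (_ * _).
      by case: e {g sgn2}; rewrite ?expr0 ?expr1 ?mulN1r ?mulrN ?sinN ?opprK ?mul1r.
    + move=> t; apply: cvgM; first exact: cf.
      exact: continuousZ_fun sinb t.
    + by move=> t; rewrite fp sinp.
  rewrite -!ipZr// -ipBr//; try exact: square_integrableZ.
  rewrite -ipZr//; last by apply: square_integrableB; exact: square_integrableZ.
  by apply: eq_int => t _; rewrite mulrBr sinB /cosn /sinn; ring.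
Qed.

Lemma fcos_reparam n (f : R -> R) (e : bool) (c : R) :
  continuous f -> (forall t, f (t + T) = f t) ->
  fcos omega T n (fun t => f ((-1) ^+ e * t + c)) =
  cos (freq n * c) * fcos omega T n f + sin (freq n * c) * fsin omega T n f.
Proof.
move=> cf fp; have [h _] := fourier_reparam n e c cf fp.
rewrite /fcos /fsin h; case: n {h} => [|n].
  by rewrite !mul0r cos0 sin0 !mul0r !addr0 !mul1r.
by rewrite /= subr0; ring.
Qed.

Lemma fsin_reparam n (f : R -> R) (e : bool) (c : R) :
  continuous f -> (forall t, f (t + T) = f t) ->
  fsin omega T n (fun t => f ((-1) ^+ e * t + c)) =
  (-1) ^+ e * (cos (freq n * c) * fsin omega T n f - sin (freq n * c) * fcos omega T n f).
Proof.
move=> cf fp; have [_ h] := fourier_reparam n e c cf fp.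
case: n h => [|n] h; first by rewrite !fsin0 !mul0r sin0 mul0r mulr0 subrr mulr0.
by rewrite /fcos /fsin h /= subr0; ring.
Qed.

Lemma ip_suml (I : Type) (s : seq I) (F : I -> R -> R) (g : R -> R) :
  (forall i, sq (F i)) -> sq g ->
  ip (fun t => \sum_(i <- s) F i t) g = \sum_(i <- s) ip (F i) g.
Proof.
move=> sF sg; elim: s => [|i s IHs].
  by rewrite big_nil; under eq_fun do rewrite big_nil; exact: ip0l.
rewrite big_cons -IHs -ipDl//; last exact: square_integrable_sum.
by under eq_fun do rewrite big_cons.
Qed.

Lemma fcos_lin n (I : Type) (s : seq I) (c : I -> R) (F : I -> R -> R) :
  (forall i, sq (F i)) ->
  fcos omega T n (fun t => \sum_(i <- s) c i * F i t) =
  \sum_(i <- s) c i * fcos omega T n (F i).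
Proof.
move=> sF; have sc := sq_cosn omega T n.
rewrite /fcos ip_suml//; last by move=> i; exact: square_integrableZ.
by rewrite mulr_sumr; apply: eq_bigr => i _; rewrite ipZl// mulrCA.
Qed.

Lemma fsin_lin n (I : Type) (s : seq I) (c : I -> R) (F : I -> R -> R) :
  (forall i, sq (F i)) ->
  fsin omega T n (fun t => \sum_(i <- s) c i * F i t) =
  \sum_(i <- s) c i * fsin omega T n (F i).
Proof.
move=> sF; have ss := sq_sinn omega T n.
rewrite /fsin ip_suml//; last by move=> i; exact: square_integrableZ.
by rewrite mulr_sumr; apply: eq_bigr => i _; rewrite ipZl// mulrCA.
Qed.

Definition invariant_loop (S : set (loop_symmetry R N)) y :=
  forall s, S s -> forall t, act s (y ((-1) ^+ ls_rev s * t + ls_shift s)) = y t.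

Lemma vproj_admissible S n y v : vH1 y v -> (forall t, centered m (y t)) ->
  invariant_loop S y -> admissible m omega S n (vproj n y).
Proof.
move=> yv yc yS; have sy := vH1_sq yv.
have cy k i : continuous (fun t => y t k i) := H1_continuous omega_gt0 T_def (yv k i).
have py k i t : y (t + T) k i = y t k i := H1_periodic (yv k i) t.
split.
- apply/centeredP => k; under eq_bigr do rewrite mxE.
  rewrite -fcos_lin// (_ : (fun t => _) = (fun=> 0)) /fcos ?(ip0l T_gt0) ?mulr0//.
  by apply/funext => t; have /centeredP -> := yc t.
- apply/centeredP => k; under eq_bigr do rewrite mxE.
  rewrite -fsin_lin// (_ : (fun t => _) = (fun=> 0)) /fsin ?(ip0l T_gt0) ?mulr0//.
  by apply/funext => t; have /centeredP -> := yc t.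
- by move=> ->; apply/matrixP => k i; rewrite !mxE fsin0.
- move=> s Ss.
  have yE k i : (fun t => y t k i) = (fun t => \sum_(l <- index_enum 'I_3)
      ls_rho s k l * y ((-1) ^+ ls_rev s * t + ls_shift s) l (ls_perm s i)).
    by apply/funext => t; rewrite -(yS s Ss t) mxE; apply: eq_bigr => l _; rewrite mxE.
  have sye k i : sq (fun t => y ((-1) ^+ ls_rev s * t + ls_shift s) k i).
    apply: square_integrable_continuous => t.
    have caff : {for t, continuous (fun t : R => (-1) ^+ ls_rev s * t + ls_shift s)}.
      by apply: cvgD; [apply: cvgMr; exact: cvg_id|exact: cvg_cst].
    exact: (@continuous_comp _ _ _ _ (fun t => y t k i) t caff (cy k i _)).
  apply/pair_equal_spec; split; apply/matrixP => k i.
    rewrite [RHS]mxE yE fcos_lin// mxE; apply: eq_bigr => l _.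
    by rewrite !mxE (@fcos_reparam n (fun t => y t l (ls_perm s i)))//.
  rewrite [RHS]mxE yE fsin_lin// mxE mxE mulr_sumr; apply: eq_bigr => l _.
  by rewrite !mxE (@fsin_reparam n (fun t => y t l (ls_perm s i)))// mulrCA.
Qed.

Lemma invariant_sub_mode S n y u : invariant_loop S y -> admissible m omega S n u ->
  invariant_loop S (fun t => y t - vmode (freq n) u t).
Proof.
move=> yS [_ _ _ uS] s Ss t.
by rewrite -[- vmode _ _ _]scaleN1r actD actZ scaleN1r yS// vmode_act uS.
Qed.

Lemma centered_vmode S n u t : admissible m omega S n u -> centered m (vmode (freq n) u t).
Proof. by move=> [u1 u2 _ _]; apply: centeredD; exact: centeredZ. Qed.

(** The modes are removed one after the other: subtracting a mode of an invariant
centered loop leaves such a loop, and creates none of the modes removed before. *)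
Lemma mode_decomposition S y v n : vH1 y v -> (forall t, centered m (y t)) ->
  invariant_loop S y ->
  exists (u : nat -> E * E) r w,
    [/\ forall k, (k < n)%N -> admissible m omega S k (u k),
        vH1 r w, forall k, (k < n)%N -> vorth k r,
        forall t, y t = \sum_(k < n) vmode (freq k) (u k) t + r t
      & qform y v = \sum_(k < n) mode_mass k *
          (pdot (Dmode (freq k) (u k)) (Dmode (freq k) (u k)) - pdot (pDelta (u k)) (u k))
          + qform r w /\ ((forall t, centered m (r t)) /\ invariant_loop S r)].
Proof.
move=> yv yc yS; elim: n => [|n [u [r [w [ua rw ro yE [qE [rc rS]]]]]]].
  exists (fun=> 0), y, v; split=> //.
    by move=> t; rewrite big_ord0 add0r.
  by rewrite big_ord0 add0r.
have za := vproj_admissible n rw rc rS.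
have [r' [w' [r'E rw' ro' roj qE']]] := vproj_split rw (erefl (vproj n r)).
move: (vproj n r) za r'E qE' => z za r'E qE'.
pose u' k := if k == n then z else u k.
have u'n : u' n = z by rewrite /u' eqxx.
have u'k k : (k < n)%N -> u' k = u k by rewrite /u' => kn; rewrite ltn_eqF.
exists u', r', w'; split=> //.
- move=> k; rewrite ltnS leq_eqVlt => /predU1P[->|kn]; first by rewrite u'n.
  by rewrite u'k//; exact: ua.
- move=> k; rewrite ltnS leq_eqVlt => /predU1P[->//|kn].
  by apply: roj; [rewrite ltn_eqF|exact: ro].
- move=> t; rewrite big_ord_recr/= u'n r'E -addrA subrKC yE; congr (_ + _).
  by apply: eq_bigr => k _; rewrite u'k.
split; last first.
  have -> : r' = (fun t => r t - vmode (freq n) z t) by apply/funext.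
  split; last exact: invariant_sub_mode.
  move=> t; rewrite -scaleN1r; apply: centeredD => //; apply: centeredZ.
  exact: centered_vmode za.
rewrite big_ord_recr/= u'n qE qE' addrA; congr (_ + _ + _).
by apply: eq_bigr => k _; rewrite u'k.
Qed.

Lemma mdot_J_le x : mdot (J R *m x) (J R *m x) <= mdot x x.
Proof.
rewrite !mdotE; apply: ler_sum => i _.
rewrite -!mulr_sumr ler_wpM2l ?(ltW (m_gt0 i))//.
rewrite !big_ord_recl !big_ord0 !mxE !big_ord_recl !big_ord0 !mxE/=.
by have := sqr_ge0 (x (lift ord0 (lift ord0 ord0)) i); rewrite expr2; lra.
Qed.

Lemma mdot_Delta_bound : exists2 C, 0 <= C & forall x, mdot (Dl x) x <= C * mdot x x.
Proof.
pose c (i j : 'I_N) := m i * m j / mutual_distance xbar i j ^+ 3.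
have c0 i j : 0 <= c i j.
  by rewrite divr_ge0 ?exprn_ge0 ?mutual_distance_ge0// mulr_ge0 ?ltW.
exists (\sum_(i < N) \sum_(j < N | (i < j)%N) c i j * (2 * ((m i)^-1 + (m j)^-1))).
  apply: sumr_ge0 => i _; apply: sumr_ge0 => j _.
  by rewrite mulr_ge0// mulr_ge0// addr_ge0// invr_ge0 ltW.
move=> x; rewrite mdot_Delta mulr_suml; apply: ler_sum => i _.
rewrite mulr_suml; apply: ler_sum => j _; rewrite -[c i j * _ * _]mulrA -/(c i j) ler_wpM2l//.
have b l : \sum_(k < 3) x k l * x k l <= (m l)^-1 * mdot x x.
  rewrite mulrC ler_pdivlMr// mulrC mdotE (bigD1 l)//= -mulr_sumr lerDl.
  apply: sumr_ge0 => l' _; apply: sumr_ge0 => k _.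
  by rewrite mulr_ge0 ?(ltW (m_gt0 _))// -expr2 sqr_ge0.
apply: le_trans (_ : 2 * (\sum_(k < 3) x k i * x k i + \sum_(k < 3) x k j * x k j) <= _).
  rewrite -big_split mulr_sumr; apply: ler_sum => k _ /=.
  by have := sqr_ge0 (x k i + x k j); rewrite expr2; lra.
by rewrite -mulrA ler_wpM2l// mulrDl lerD.
Qed.

(** Loops without low modes have a small potential term compared with the kinetic
one, so the form is coercive on them. *)
Lemma qform_coercive : exists n, forall r w, vH1 r w ->
  (forall k, (k < n)%N -> vorth k r) ->
  0 <= qform r w /\ (qform r w = 0 -> forall t, r t = 0).
Proof.
have [C C0 CP] := mdot_Delta_bound.
pose K := varpi ^+ 2 + C.
have K0 : 0 <= K by rewrite addr_ge0 ?sqr_ge0.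
(* makes K times the square norm of r at most 1/4 that of w *)
pose delta := (4 * T * (K + 1))^-1.
have delta0 : 0 < delta by rewrite invr_gt0 !mulr_gt0//; lra.
have [n nP] := high_modes_small omega_gt0 T_def delta0.
exists n.+1 => r w rw ro; have sr := vH1_sq rw; have sw := vH1_deriv_sq rw.
have rsmall k i t : r t k i ^+ 2 <= delta * ip (fun t => w t k i) (fun t => w t k i).
  by apply: (nP _ _ (rw k i)) => j jn; exact: ro.
have rr : vip r r <= delta * T * vip w w.
  rewrite !vipE// mulr_sumr; apply: ler_sum => i _; rewrite mulr_sumr.
  apply: ler_sum => k _; rewrite mulrCA ler_wpM2l ?(ltW (m_gt0 i))//.
  set W := (X in _ <= _ * X); have -> : delta * T * W = int 0 T (fun=> delta * W).
    by rewrite int_cst// subr0 mulrAC.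
  apply: le_int; first exact: square_integrableM.
    exact: continuous_itv_integrable (@cst_continuous _ _ _).
  by move=> t _; rewrite -expr2; exact: rsmall.
have low : 2^-1 * vip w w - K * vip r r <= qform r w.
  have sv := vel_sq rw; have sD := vsq_Delta sr.
  have iw := vsq_integrable sw sw; have ir := vsq_integrable sr sr.
  have iv := vsq_integrable sv sv; have iD := vsq_integrable sD sr.
  rewrite /qform /vip -!intZ// -!intB//; try exact: itv_integrableZ.
  apply: le_int.
  - by apply: itv_integrableB; exact: itv_integrableZ.
  - exact: itv_integrableB.
  move=> t _; have h1 := CP (r t); have h2 := mdot_J_le (r t).
  have h3 : 2^-1 * mdot (w t) (w t) - varpi ^+ 2 * mdot (J R *m r t) (J R *m r t)
      <= mdot (vel r w t) (vel r w t).
    have := mdot_ge0 m_gt0 (w t + 2 *: (varpi *: (J R *m r t))).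
    rewrite /vel; move: (J R *m r t) => z.
    rewrite !mdotDl !mdotDr !mdotZl !mdotZr [mdot z (w t)]mdotC.
    move: (mdot _ _) (mdot _ _) (mdot _ _) => A B D; nra.
  have h4 : varpi ^+ 2 * mdot (J R *m r t) (J R *m r t) <= varpi ^+ 2 * mdot (r t) (r t).
    by rewrite ler_wpM2l ?sqr_ge0.
  rewrite /K mulrDl; lra.
have W0 : 0 <= vip w w := vip_ge0 w.
have dT : K * (delta * T) <= 4^-1.
  rewrite /delta.
  have -> : K * ((4 * T * (K + 1))^-1 * T) = K / (K + 1) / 4.
    by field; rewrite !gt_eqF//; lra.
  by rewrite ler_piMl// ler_pdivrMr ?mul1r; lra.
have low2 : 4^-1 * vip w w <= qform r w.
  have h1 : K * vip r r <= K * (delta * T * vip w w) by rewrite ler_wpM2l.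
  have h2 : K * (delta * T * vip w w) <= 4^-1 * vip w w by rewrite mulrA ler_wpM2r.
  by lra.
split; first by apply: le_trans low2; rewrite mulr_ge0.
move=> q0; have w0 : vip w w = 0 by apply/le_anti; rewrite W0 andbT; lra.
move=> t; apply/matrixP => k i; rewrite mxE.
have wki : ip (fun t => w t k i) (fun t => w t k i) = 0.
  have := w0; rewrite vipE// => /eqP.
  rewrite psumr_eq0 => [/allP/(_ i (mem_index_enum i))|i' _]; last first.
    by apply: sumr_ge0 => k' _; rewrite mulr_ge0 ?(ltW (m_gt0 _))// ip_ge0.
  rewrite /= psumr_eq0 => [/allP/(_ k (mem_index_enum k))|k' _]; last first.
    by rewrite mulr_ge0 ?(ltW (m_gt0 _))// ip_ge0.
  by rewrite /= mulf_eq0 gt_eqF//= => /eqP.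
have := rsmall k i t; rewrite wki mulr0 => h.
by apply/eqP; rewrite -sqrf_eq0; apply/eqP/le_anti; rewrite h sqr_ge0.
Qed.

Section Nonnegativity.
Context (S : set (loop_symmetry R N)).
Hypothesis S_compatible : forall s, S s -> compatible m xbar s.
Hypothesis eigenvalues_ge1 : forall n u lam, admissible m omega S n u -> u != 0 ->
  Dmode (freq n) (Dmode (freq n) u) = - lam *: pDelta u -> 1 <= lam.

Let mode_ge0 k u : admissible m omega S k u ->
  0 <= mode_mass k * (pdot (Dmode (freq k) u) (Dmode (freq k) u) - pdot (pDelta u) u).
Proof.
move=> ua; apply: mulr_ge0; first exact: ltW (mode_mass_gt0 k).
by rewrite subr_ge0; exact: (mode_action_ge0 m_gt0 xbar_free S_compatible eigenvalues_ge1 ua).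
Qed.

(** The low modes are handled by [mode_action_ge0], the rest by coercivity. *)
Lemma qform_ge0 y v : vH1 y v -> (forall t, centered m (y t)) ->
  invariant_loop S y -> 0 <= qform y v.
Proof.
move=> yv yc yS; have [n nP] := qform_coercive.
have [u [r [w [ua rw ro yE [-> _]]]]] := mode_decomposition n yv yc yS.
apply: addr_ge0; last by have [] := nP r w rw ro.
by apply: sumr_ge0 => k _; apply: mode_ge0; exact: ua.
Qed.

(** By coercivity the loop has no high modes at all; the regularity of minimizers comes
from here. *)
Lemma qform_eq0 y v : vH1 y v -> (forall t, centered m (y t)) ->
  invariant_loop S y -> qform y v = 0 ->
  exists n (u : nat -> E * E),
    (forall t, y t = \sum_(k < n) vmode (freq k) (u k) t) /\
    forall k, (k < n)%N -> Dmode (freq k) (Dmode (freq k) (u k)) = - pDelta (u k).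
Proof.
move=> yv yc yS q0; have [n nP] := qform_coercive.
have [u [r [w [ua rw ro yE [qE _]]]]] := mode_decomposition n yv yc yS.
have [r0 rP] := nP r w rw ro.
have s0 : 0 <= \sum_(k < n) mode_mass k *
     (pdot (Dmode (freq k) (u k)) (Dmode (freq k) (u k)) - pdot (pDelta (u k)) (u k)).
  by apply: sumr_ge0 => k _; apply: mode_ge0; exact: ua.
move: q0; rewrite qE => /eqP; rewrite paddr_eq0// => /andP[/eqP sum0 /eqP /rP rz].
exists n, u; split=> [t|k kn]; first by rewrite yE rz addr0.
apply: (mode_action_eq0 m_gt0 xbar_free S_compatible eigenvalues_ge1 (ua k kn)).
move/eqP: sum0; rewrite psumr_eq0 => [/allP/(_ (Ordinal kn) (mem_index_enum _))|j _]; last first.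
  by apply: mode_ge0; exact: ua.
by rewrite /= mulf_eq0 gt_eqF ?mode_mass_gt0//= subr_eq0 => /eqP.
Qed.

End Nonnegativity.

End LoopForm.

(** * Isometries of the circle *)

Section CircleIsometries.
Context {R : realType}.
Implicit Types (x a b t : R).

Lemma cos_eq1 x : cos x = 1 -> exists n : int, x = n%:~R * (pi *+ 2).
Proof.
move=> cx; have p0 : 0 < pi *+ 2 :> R by rewrite pmulrn_lgt0 ?pi_gt0.
have [n] := periodic_reduction x p0; set z := _ + _ => /andP[z0 z2].
have cz : cos z = 1 by rewrite /z (periodic_int (@cosD2pi R)).
have zero (w : R) : 0 <= w -> w <= pi -> cos w = 1 -> w = 0.
  move=> w0 wpi cw; apply/eqP; rewrite eq_le w0 andbT leNgt; apply/negP => w1.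
  have pp := pi_ge0 R.
  by have := @ltr_cos R 0 w; rewrite !in_itv/= w0 wpi lexx pp => /(_ isT isT); rewrite cw cos0 ltxx w1.
have [zp|zp] := leP z pi.
  by exists (- n); rewrite mulrNz mulNr; apply/eqP; rewrite -addr_eq0; apply/eqP; exact: zero.
have w0 : 0 <= pi *+ 2 - z by lra.
have wp : pi *+ 2 - z <= pi by rewrite mulr2n; lra.
have cw : cos (pi *+ 2 - z) = 1 by rewrite cosB cos2pi sin2pi cz mul0r addr0 mulr1.
have /eqP := zero _ w0 wp cw; rewrite subr_eq0 => /eqP zE.
have xE : x = z - n%:~R * (pi *+ 2) by rewrite /z addrK.
by exists (1 - n); rewrite {1}xE rmorphB/= mulrBl mul1r; congr (_ - _).
Qed.

Lemma unit_vector_angle a b : a ^+ 2 + b ^+ 2 = 1 -> exists u, a = cos u /\ b = sin u.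
Proof.
move=> ab; have a1 : -1 <= a <= 1.
  have b2 := sqr_ge0 b; have : a ^+ 2 <= 1 by lra.
  by rewrite -ler_norml -(@ler_sqr _ `|a| 1) ?nnegrE// real_normK ?num_real// expr1n.
have sE : sin (acos a) = `|b|.
  by rewrite sin_acos// -sqrtr_sqr -ab; congr Num.sqrt; ring.
have cE : cos (acos a) = a by rewrite acosK.
have [b0|b0] := leP 0 b.
  by exists (acos a); rewrite cE sE ger0_norm.
by exists (- acos a); rewrite cosN sinN cE sE ltr0_norm// opprK.
Qed.

Lemma orthogonal_mx_inv n (A : 'M[R]_n) : orthogonal_mx A ->
  [/\ invmx A = A^T, A *m A^T = 1%:M & orthogonal_mx (invmx A)].
Proof.
move=> oA; have oA' : A *m A^T = 1%:M by exact: mulmx1C.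
have [uA _] := mulmx1_unit oA'.
have iA : invmx A = A^T by rewrite -[A^T]mul1mx -(mulVmx uA) -mulmxA oA' mulmx1.
by split=> //; rewrite /orthogonal_mx iA trmxK.
Qed.

(** The first column is (cos u, sin u); the second one, a unit vector orthogonal to it,
is determined up to the sign (-1)^e, here called l. *)
Lemma orthogonal2_angle (A : 'M[R]_2) : orthogonal_mx A ->
  exists (e : bool) u, forall x : R,
    A *m (\col_(k < 2) (if k == 0 then cos x else sin x)) =
    \col_(k < 2) (if k == 0 then cos ((-1) ^+ e * x + u) else sin ((-1) ^+ e * x + u)).
Proof.
move=> oA; have E i j : (A^T *m A) i j = (i == j)%:R by rewrite oA mxE.
have e00 := E 0 0; have e01 := E 0 1; have e11 := E 1 1.
rewrite !mxE !big_ord_recl !big_ord0 !mxE in e00 e01 e11.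
have l1 : lift ord0 ord0 = 1 :> 'I_2 by apply/val_inj.
rewrite l1 !addr0 -/(0 : 'I_2) in e00 e01 e11.
have z0 : ord0 = 0 :> 'I_2 by []. rewrite z0 /= in e00 e01 e11.
have [u [aE bE]] : exists u, A 0 0 = cos u /\ A 1 0 = sin u.
  by apply: unit_vector_angle; rewrite !expr2 e00.
rewrite aE bE in e00 e01.
have cs := cos2Dsin2 u.
set p := A 0 1 in e01 e11; set q := A 1 1 in e01 e11.
pose l := q * cos u - p * sin u.
have pE : p = - l * sin u.
  have : p * (cos u ^+ 2 + sin u ^+ 2) =
    - l * sin u + cos u * (cos u * p + sin u * q) by rewrite /l; ring.
  by rewrite cs mulr1 e01 mulr0 addr0.
have qE : q = l * cos u.
  have : q * (cos u ^+ 2 + sin u ^+ 2) =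
    l * cos u + sin u * (cos u * p + sin u * q) by rewrite /l; ring.
  by rewrite cs mulr1 e01 mulr0 addr0.
have l2 : l ^+ 2 = 1.
  have : l ^+ 2 * (cos u ^+ 2 + sin u ^+ 2) =
    (- l * sin u) * (- l * sin u) + (l * cos u) * (l * cos u) by ring.
  by rewrite cs mulr1 -pE -qE e11.
have col x : A *m (\col_(k < 2) (if k == 0 then cos x else sin x)) =
    \col_(k < 2) (if k == 0 then cos u * cos x - l * sin u * sin x else sin u * cos x + l * cos u * sin x).
  apply/colP => k; rewrite !mxE !big_ord_recl !big_ord0 !mxE/= l1 z0 addr0.
  have [->|->] : k = 0 \/ k = 1.
    by case: k => [[|[|]]]//= ?; [left|right]; apply/val_inj.
  + by rewrite eqxx aE -/p pE; ring.
  + by rewrite /= bE -/q qE.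
move/eqP: l2; rewrite sqrf_eq1 => /orP[/eqP l1'|/eqP lN1].
  exists false, u => x; rewrite col; apply/colP => k; rewrite !mxE expr0 mul1r l1' cosD sinD.
  by case: ifP => _; ring.
exists true, u => x; rewrite col; apply/colP => k; rewrite !mxE expr1 mulN1r lN1 cosD sinD cosN sinN.
by case: ifP => _; ring.
Qed.

(** Since time_act picks an arbitrary representative modulo T, the integer n may depend
on t. *)
Lemma time_act_affine (omega T : R) (A : 'M[R]_2) : 0 < omega -> T = 2 * pi / omega ->
  orthogonal_mx A ->
  exists (e : bool) c, forall t, exists n : int,
    time_act T A t = (-1) ^+ e * t + c + n%:~R * T.
Proof.
move=> w0 TE /orthogonal2_angle[e [u AE]].
have wn0 : omega != 0 by rewrite gt_eqF.
have pn0 : pi != 0 :> R by rewrite gt_eqF// pi_gt0.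
have P0 : 2 * pi != 0 :> R by rewrite mulf_neq0.
have ang t : 2 * pi * t / T = omega * t.
  by rewrite TE invf_div; move: (2 * pi) P0 => P P0; field.
exists e, (u / omega) => t.
pose s0 := (-1) ^+ e * t + u / omega.
have h0 : circle_point T s0 = A *m circle_point T t.
  rewrite /circle_point !ang AE; apply/colP => k; rewrite !mxE.
  have -> : omega * s0 = (-1) ^+ e * (omega * t) + u by rewrite /s0; field.
  by [].
have h1 : circle_point T (time_act T A t) = A *m circle_point T t.
  by rewrite /time_act; apply: (@getPex _ [set s | circle_point T s = A *m circle_point T t]); exists s0.
move: (time_act T A t) h1 => s1; rewrite -h0 /circle_point !ang => h.
have hc := congr1 (fun v : 'cV[R]_2 => v 0 0) h; rewrite !mxE/= in hc.
have hs := congr1 (fun v : 'cV[R]_2 => v 1 0) h; rewrite !mxE/= in hs.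
have [n nE] : exists n : int, omega * s1 - omega * s0 = n%:~R * (pi *+ 2).
  by apply: cos_eq1; rewrite cosB hc hs -!expr2 cos2Dsin2.
exists n; rewrite -/s0; apply: (mulfI wn0); rewrite mulrDr TE.
have -> : omega * s1 = omega * s0 + n%:~R * (pi *+ 2) by rewrite -nE; ring.
by congr (_ + _); rewrite mulrCA [omega * _]mulrC mulfVK// mulr_natl.
Qed.

End CircleIsometries.

(** * Symmetries of the relative equilibrium *)

Section HorizontalRotation.
Context {R : realType} {N : nat}.
Local Notation E := (config R N).
Implicit Types (x : E) (phi : R).

Lemma sum3 (F : 'I_3 -> R) : \sum_(k < 3) F k = F 0 + F 1 + F ord_max.
Proof.
by rewrite !big_ord_recl big_ord0 addr0 addrA; congr (F _ + F _ + F _); apply/val_inj.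
Qed.

Lemma ord3P (k : 'I_3) : [\/ k = 0, k = 1 | k = ord_max].
Proof.
by case: k => [[|[|[|]]] lk]//; [apply: Or31|apply: Or32|apply: Or33]; apply/val_inj.
Qed.

(** Here - J^2 and 1 + J^2 are the projections on the horizontal plane and on the
vertical axis. *)
Lemma expJ_decomp phi : expJ phi = cos phi *: (- (J R *m J R)) + sin phi *: J R
  + (1%:M + J R *m J R).
Proof.
apply/matrixP => i j; rewrite !mxE !big_ord_recl !big_ord0 !mxE.
by case: i => [[|[|[|]]] ?]//; case: j => [[|[|[|]]] ?]//=; rewrite ?eqE/=; ring.
Qed.

Lemma J3 : J R *m (J R *m J R) = - J R.
Proof.
apply/matrixP => i j; rewrite !mxE !big_ord_recl !big_ord0 !mxE !big_ord_recl !big_ord0 !mxE.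
by case: i => [[|[|[|]]] ?]//; case: j => [[|[|[|]]] ?]//=; ring.
Qed.

Lemma expJ_orthogonal phi : orthogonal_mx (expJ phi).
Proof.
apply/matrixP => i j; rewrite !mxE !big_ord_recl !big_ord0 !mxE.
have cs := cos2Dsin2 phi.
case: i => [[|[|[|]]] ?]//; case: j => [[|[|[|]]] ?]//=; rewrite ?eqE/=;
  by (ring || (rewrite -cs; ring)).
Qed.

Lemma horizontalJJ x : horizontal x -> J R *m (J R *m x) = - x.
Proof.
move=> hx; apply/matrixP => k i; rewrite !mxE !big_ord_recl !big_ord0 !mxE.
rewrite !big_ord_recl !big_ord0 !mxE.
have := congr1 (fun v : 'rV_N => v 0 i) hx; rewrite !mxE => x2.
case: k => [[|[|[|]]] lk]//=; rewrite ?mul0r ?mulN1r ?mul1r ?add0r ?addr0 ?mul0r ?addr0.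
- by congr (- x _ _); apply/val_inj.
- by congr (- x _ _); apply/val_inj.
- by rewrite (_ : Ordinal lk = ord_max) ?x2 ?oppr0//; apply/val_inj.
Qed.

Lemma expJ_horizontal phi x : horizontal x ->
  expJ phi *m x = cos phi *: x + sin phi *: (J R *m x).
Proof.
move=> hx; rewrite expJ_decomp !mulmxDl -!scalemxAl mulNmx mul1mx -mulmxA horizontalJJ//.
by rewrite opprK subrr addr0.
Qed.

Lemma horizontalJ x : horizontal (J R *m x).
Proof.
apply/rowP => i; rewrite !mxE !big_ord_recl !big_ord0 !mxE/=.
by rewrite !mul0r !addr0.
Qed.

Lemma horizontalD x y : horizontal x -> horizontal y -> horizontal (x + y).
Proof. by rewrite /horizontal => hx hy; rewrite linearD/= hx hy addr0. Qed.

Lemma horizontalZ c x : horizontal x -> horizontal (c *: x).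
Proof. by rewrite /horizontal => hx; rewrite linearZ/= hx scaler0. Qed.

Lemma mutual_distance_orthogonal (A : 'M[R]_3) x i j : orthogonal_mx A ->
  mutual_distance (A *m x) i j = mutual_distance x i j.
Proof.
move=> oA; rewrite /mutual_distance /enorm; congr Num.sqrt.
have colM k : col k (A *m x) = A *m col k x by rewrite !colE mulmxA.
rewrite !colM -mulmxBr; move: (_ - _) => z.
have e (w : 'cV[R]_3) : \sum_(k < 3) w k 0 ^+ 2 = (w^T *m w) 0 0.
  by rewrite mxE; apply: eq_bigr => k _; rewrite mxE expr2.
by rewrite !e trmx_mul -mulmxA [A^T *m _]mulmxA oA mul1mx.
Qed.

End HorizontalRotation.

Section SymmetryCompatibility.
Context {R : realType} {N : nat} (m : 'I_N -> R) (xbar : config R N).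
Hypothesis m_gt0 : forall i, 0 < m i.
Hypothesis xbar_neq0 : xbar != 0.
Hypothesis xbar_horizontal : horizontal xbar.
Context (omega : R).
Hypothesis omega_gt0 : 0 < omega.
Local Notation E := (config R N).
Local Notation Dl := (Delta m xbar).
Implicit Types (x y : E) (s : loop_symmetry R N) (t : R).

Lemma col_perm_mulmx (A : 'M[R]_3) (p : 'S_N) x :
  A *m col_perm p x = col_perm p (A *m x).
Proof. by apply/matrixP => k i; rewrite !mxE; apply: eq_bigr => l _; rewrite mxE. Qed.

Lemma mutual_distance_perm (p : 'S_N) x i j :
  mutual_distance (col_perm p x) i j = mutual_distance x (p i) (p j).
Proof. by congr Num.sqrt; apply: eq_bigr => k _; rewrite !mxE. Qed.

(** Placing two bodies alone off the center of mass shows that all masses are multiplied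
by the same factor, which is 1 because the total mass is unchanged. *)
Lemma centered_perm_mass (p : 'S_N) :
  (forall x, centered m x -> centered m (col_perm p x)) -> forall i, m (p i) = m i.
Proof.
move=> H.
have cross a b : m (p^-1%g a) * m b = m (p^-1%g b) * m a.
  have [->//|ab] := eqVneq a b.
  pose c : E := \matrix_(k, i) ((i == a)%:R / m a - (i == b)%:R / m b).
  have mn0 i : m i != 0 by rewrite gt_eqF.
  have cc : centered m c.
    apply/centeredP => k; under eq_bigr do rewrite mxE mulrBr.
    rewrite sumrB (bigD1 a)//= big1 => [|i /negbTE ->]; last by rewrite mul0r mulr0.
    rewrite (bigD1 b)//= big1 => [|i /negbTE ->]; last by rewrite mul0r mulr0.
    by rewrite !eqxx !mul1r !addr0 !divff// subrr.
  have /centeredP/(_ 0) := H _ cc.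
  under eq_bigr do rewrite !mxE mulrBr.
  rewrite sumrB (bigD1 (p^-1%g a))//= big1 => [|i ia]; last first.
    by rewrite (_ : (p i == a) = false) ?mul0r ?mulr0//; apply/negbTE; apply: contra ia => /eqP <-; rewrite permK.
  rewrite (bigD1 (p^-1%g b))//= big1 => [|i ib]; last first.
    by rewrite (_ : (p i == b) = false) ?mul0r ?mulr0//; apply/negbTE; apply: contra ib => /eqP <-; rewrite permK.
  rewrite !permKV !eqxx !mul1r !addr0 => /eqP; rewrite subr_eq0 => /eqP h.
  have : m (p^-1%g a) / m a * (m a * m b) = m (p^-1%g b) / m b * (m a * m b) by rewrite h.
  by rewrite mulrA divfK// mulrCA divfK// [m a * _]mulrC.
move=> i; pose M := \sum_j m j.
have M0 : M != 0.
  rewrite gt_eqF// /M (bigD1 i)//= ltr_pwDl// sumr_ge0// => j _; exact: ltW.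
have : m (p^-1%g (p i)) * M = M * m (p i).
  rewrite {1}/M mulr_sumr.
  under eq_bigr do rewrite cross.
  rewrite -mulr_suml; congr (_ * _).
  by rewrite /M (reindex_inj (@perm_inj _ p))/=; apply: eq_bigr => j _; rewrite permK.
by rewrite permK mulrC => /(mulfI M0).
Qed.

(** Invariance at time 0 and a quarter of a period later gives the images under rho of
two configurations w and J w whose columns together span the horizontal plane; they
force rho to preserve this plane, with the orientation given by the direction of
time. *)
Lemma compatible_of_invariant s :
  orthogonal_mx (ls_rho s) ->
  (forall x, centered m x -> centered m (act s x)) ->
  (forall t, act s (rotating omega (fun=> xbar) ((-1) ^+ ls_rev s * t + ls_shift s)) =
     rotating omega (fun=> xbar) t) ->
  compatible m xbar s.
Proof.
move=> orho cact inv; set rho := ls_rho s in orho *; set p := ls_perm s.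
have mp : forall i, m (p i) = m i.
  apply: centered_perm_mass => x cx.
  have := centered_mulmx rho^T (cact _ cx).
  by rewrite /act mulmxA orho mul1mx.
have yE t : rotating omega (fun=> xbar) t = cos (omega * t) *: xbar + sin (omega * t) *: (J R *m xbar).
  by rewrite /rotating expJ_horizontal.
pose g := omega * ls_shift s.
pose w0 := expJ g *m xbar.
have h1 : act s w0 = xbar.
  have := inv 0; rewrite mulr0 add0r /rotating mulr0 -/g -/w0 => ->.
  by rewrite expJ_horizontal// cos0 sin0 scale1r scale0r addr0.
have w0h : horizontal w0.
  rewrite /w0 expJ_horizontal//; apply: horizontalD; apply: horizontalZ => //.
  exact: horizontalJ.
have wn0 : omega != 0 by rewrite gt_eqF.
(* a quarter of a period later *)
have h2 : act s (J R *m w0) = (-1) ^+ ls_rev s *: (J R *m xbar).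
  have := inv (pi / 2 / omega).
  rewrite !yE mulrDr -/g mulrCA [omega * (pi / 2 / _)]mulrC mulfVK//.
  rewrite cos_pihalf sin_pihalf scale0r add0r scale1r => <-.
  rewrite -actZ; congr act; rewrite /w0 expJ_horizontal// mulmxDr -!scalemxAr horizontalJJ//.
  case: (ls_rev s); rewrite ?expr1 ?expr0 ?mulN1r ?mul1r ?scaleN1r ?scale1r.
    by rewrite ![_ + g]addrC cosBpihalf sinBpihalf opprD scaleNr opprK scalerN addrC.
  by rewrite ![_ + g]addrC cosDpihalf sinDpihalf scalerN scaleNr addrC.
pose w := col_perm p w0.
have wh : horizontal w.
  by apply/rowP => i; have := congr1 (fun v : 'rV_N => v 0 (p i)) w0h; rewrite !mxE.
have r1 : rho *m w = xbar by exact: h1.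
have r2 : rho *m (J R *m w) = (-1) ^+ ls_rev s *: (J R *m xbar).
  by rewrite -h2 /act; congr (_ *m _); exact: col_perm_mulmx.
pose e : R := (-1) ^+ ls_rev s.
have e2 : e * e = 1 by rewrite -expr2 sqrr_sign.
pose M := rho *m J R - e *: (J R *m rho).
(* M vanishes on w and on J w, whose columns span the horizontal plane *)
have Mw : M *m w = 0.
  by rewrite mulmxBl -mulmxA r2 -scalemxAl -mulmxA r1 subrr.
have MJw : M *m (J R *m w) = 0.
  rewrite mulmxBl -mulmxA horizontalJJ// mulmxN r1 -scalemxAl -mulmxA r2.
  by rewrite -scalemxAr horizontalJJ// scalerA e2 scale1r opprK addNr.
have w2 i : w ord_max i = 0.
  by have := congr1 (fun v : 'rV_N => v 0 i) wh; rewrite [LHS]mxE [RHS]mxE.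
have [i wi0] : exists i, w 0 i != 0 \/ w 1 i != 0.
  apply/not_existsP => h.
  suff w00 : w = 0 by move: xbar_neq0; rewrite -r1 w00 mulmx0 eqxx.
  apply/matrixP => k i; rewrite [RHS]mxE.
  have := h i => /not_orP[/negP/negPn/eqP a /negP/negPn/eqP b].
  by case: (ord3P k) => ->.
have Mcol k : M k 0 = 0 /\ M k 1 = 0.
  have a := congr1 (fun A : E => A k i) Mw; rewrite mxE sum3 [RHS]mxE w2 mulr0 addr0 in a.
  have b := congr1 (fun A : E => A k i) MJw; rewrite mxE sum3 [RHS]mxE in b.
  have j0 : (J R *m w) 0 i = - w 1 i by rewrite mxE sum3 !mxE/=; ring.
  have j1 : (J R *m w) 1 i = w 0 i by rewrite mxE sum3 !mxE/=; ring.
  have j2 : (J R *m w) ord_max i = 0 by rewrite mxE sum3 !mxE/=; ring.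
  rewrite j0 j1 j2 mulr0 addr0 in b.
  move: (w 0 i) (w 1 i) (M k 0) (M k 1) wi0 a b => u v A B uv a b.
  have n0 : u ^+ 2 + v ^+ 2 != 0.
    rewrite paddr_eq0 ?sqr_ge0// !sqrf_eq0 negb_and.
    by case: uv => ->; rewrite ?orbT.
  split; apply: (mulfI n0); rewrite mulr0.
    transitivity (u * (A * u + B * v) - v * (A * - v + B * u)); first ring.
    by rewrite a b !mulr0 subrr.
  transitivity (v * (A * u + B * v) + u * (A * - v + B * u)); first ring.
  by rewrite a b !mulr0 addr0.
have J_comm : rho *m J R = e *: (J R *m rho).
  have ME k l : M k l = (rho *m J R) k l - e * (J R *m rho) k l by rewrite !mxE.
  have r21 : rho ord_max 1 = 0.
    have [+ _] := Mcol ord_max; rewrite ME !mxE !sum3 !mxE/=.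
    by move=> h; rewrite -[RHS]h; ring.
  have r20 : rho ord_max 0 = 0.
    have [_ +] := Mcol ord_max; rewrite ME !mxE !sum3 !mxE/=.
    by move=> /eqP h; apply/eqP; rewrite -oppr_eq0 -(eqP h); apply/eqP; ring.
  (* rho maps the horizontal plane to itself, hence also the vertical axis *)
  have [_ orho' _] := orthogonal_mx_inv orho.
  have n1 := congr1 (fun A : 'M[R]_3 => A ord_max ord_max) orho'.
  have n2 := congr1 (fun A : 'M[R]_3 => A ord_max ord_max) orho.
  rewrite !mxE sum3 !mxE eqxx r20 r21 in n1; rewrite !mxE sum3 !mxE eqxx in n2.
  have [r02 r12] : rho 0 ord_max = 0 /\ rho 1 ord_max = 0.
    move: (rho 0 ord_max) (rho 1 ord_max) (rho ord_max ord_max) n1 n2 => a b c n1 n2.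
    have : a ^+ 2 + b ^+ 2 == 0.
      apply/eqP; transitivity (a * a + b * b + c * c - (0 * 0 + 0 * 0 + c * c)); first ring.
      by rewrite n2 n1 subrr.
    by rewrite paddr_eq0 ?sqr_ge0// !sqrf_eq0 => /andP[/eqP-> /eqP->].
  apply/eqP; rewrite -subr_eq0 -/M; apply/eqP/matrixP => k l; rewrite [RHS]mxE.
  have [m0 m1] := Mcol k.
  case: (ord3P l) => -> //; rewrite ME !mxE !sum3 !mxE/= r02 r12.
  by case: (ord3P k) => ->/=; ring.
split.
- move=> x; rewrite /act Delta_mulmx; congr (_ *m _).
  have dist a j : mutual_distance xbar a j = mutual_distance xbar (p a) (p j).
    rewrite -{1}r1 mutual_distance_orthogonal// mutual_distance_perm.
    by rewrite mutual_distance_orthogonal//; exact: expJ_orthogonal.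
  apply/matrixP => k a; rewrite [LHS]mxE [RHS]mxE [RHS]mxE.
  rewrite [RHS](reindex_inj (@perm_inj _ p))/=.
  apply: eq_big => [j|j ja]; first by rewrite (inj_eq perm_inj).
  by rewrite !mxE mp -dist.
- by move=> x; rewrite /act -col_perm_mulmx mulmxA J_comm -scalemxAl mulmxA.
Qed.

End SymmetryCompatibility.

(** * Modes in the inertial frame and invariant loops *)

Section RotatingModes.
Context {R : realType} {N : nat}.
Local Notation E := (config R N).

Lemma is_derive_mx (M : R -> E) (D : E) (t : R) :
  (forall k i, is_derive t 1 (fun s => M s k i) (D k i)) ->
  derivable M t 1 /\ derive1 M t = D.
Proof.
move=> dM.
have d : derivable M t 1 by apply/derivable_mxP => k i; have [] := dM k i.
split=> //; rewrite derive1E derive_mx//; apply/matrixP => k i; rewrite mxE.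
by have [] := dM k i.
Qed.

Lemma is_derive_trig_product (w k al be ga al' be' ga' t : R) :
  is_derive t 1 (fun s => (al * cos (w * s) + be * sin (w * s) + ga) * cos (k * s)
                        + (al' * cos (w * s) + be' * sin (w * s) + ga') * sin (k * s))
   ((- (w * al) * sin (w * t) + w * be * cos (w * t)) * cos (k * t)
    - k * (al * cos (w * t) + be * sin (w * t) + ga) * sin (k * t)
    + (- (w * al') * sin (w * t) + w * be' * cos (w * t)) * sin (k * t)
    + k * (al' * cos (w * t) + be' * sin (w * t) + ga') * cos (k * t)).
Proof.
have dc := is_derive_cosM w t; have ds := is_derive_sinM w t.
have kc := is_derive_cosM k t; have ks := is_derive_sinM k t.
have d1 a b c : is_derive t 1 (fun s => a * cos (w * s) + b * sin (w * s) + c)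
    (- (w * a) * sin (w * t) + w * b * cos (w * t)).
  apply: eq_is_derive (is_deriveD (is_deriveD (is_deriveZ a dc) (is_deriveZ b ds)) (is_derive_cst c t 1)) _ _.
    by [].
  by rewrite /GRing.scale/= addr0; ring.
apply: eq_is_derive (is_deriveD (is_deriveM (d1 al be ga) kc) (is_deriveM (d1 al' be' ga') ks)) _ _.
  by [].
by rewrite /GRing.scale/=; ring.
Qed.

Lemma is_derive_rotating_mode (varpi k : R) (u : E * E) (t : R) :
  derivable (rotating varpi (vmode k u)) t 1 /\
  derive1 (rotating varpi (vmode k u)) t = rotating varpi (vmode k (Dmode varpi k u)) t.
Proof.
pose A (x : E) := - (J R *m (J R *m x)); pose B (x : E) := J R *m x.
pose K (x : E) := x + J R *m (J R *m x).
have XE (v : E * E) s : rotating varpi (vmode k v) s =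
   cos (k * s) *: (cos (varpi * s) *: A v.1 + sin (varpi * s) *: B v.1 + K v.1)
   + sin (k * s) *: (cos (varpi * s) *: A v.2 + sin (varpi * s) *: B v.2 + K v.2).
  rewrite /rotating /vmode expJ_decomp mulmxDr -!scalemxAr.
  by congr (_ *: _ + _ *: _); rewrite /A /B /K !mulmxDl -!scalemxAl mulNmx mul1mx !mulmxA.
have J3v (x : E) : J R *m (J R *m (J R *m x)) = - (J R *m x).
  by rewrite [X in _ *m X]mulmxA mulmxA J3 mulNmx.
have AD x y a b : A (a *: x + b *: (J R *m y)) = a *: A x + b *: B y.
  by rewrite /A /B !mulmxDr -!scalemxAr J3v opprD !scalerN opprK.
have BD x y a b : B (a *: x + b *: (J R *m y)) = a *: B x - b *: A y.
  by rewrite /A /B !mulmxDr -!scalemxAr scalerN opprK.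
have KD x y a b : K (a *: x + b *: (J R *m y)) = a *: K x.
  rewrite /K !mulmxDr -!scalemxAr J3v scalerN addrACA addrN addr0 -scalerDr //.
apply: is_derive_mx => l i.
have h := is_derive_trig_product varpi k (A u.1 l i) (B u.1 l i) (K u.1 l i)
   (A u.2 l i) (B u.2 l i) (K u.2 l i) t.
apply: eq_is_derive h _ _.
  by move=> s; rewrite XE !mxE; ring.
rewrite XE /Dmode/= !AD !BD !KD.
move: (A u.1) (B u.1) (K u.1) (A u.2) (B u.2) (K u.2) => a1 b1 c1 a2 b2 c2.
by rewrite !mxE; ring.
Qed.

Lemma rotating_mode_twice_derivable (varpi k : R) (u : E * E) :
  twice_derivable (rotating varpi (vmode k u)) /\
  forall t, derive1 (derive1 (rotating varpi (vmode k u))) t =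
    rotating varpi (vmode k (Dmode varpi k (Dmode varpi k u))) t.
Proof.
have e : derive1 (rotating varpi (vmode k u)) = rotating varpi (vmode k (Dmode varpi k u)).
  by apply/funext => t; have [] := is_derive_rotating_mode varpi k u t.
split=> t; last by rewrite e; have [] := is_derive_rotating_mode varpi k (Dmode varpi k u) t.
split; first by have [] := is_derive_rotating_mode varpi k u t.
by rewrite e; have [] := is_derive_rotating_mode varpi k (Dmode varpi k u) t.
Qed.

End RotatingModes.

Section LoopSpaces.
Context {R : realType} {N : nat} (m : 'I_N -> R) (xbar : config R N).
Hypothesis m_gt0 : forall i, 0 < m i.
Context (omega T varpi : R).
Hypothesis omega_gt0 : 0 < omega.
Hypothesis T_def : T = 2 * pi / omega.
Context (G : set (symmetry R N)).
Local Notation E := (config R N).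
Local Notation freq n := (n%:R * omega).

Let T_gt0 : 0 < T := period_gt0 omega_gt0 T_def.

Lemma LambdaP (y : R -> E) : Lambda m T y <->
  (forall t, centered m (y t)) /\ exists v, vH1 T y v.
Proof.
split=> [[yp yc [v yv]]|[yc [v yv]]].
  split=> //; exists v => k i; have [sv vi] := yv k i.
  by split=> // t; rewrite ?yp//; exact: vi.
split=> //; last by exists v => k i; have [_ sv vi] := yv k i.
by move=> t; apply/matrixP => k i; have [yp _ _] := yv k i; exact: yp.
Qed.

(** The hypothesis of periodicity absorbs the choice of representatives made by
time_act. *)
Definition symmetries_of : set (loop_symmetry R N) :=
  [set s | exists2 g, G g & [/\ ls_rho s = sym_space g, ls_perm s = (sym_body g)^-1%g
    & forall y : R -> E, (forall t, y (t + T) = y t) ->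
      forall t, loop_act T g y t = act s (y ((-1) ^+ ls_rev s * t + ls_shift s))]].

Hypothesis G_subgroup : finite_subgroup G.

Lemma symmetries_of_surj g : G g -> exists2 s, symmetries_of s &
  forall y : R -> E, (forall t, y (t + T) = y t) ->
      forall t, loop_act T g y t = act s (y ((-1) ^+ ls_rev s * t + ls_shift s)).
Proof.
move=> Gg; have [_ Gorth _ _ _] := G_subgroup; have [ot os] := Gorth g Gg.
have [_ _ oi] := orthogonal_mx_inv ot.
have [e [c ecP]] := time_act_affine omega_gt0 T_def oi.
pose s := LoopSymmetry (sym_space g) (sym_body g)^-1%g e c.
have sP (y : R -> E) : (forall t, y (t + T) = y t) ->
    forall t, loop_act T g y t = act s (y ((-1) ^+ e * t + c)).
  move=> yp t; rewrite /loop_act /act/=; have [n ->] := ecP t.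
  by rewrite (periodic_int yp).
by exists s => //; exists g.
Qed.

Lemma LambdaG_invariant (y : R -> E) : LambdaG m T G y -> invariant_loop symmetries_of y.
Proof.
move=> [[yp _ _] yG] s [g Gg [_ _ sP]] t.
by rewrite -sP// yG.
Qed.

Lemma invariant_LambdaG (y : R -> E) : Lambda m T y ->
  invariant_loop symmetries_of y -> LambdaG m T G y.
Proof.
move=> Ly yS; split=> // g Gg; have [s Ss sP] := symmetries_of_surj Gg.
have [yp _ _] := Ly.
by apply/funext => t; rewrite sP// yS.
Qed.

Lemma constant_loop_Lambda (c : E) : centered m c -> Lambda m T (fun=> c).
Proof.
move=> cc; apply/LambdaP; split=> //; exists (fun=> 0) => k i.
have -> : (fun t : R => (0 : E) k i) = (fun=> 0) by apply/funext => t; rewrite mxE.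
apply: H1_C1 => //; exact: cst_continuous.
Qed.

Hypothesis G_acts : acts_on_loops m T G.

(** G preserves the space of loops, which contains the constant ones. *)
Lemma act_centered s (x : E) : symmetries_of s -> centered m x -> centered m (act s x).
Proof.
move=> [g Gg [_ _ sP]] cx.
have [_ + _] := G_acts Gg (constant_loop_Lambda cx).
by move=> /(_ 0); rewrite sP.
Qed.

Lemma symmetries_of_orthogonal s : symmetries_of s -> orthogonal_mx (ls_rho s).
Proof.
move=> [g Gg [-> _ _]]; have [_ Gorth _ _ _] := G_subgroup.
by have [] := Gorth g Gg.
Qed.

Hypothesis xbar_neq0 : xbar != 0.
Hypothesis xbar_horizontal : horizontal xbar.
Hypothesis ybar_invariant : LambdaG m T G (rotating omega (fun=> xbar)).

Lemma symmetries_of_compatible s : symmetries_of s -> compatible m xbar s.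
Proof.
move=> Ss; apply: (compatible_of_invariant m_gt0 xbar_neq0 xbar_horizontal omega_gt0).
- exact: symmetries_of_orthogonal.
- by move=> x; exact: act_centered.
- exact: LambdaG_invariant ybar_invariant s Ss.
Qed.

(** The Fourier mode with amplitudes u is an eigenfunction by itself. *)
Lemma admissible_eigenvalue n u lam : admissible m omega symmetries_of n u -> u != 0 ->
  Dmode varpi (freq n) (Dmode varpi (freq n) u) = - lam *: pDelta m xbar u ->
  eigenvalues m T varpi G xbar lam.
Proof.
move=> ua u0 uE; exists (vmode (freq n) u) => x.
have [u1 u2 u3 u4] := ua.
have [d2 dd] := rotating_mode_twice_derivable varpi (freq n) u.
split=> //.
- apply: invariant_LambdaG; last by move=> s Ss t; rewrite vmode_act u4.
  apply/LambdaP; split; last by exists (vmode (freq n) (dmode (freq n) u)); exact: vH1_vmode.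
  by move=> t; exact: centered_vmode ua.
- apply/not_existsP => h.
  have z t : vmode (freq n) u t = 0.
    have /negP/negPn/eqP xt := h t.
    have o := expJ_orthogonal (varpi * t).
    by rewrite -[LHS]mul1mx -o -mulmxA -[expJ _ *m _]/(x t) xt mulmx0.
  case/negP: u0; apply/eqP.
  have a0 : u.1 = 0.
    by have := z 0; rewrite /vmode mulr0 cos0 sin0 scale1r scale0r addr0.
  have b0 : u.2 = 0.
    case: n u3 z {ua uE d2 dd u4 h x} => [|n] u3 z; first exact: u3.
    have k0 : freq n.+1 != 0 by rewrite mulf_neq0 ?pnatr_eq0// gt_eqF.
    have := z (pi / 2 / freq n.+1); rewrite /vmode mulrC mulfVK//.
    by rewrite cos_pihalf sin_pihalf scale0r add0r scale1r.
  by rewrite [u]surjective_pairing a0 b0.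
- move=> t; rewrite dd uE /x /rotating /vmode.
  rewrite Delta_mulmx -mulmxN scalemxAr; congr (_ *m _).
  rewrite DeltaD !DeltaZ /= scalerDr opprD !scalerA !mulrN !scaleNr !opprK.
  by rewrite ![_ * lam]mulrC.
Qed.

End LoopSpaces.

(** * The lower bound for the action *)

Lemma continuous_int_eq0 (R : realType) (T : R) (f : R -> R) : 0 < T -> continuous f ->
  (forall t, 0 <= f t) -> Rintegral (@lebesgue_measure R) [set` `[0, T]] f = 0 ->
  forall t, 0 <= t <= T -> f t = 0.
Proof.
move=> T0 cf f0 If t0 /andP[t00 t0T]; apply/eqP; rewrite eq_le f0 andbT leNgt; apply/negP => ft.
have h0 : 0 < f t0 / 2 by rewrite divr_gt0.
have /cvgrPdist_lt/(_ _ h0)/nbhs_ballP[e /= e0 He] := cf t0.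
pose a : R := Num.max 0 (t0 - e / 2); pose b : R := Num.min T (t0 + e / 2).
have a0 : 0 <= a by rewrite le_max lexx.
have bT : b <= T by rewrite ge_min lexx.
have at0 : a <= t0 by rewrite ge_max t00 lerBlDr lerDl divr_ge0 ?ltW.
have t0b : t0 <= b by rewrite le_min t0T lerDl divr_ge0 ?ltW.
have e2 : 0 < e / 2 by rewrite divr_gt0.
have ab : a < b.
  rewrite lt_min !gt_max T0/=; apply/andP; split; lra.
have big s : a <= s <= b -> f t0 / 2 <= f s.
  move=> /andP[as_ sb].
  have : ball t0 e s.
    rewrite /ball/=; move: as_ sb; rewrite ge_max le_min => /andP[_ h1] /andP[_ h2].
    by rewrite ltr_norml; lra.
  by move=> /He; rewrite ltr_norml => /andP[h1 h2]; lra.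
have ci x y : itv_integrable x y f by exact: continuous_itv_integrable.
move: If; rewrite (@int_split _ 0 T a)// ?a0 ?(le_trans (ltW ab))//.
rewrite (@int_split _ a T b)// ?(ltW ab)// => If.
have i1 : 0 <= Rintegral (@lebesgue_measure R) [set` `[0, a]] f by exact: int_ge0.
have i2 : 0 <= Rintegral (@lebesgue_measure R) [set` `[b, T]] f by exact: int_ge0.
have i3 : f t0 / 2 * (b - a) <= Rintegral (@lebesgue_measure R) [set` `[a, b]] f.
  rewrite -int_cst ?(ltW ab)//; apply: le_int => //.
  exact: continuous_itv_integrable (@cst_continuous _ _ _).
have : 0 < f t0 / 2 * (b - a) by rewrite mulr_gt0// subr_gt0.
by lra.
Qed.

Section ActionBounds.
Context {R : realType} {N : nat} (m : 'I_N -> R) (xbar : config R N).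
Hypothesis m_gt0 : forall i, 0 < m i.
Hypothesis xbar_free : collision_free xbar.
Context (varpi omega T : R).
Hypothesis omega_gt0 : 0 < omega.
Hypothesis T_def : T = 2 * pi / omega.
Local Notation E := (config R N).
Local Notation Dl := (Delta m xbar).
Local Notation mdot := (mdot m).
Local Notation rbar := (mutual_distance xbar).
Notation mu := (@lebesgue_measure R).
Local Notation int a b f := (Rintegral mu [set` `[a, b]] f).
Local Notation qform := (qform m xbar varpi T).
Local Notation vip := (vip m T).
Implicit Types (x : E) (y v : R -> E) (t : R).

Let T_gt0 : 0 < T := period_gt0 omega_gt0 T_def.
Let T_ge0 : 0 <= T. Proof. exact: ltW T_gt0. Qed.

Definition Ubar : R := \sum_(i < N) \sum_(j < N | (i < j)%N) m i * m j / rbar i j.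

(** The total slack in the tangent inequalities for the pairs. *)
Definition shape_gap x : R := \sum_(i < N) \sum_(j < N | (i < j)%N)
  m i * m j / (2 * rbar i j ^+ 3) * (mutual_distance x i j - rbar i j) ^+ 2.

(** The first two terms are the tangent at r = a of 1/r as a function of r^2.  The third
one brings the left-hand side to 2/a - r/a^2, and the claim to (r - a)^2 >= 0. *)
Lemma inv_tangent (a r : R) : 0 < a -> 0 < r ->
  3 / 2 / a - r ^+ 2 / (2 * a ^+ 3) + (r - a) ^+ 2 / (2 * a ^+ 3) <= r^-1.
Proof.
move=> a0 r0; have an : a != 0 by rewrite gt_eqF.
have rn : r != 0 by rewrite gt_eqF.
rewrite -subr_ge0 (_ : _ - _ = (r - a) ^+ 2 / (r * a ^+ 2)); last by field; rewrite an rn.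
by rewrite divr_ge0 ?sqr_ge0// mulr_ge0 ?exprn_ge0 ?ltW.
Qed.

Lemma U_lower_bound x :
  ((3 / 2 * Ubar - 2^-1 * mdot (Dl x) x + shape_gap x)%:E <= U m x)%E.
Proof.
rewrite mdot_Delta_self /Ubar /shape_gap /U.
rewrite !mulr_sumr -sumrB -big_split/= -sumEFin; apply: lee_sum => i _.
rewrite !mulr_sumr -sumrB -big_split/= -sumEFin; apply: lee_sum => j ij.
have ij' : i != j by rewrite neq_ltn ij.
have r0 := mutual_distance_gt0 xbar_free ij'.
have mm : 0 < m i * m j by rewrite mulr_gt0.
have := mutual_distance_ge0 x i j; rewrite le_eqVlt => /predU1P[<-|d0].
  by rewrite inver eqxx mulry gtr0_sg// mul1e leey.
rewrite inver gt_eqF// -EFinM lee_fin.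
have := inv_tangent r0 d0; move: (mutual_distance x i j) (rbar i j) d0 r0 => r a d0 r0 h.
apply: le_trans (_ : m i * m j * (3 / 2 / a - r ^+ 2 / (2 * a ^+ 3) + (r - a) ^+ 2 / (2 * a ^+ 3)) <= _); last by rewrite ler_pM2l.
by rewrite le_eqVlt; apply/orP; left; apply/eqP; field; rewrite gt_eqF.
Qed.

Lemma U_xbar x : (forall i j, mutual_distance x i j = rbar i j) -> U m x = Ubar%:E.
Proof.
move=> xr; rewrite /U /Ubar -sumEFin; apply: eq_bigr => i _.
rewrite -sumEFin; apply: eq_bigr => j ij.
have ij' : i != j by rewrite neq_ltn ij.
by rewrite xr inver gt_eqF ?mutual_distance_gt0.
Qed.

Lemma U_ge0 x : (0 <= U m x)%E.
Proof.
apply: sume_ge0 => i _; apply: sume_ge0 => j _; apply: mule_ge0.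
  by rewrite lee_fin mulr_ge0 ?ltW.
by rewrite inve_ge0 lee_fin mutual_distance_ge0.
Qed.

Lemma shape_gap_ge0 x : 0 <= shape_gap x.
Proof.
apply: sumr_ge0 => i _; apply: sumr_ge0 => j _; rewrite mulr_ge0 ?sqr_ge0//.
by rewrite divr_ge0 ?mulr_ge0 ?exprn_ge0 ?mutual_distance_ge0// ltW.
Qed.

Lemma shape_gap_eq0 x : shape_gap x = 0 ->
  forall i j, mutual_distance x i j = rbar i j.
Proof.
have nneg (i j : 'I_N) : 0 <= m i * m j / (2 * rbar i j ^+ 3) * (mutual_distance x i j - rbar i j) ^+ 2.
  by rewrite mulr_ge0 ?sqr_ge0// divr_ge0 ?mulr_ge0 ?exprn_ge0 ?mutual_distance_ge0// ltW.
move=> /eqP; rewrite psumr_eq0 => [/allP h|i _]; last exact: sumr_ge0.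
have lt (i j : 'I_N) : (i < j)%N -> mutual_distance x i j = rbar i j.
  move=> ij; have := h i (mem_index_enum i); rewrite /= psumr_eq0//.
  move=> /allP/(_ j (mem_index_enum j)); rewrite ij/= mulf_eq0 => /orP[|]; last first.
    by rewrite sqrf_eq0 subr_eq0 => /eqP.
  have ij' : i != j by rewrite neq_ltn ij.
  have r0 := mutual_distance_gt0 xbar_free ij'.
  have mm : 0 < m i * m j by rewrite mulr_gt0.
  have d0 : 0 < 2 * rbar i j ^+ 3 by rewrite mulr_gt0// exprn_gt0.
  by rewrite (gt_eqF (divr_gt0 mm d0)).
move=> i j; case: (ltngtP i j) => [/lt//|/lt e|/val_inj->].
  by rewrite mutual_distanceC e mutual_distanceC.
by rewrite /mutual_distance !subrr.
Qed.

Lemma continuous_mutual_distance y i j : (forall k i, continuous (fun t => y t k i)) ->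
  continuous (fun t => mutual_distance (y t) i j).
Proof.
move=> cy t.
have c : continuous (fun t => \sum_(k < 3) (y t k i - y t k j) ^+ 2).
  apply: continuous_sum_fun => k s.
  rewrite (_ : (fun t => _) = (fun t => (y t k i - y t k j) * (y t k i - y t k j))).
    by apply: cvgM; apply: cvgB; exact: cy.
  by apply/funext => z; rewrite expr2.
rewrite (_ : (fun t => _) = (fun t => Num.sqrt (\sum_(k < 3) (y t k i - y t k j) ^+ 2))).
  by exact: (cvg_comp _ _ (c t) (@sqrt_continuous R _)).
apply/funext => s; congr Num.sqrt; apply: eq_bigr => k _; by rewrite !mxE.
Qed.

Lemma continuous_shape_gap y : (forall k i, continuous (fun t => y t k i)) ->
  continuous (fun t => shape_gap (y t)).
Proof.
move=> cy; apply: continuous_sum_fun => i.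
pose f (j : 'I_N) t := if (i < j)%N then m i * m j / (2 * rbar i j ^+ 3) *
  (mutual_distance (y t) i j - rbar i j) ^+ 2 else 0.
rewrite (_ : (fun t => _) = fun t => \sum_(j < N) f j t); last first.
  by apply/funext => t; rewrite big_mkcond.
apply: continuous_sum_fun => j; rewrite /f; case: (i < j)%N; last exact: cst_continuous.
have cd := @continuous_mutual_distance y i j cy.
apply: continuousZ_fun => t.
rewrite (_ : (fun t => _) = (fun t => (mutual_distance (y t) i j - rbar i j) * (mutual_distance (y t) i j - rbar i j))).
  by apply: cvgM; apply: cvgB; [exact: cd|exact: cvg_cst|exact: cd|exact: cvg_cst].
by apply/funext => z; rewrite expr2.
Qed.

Lemma L2_derivP y : Lambda m T y -> vH1 T y (L2_deriv T y).
Proof.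
move=> Ly; have [yp _ ey] := Ly.
have H : L2_derivative T y (L2_deriv T y) := getPex ey.
move=> k i; have [sv vi] := H k i.
by split=> // t; rewrite yp.
Qed.

Lemma vH1_components_continuous y v : vH1 T y v -> forall k i, continuous (fun t => y t k i).
Proof. by move=> yv k i; exact: (H1_continuous omega_gt0 T_def (yv k i)). Qed.

Lemma action_lower_bound y : Lambda m T y ->
  ((3 / 2 * Ubar * T + 2^-1 * qform y (L2_deriv T y)
     + int 0 T (fun t => shape_gap (y t)))%:E
   <= action_functional m T varpi y)%E.
Proof.
move=> Ly; have yv := L2_derivP Ly; set v := L2_deriv T y in yv *.
have sy := vH1_sq omega_gt0 T_def yv.
have sv := vel_sq varpi omega_gt0 T_def yv.
have sD : vsq T (fun t => Dl (y t)) := vsq_Delta m xbar sy.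
have iv := vsq_integrable m sv sv; have iD := vsq_integrable m sD sy.
have cg := continuous_shape_gap (vH1_components_continuous yv).
have ig := continuous_itv_integrable 0 T cg.
pose g t := (3 / 2 * Ubar + (2^-1 * mdot (vel varpi y v t) (vel varpi y v t)
   - 2^-1 * mdot (Dl (y t)) (y t))) + shape_gap (y t).
have ic : itv_integrable 0 T (fun=> 3 / 2 * Ubar).
  exact: continuous_itv_integrable (@cst_continuous _ _ _).
have i1 := itv_integrableZ 2^-1 iv; have i2 := itv_integrableZ 2^-1 iD.
have i3 := itv_integrableB i1 i2.
have gi : itv_integrable 0 T g.
  by apply: itv_integrableD => //; exact: itv_integrableD.
have -> : 3 / 2 * Ubar * T + 2^-1 * qform y v + int 0 T (fun t => shape_gap (y t)) = int 0 T g.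
  rewrite /g intD//; last exact: itv_integrableD.
  by rewrite intD// int_cst// intB// !intZ// subr0 -mulrBr.
apply: le_integral_minorant => // t _.
  by rewrite adde_ge0 ?U_ge0// lee_fin mulr_ge0// mass_sqnormE mdot_ge0.
have -> : (g t)%:E = ((2^-1 * mass_sqnorm m (v t + varpi *: (J R *m y t)))%:E +
   (3 / 2 * Ubar - 2^-1 * mdot (Dl (y t)) (y t) + shape_gap (y t))%:E)%E.
  by rewrite -EFinD mass_sqnormE /g /vel; congr EFin; ring.
by apply: leeD => //; exact: U_lower_bound.
Qed.

Section RelativeEquilibrium.
Hypothesis xbar_horizontal : horizontal xbar.
Hypothesis Delta_xbar : Dl xbar = (omega + varpi) ^+ 2 *: xbar.
Local Notation ybar := (rotating omega (fun=> xbar)).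

(** Pair [Delta_xbar] with xbar. *)
Lemma Ubar_inertia : Ubar = (omega + varpi) ^+ 2 * mdot xbar xbar.
Proof.
rewrite -mdotZl -Delta_xbar mdot_Delta_self; apply: eq_bigr => i _; apply: eq_bigr => j ij.
have ij' : i != j by rewrite neq_ltn ij.
have := mutual_distance_gt0 xbar_free ij'; move: (rbar i j) => r r0.
by field; rewrite gt_eqF.
Qed.

Lemma mdot_J_horizontal : mdot (J R *m xbar) (J R *m xbar) = mdot xbar xbar.
Proof. by rewrite mdotJ horizontalJJ// mdotNr opprK. Qed.

Lemma ybar_mode : ybar = vmode (1%:R * omega) (xbar, J R *m xbar).
Proof.
by apply/funext => t; rewrite mul1r /rotating /vmode/= expJ_horizontal.
Qed.

Lemma action_ybar : Lambda m T ybar ->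
  action_functional m T varpi ybar = (3 / 2 * Ubar * T)%:E.
Proof.
move=> Ly; have yv := L2_derivP Ly; set v := L2_deriv T ybar in yv *.
pose u : E * E := (xbar, J R *m xbar).
pose vb := vmode (1%:R * omega) (dmode (1%:R * omega) u).
have yvb : vH1 T ybar vb by rewrite ybar_mode; exact: vH1_vmode.
have sy := vH1_sq omega_gt0 T_def yv.
have sv := vel_sq varpi omega_gt0 T_def yv.
have svb := vel_sq varpi omega_gt0 T_def yvb.
pose w t := v t - vb t.
have sw : vsq T w.
  move=> k i; under eq_fun do rewrite mxE [X in _ + X]mxE.
  by apply: square_integrableB; [exact: (vH1_deriv_sq yv k i)|exact: (vH1_deriv_sq yvb k i)].
(* the chosen derivative v and the classical one vb have the same primitive, but need
   not agree pointwise *)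
have w0 h : vsq T h -> vip w h = 0.
  move=> sh; rewrite vipE// big1// => i _; rewrite big1// => k _.
  rewrite ip_null ?mulr0//.
  move=> t tT; have /andP[t0 tT'] := tT.
  have e1 := H1_int (yv k i) tT; have e2 := H1_int (yvb k i) tT.
  have sub (z : R -> R) : square_integrable T z -> itv_integrable 0 t z.
    by move=> sz; apply: itv_integrableS (square_integrable_int sz).
  under eq_Rintegral do rewrite mxE [X in _ + X]mxE.
  rewrite intB; [|apply: sub; exact: (vH1_deriv_sq yv k i)|apply: sub; exact: (vH1_deriv_sq yvb k i)].
  by apply/eqP; rewrite subr_eq0; apply/eqP/(addrI (ybar 0 k i)); rewrite -e1 -e2.
have velE : vel varpi ybar v = (fun t => vel varpi ybar vb t + w t).
  by apply/funext => t; rewrite /vel /w addrAC subrKC.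
have e1 : vip (vel varpi ybar v) (vel varpi ybar v) = T * Ubar.
  rewrite velE vip_sqrD//; last by rewrite vipC w0.
  rewrite (w0 _ sw) addr0.
  have -> : vel varpi ybar vb = vmode (1%:R * omega) (Dmode varpi (1%:R * omega) u).
    by apply/funext => t; rewrite vmode_Dmode /vel ybar_mode.
  rewrite (vip_vmode m omega_gt0 T_def)// /mode_mass /= subr0 mul1r.
  have -> : Dmode varpi omega u = ((omega + varpi) *: (J R *m xbar), - (omega + varpi) *: xbar).
    rewrite /Dmode /u/= horizontalJJ// scalerN; congr pair; first by rewrite scalerDl.
    by rewrite opprD scalerDl !scaleNr.
  rewrite /pdot/= !mdotZl !(mdotC _ _ (_ *: _)) !mdotZl mdot_J_horizontal Ubar_inertia.
  by move: (mdot xbar xbar) => I; field.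
rewrite /action_functional -/v.
have Uy t : U m (ybar t) = Ubar%:E.
  apply: U_xbar => i j; rewrite mutual_distance_orthogonal//; exact: expJ_orthogonal.
under eq_integral do rewrite Uy mass_sqnormE -EFinD.
have iv := vsq_integrable m sv sv.
have ic : itv_integrable 0 T (fun=> Ubar).
  exact: continuous_itv_integrable (@cst_continuous _ _ _).
have iF : itv_integrable 0 T (fun t => 2^-1 * mdot (vel varpi ybar v t) (vel varpi ybar v t) + Ubar).
  by apply: itv_integrableD => //; exact: itv_integrableZ.
have -> : 3 / 2 * Ubar * T = int 0 T (fun t => 2^-1 * mdot (vel varpi ybar v t) (vel varpi ybar v t) + Ubar).
  rewrite intD//; last exact: itv_integrableZ.
  by rewrite intZ// int_cst// subr0 -/(vip _ _) e1; field.
by rewrite /Rintegral fineK//; exact: integrable_fin_num iF.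
Qed.

End RelativeEquilibrium.
End ActionBounds.

(** * Gram matrices and congruence *)

Section Gram.
Context {R : realType}.

Lemma gram_eq0 (d n : nat) (z : 'M[R]_(d, n)) : z^T *m z = 0 -> z = 0.
Proof.
move=> z0; apply/matrixP => k i; rewrite [RHS]mxE.
have : (z^T *m z) i i = 0 by rewrite z0 mxE.
rewrite mxE => /eqP; rewrite psumr_eq0 => [/allP/(_ k (mem_index_enum k))|l _].
  by rewrite /= !mxE mulf_eq0 orbb => /eqP.
by rewrite !mxE -expr2 sqr_ge0.
Qed.

Lemma orthogonal_mxM (n : nat) (A B : 'M[R]_n) :
  orthogonal_mx A -> orthogonal_mx B -> orthogonal_mx (A *m B).
Proof.
move=> oA oB; rewrite /orthogonal_mx trmx_mul mulmxA -[_ *m A^T *m A]mulmxA.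
by rewrite [A^T *m A]oA mulmx1 [B^T *m B]oB.
Qed.

(** The reflection in the hyperplane orthogonal to x - y. *)
Lemma householder (d : nat) (x y : 'cV[R]_d) : x^T *m x = y^T *m y ->
  exists2 H : 'M[R]_d, orthogonal_mx H &
    H *m x = y /\ forall v : 'cV[R]_d, (x - y)^T *m v = 0 -> H *m v = v.
Proof.
move=> xy; have [->|nxy] := eqVneq x y.
  by exists 1%:M; [rewrite /orthogonal_mx trmx1 mulmx1|split=> *; rewrite mul1mx].
pose w := x - y; pose q := (w^T *m w) 0 0.
have wq : w^T *m w = q%:M by rewrite [LHS]mx11_scalar.
have q0 : q != 0.
  apply: contra nxy => /eqP q0; rewrite -subr_eq0; apply/eqP/gram_eq0.
  by rewrite [LHS]wq q0 -scalemx1 scale0r.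
pose H : 'M[R]_d := 1%:M - (2 / q) *: (w *m w^T).
have Hv v : H *m v = v - (2 / q) *: (w *m (w^T *m v)).
  by rewrite /H mulmxBl mul1mx -scalemxAl mulmxA.
have HT : H^T = H by rewrite /H linearB/= trmx1 linearZ/= trmx_mul trmxK.
exists H.
  rewrite /orthogonal_mx HT {2}/H mulmxBr mulmx1 -scalemxAr mulmxA Hv wq.
  rewrite mul_mx_scalar scalerA mulfVK// scalerDl scale1r opprD addrA subrr sub0r.
  by rewrite mulNmx scalerN opprK /H subrK.
split=> [|v wv]; last by rewrite Hv wv mulmx0 scaler0 subr0.
have wx : w^T *m x = (q / 2)%:M.
  have e : w^T *m x + w^T *m x = q%:M.
    rewrite -wq /w linearB/= !mulmxBl !mulmxBr xy.
    have -> : y^T *m x = x^T *m y.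
      by rewrite [y^T *m x]mx11_scalar -tr_scalar_mx -mx11_scalar trmx_mul trmxK.
    by rewrite [in RHS]opprB.
  rewrite [LHS]mx11_scalar; congr (_%:M); move/matrixP/(_ 0 0): e.
  by rewrite mxE [RHS]mxE eqxx mulr1n; move: ((w^T *m x) 0 0) => z; lra.
rewrite Hv wx mul_mx_scalar scalerA (_ : 2 / q * (q / 2) = 1); last by field.
by rewrite scale1r /w opprB addrC subrK.
Qed.

(** The columns are brought into place one after the other, by reflections that fix the
previous ones. *)
Lemma gram_congruent (d n : nat) (X Y : 'M[R]_(d, n)) : X^T *m X = Y^T *m Y ->
  exists2 S : 'M[R]_d, orthogonal_mx S & Y = S *m X.
Proof.
move=> XY.
have gram i j : (col i X)^T *m col j X = (col i Y)^T *m col j Y.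
  rewrite !colE !trmx_mul -!mulmxA [X^T *m (X *m _)]mulmxA XY.
  by rewrite -[Y^T *m Y *m _]mulmxA.
have step k : exists2 S : 'M[R]_d, orthogonal_mx S &
    forall j : 'I_n, (j < k)%N -> S *m col j X = col j Y.
  elim: k => [|k [S oS SP]]; first by exists 1%:M; rewrite // /orthogonal_mx trmx1 mulmx1.
  have [kn|nk] := ltnP k n; last first.
    by exists S => // j _; rewrite SP// (leq_trans (ltn_ord j)).
  pose i := Ordinal kn.
  have Sdot u v : (S *m u : 'cV[R]_d)^T *m (S *m v : 'cV[R]_d) = u^T *m v.
    by rewrite trmx_mul -mulmxA [S^T *m _]mulmxA [S^T *m S]oS mul1mx.
  have [|H oH [Hi Hv]] := @householder d (S *m col i X) (col i Y); first by rewrite Sdot gram.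
  exists (H *m S); first exact: orthogonal_mxM.
  move=> j; rewrite ltnS leq_eqVlt => /predU1P[jk|jk].
    by rewrite (_ : j = i) -?mulmxA//; exact: val_inj.
  rewrite -mulmxA SP// Hv//.
  by rewrite linearB/= mulmxBl -[X in _ *m X - _](SP j jk) Sdot gram subrr.
have [S oS SP] := step n; exists S => //.
by apply/matrixP => k j; have /matrixP/(_ k 0) := SP j (ltn_ord j); rewrite !mxE => <-;
  apply: eq_bigr => l _; rewrite mxE.
Qed.

End Gram.

(** * Harmonic motions of constant shape *)

Section HarmonicMotion.
Context {R : realType}.

(** In a frame rotating with angular velocity w the point (f, g / w) of the phase plane
does not move. *)
Lemma harmonic_oscillator (w : R) (f g : R -> R) : w != 0 ->
  (forall t : R, is_derive t 1 f (g t)) ->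
  (forall t : R, is_derive t 1 g (- (w ^+ 2) * f t)) ->
  forall t : R, f t = cos (w * t) * f 0 + sin (w * t) * (g 0 / w).
Proof.
move=> w0 df dg t.
have cst (h : R -> R) : (forall s : R, is_derive s 1 h 0) -> h t = h 0.
  by move=> dh; exact: is_derive_0_is_cst.
have d1 (s : R) : is_derive s 1 (fun s => f s * cos (w * s) - w^-1 * (g s * sin (w * s))) 0.
  have dc := is_derive_cosM w s; have ds := is_derive_sinM w s.
  apply: eq_is_derive (is_deriveB (is_deriveM (df s) dc) (is_deriveZ w^-1 (is_deriveM (dg s) ds))) _ _.
    by [].
  by rewrite /GRing.scale/=; field.
have d2 (s : R) : is_derive s 1 (fun s => f s * sin (w * s) + w^-1 * (g s * cos (w * s))) 0.
  have dc := is_derive_cosM w s; have ds := is_derive_sinM w s.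
  apply: eq_is_derive (is_deriveD (is_deriveM (df s) ds) (is_deriveZ w^-1 (is_deriveM (dg s) dc))) _ _.
    by [].
  by rewrite /GRing.scale/=; field.
have e1 : f t * cos (w * t) - w^-1 * (g t * sin (w * t)) = f 0.
  by rewrite (cst _ d1) mulr0 cos0 sin0 !mulr0 mulr1 subr0.
have e2 : f t * sin (w * t) + w^-1 * (g t * cos (w * t)) = g 0 / w.
  by rewrite (cst _ d2) mulr0 cos0 sin0 mulr0 mulr1 add0r mulrC.
rewrite -e1 -e2 -[LHS]mulr1 -(cos2Dsin2 (w * t)).
by move: (cos _) (sin _) (f t) (g t) => c s a b; field.
Qed.

End HarmonicMotion.

Section Rigidity.
Context {R : realType} {N : nat} (m : 'I_N -> R) (xbar : config R N).
Hypothesis m_gt0 : forall i, 0 < m i.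
Local Notation E := (config R N).
Implicit Types (x y a b : E).

(** Let d be the difference of the Gram matrices.  Equal distances make
2 d i j = d i i + d j j, and the centers of mass make the weighted sum of each row of d
vanish; summing twice gives d = 0. *)
Lemma gram_of_distances x y : centered m x -> centered m y ->
  (forall i j, mutual_distance x i j = mutual_distance y i j) ->
  x^T *m x = y^T *m y.
Proof.
move=> /centeredP cx /centeredP cy xy.
pose d i j := (x^T *m x) i j - (y^T *m y) i j.
have dE i j : d i j = \sum_(k < 3) (x k i * x k j - y k i * y k j).
  by rewrite /d !mxE -sumrB; apply: eq_bigr => k _; rewrite !mxE.
have polar i j : d i j = (d i i + d j j) / 2.
  have : mutual_distance x i j ^+ 2 = mutual_distance y i j ^+ 2 by rewrite xy.
  by rewrite !sqr_mutual_distance !dE !sum3; lra.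
have center i : \sum_(j < N) m j * d i j = 0.
  under eq_bigr do rewrite dE mulr_sumr.
  rewrite exchange_big big1// => k _.
  under eq_bigr do rewrite mulrBr mulrCA [X in _ - X]mulrCA.
  by rewrite sumrB -!mulr_sumr cx cy !mulr0 subrr.
pose M := \sum_(j < N) m j; pose K := \sum_(j < N) m j * d j j.
have center' i : M * d i i + K = 0.
  have := center i; under eq_bigr do rewrite polar.
  rewrite /M /K mulr_suml -big_split/= => h.
  apply: (@mulfI _ (2^-1)); first by rewrite invr_neq0.
  rewrite mulr0 -[RHS]h mulr_sumr; apply: eq_bigr => j _.
  by rewrite -mulrDr mulrC -mulrA.
have MK : M * K = 0.
  have : \sum_(i < N) m i * (M * d i i + K) = 0 by rewrite big1// => i _; rewrite center' mulr0.
  under eq_bigr do rewrite mulrDr mulrCA.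
  by rewrite big_split/= -mulr_sumr -mulr_suml -/K -/M; lra.
have diag i : d i i = 0.
  have M0 : 0 < M.
    by rewrite /M (bigD1 i)//= ltr_wpDr// sumr_ge0// => j _; exact: ltW.
  have K0 : K = 0 by move/eqP: MK; rewrite mulf_eq0 gt_eqF//= => /eqP.
  by have /eqP := center' i; rewrite K0 addr0 mulf_eq0 gt_eqF//= => /eqP.
apply/matrixP => i j; apply/eqP; rewrite -subr_eq0 -/(d i j) polar !diag addr0 mul0r//.
Qed.

(** As Delta acts on the right, the Gram matrix of its residual at x is determined by the
Gram matrix of x. *)
Lemma Delta_congruent x lam : Delta m xbar xbar = lam *: xbar ->
  x^T *m x = xbar^T *m xbar -> Delta m xbar x = lam *: x.
Proof.
move=> Db xx; apply/eqP; rewrite -subr_eq0; apply/eqP/gram_eq0.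
pose D := Delta_mx m xbar - lam%:M.
have DE (z : E) : Delta m xbar z - lam *: z = z *m D.
  by rewrite DeltaE /D mulmxBr mul_mx_scalar.
rewrite DE trmx_mul mulmxA -[_ *m x^T *m x]mulmxA xx mulmxA -[_ *m xbar *m D]mulmxA.
by rewrite -DE Db subrr mulmx0.
Qed.

Hypothesis xbar_horizontal : horizontal xbar.
Local Notation Jx := (J R *m xbar).

Lemma rotated_gram : Jx^T *m Jx = xbar^T *m xbar.
Proof.
by rewrite trmx_mul trJ mulmxN mulNmx -mulmxA horizontalJJ// mulmxN opprK.
Qed.

Lemma skew_gram : Jx^T *m xbar = - (xbar^T *m Jx).
Proof. by rewrite trmx_mul trJ mulmxN mulNmx -mulmxA. Qed.

Lemma horizontal_entry i : xbar ord_max i = 0.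
Proof. by move/matrixP/(_ 0 i): xbar_horizontal; rewrite !mxE. Qed.

Lemma planar_skew_entry i j :
  (xbar^T *m Jx) i j = xbar 1 i * xbar 0 j - xbar 0 i * xbar 1 j.
Proof.
by rewrite mxE sum3 !mxE !sum3 !mxE/= horizontal_entry; ring.
Qed.

(** If two columns of xbar span the plane, then the block of B on the plane is skew,
hence a multiple of J, and the orthogonality of B makes the factor a sign.  If xbar is
collinear, both sides vanish. *)
Lemma planar_skew_gram (B : 'M[R]_3) : orthogonal_mx B ->
  let C := xbar^T *m (B *m xbar) in C^T = - C ->
  exists e : bool, C = (-1) ^+ e *: (xbar^T *m Jx).
Proof.
move=> oB C CT.
have CE i j : C i j = xbar 0 i * (B 0 0 * xbar 0 j + B 0 1 * xbar 1 j)
   + xbar 1 i * (B 1 0 * xbar 0 j + B 1 1 * xbar 1 j).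
  by rewrite /C mxE sum3 !mxE !sum3 !horizontal_entry; ring.
have skew i j : C i j + C j i = 0.
  have /matrixP/(_ i j) := CT; rewrite [LHS]mxE [RHS]mxE => ->; exact: addrN.
have diag i : C i i = 0 by have := skew i i; lra.
have [[i [j ij]]|none] := pselect (exists i j, xbar 0 i * xbar 1 j - xbar 1 i * xbar 0 j != 0); last first.
  have W0 i j : xbar 1 i * xbar 0 j = xbar 0 i * xbar 1 j.
    apply/eqP; rewrite eq_sym -subr_eq0; apply/negP/negP; apply: contrapT => /negP h.
    by apply: none; exists i, j.
  exists false; rewrite scale1r; apply/matrixP => i j.
  rewrite planar_skew_entry W0 subrr.
  have e0 : xbar 0 i * C i j = 0.
    have -> : xbar 0 i * C i j = xbar 0 j * C i i +
        (B 0 1 * xbar 0 i + B 1 1 * xbar 1 i) * (xbar 0 i * xbar 1 j - xbar 1 i * xbar 0 j).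
      by rewrite !CE; ring.
    by rewrite diag W0 subrr !mulr0 addr0.
  have e1 : xbar 1 i * C i j = 0.
    have -> : xbar 1 i * C i j = xbar 1 j * C i i -
        (B 0 0 * xbar 0 i + B 1 0 * xbar 1 i) * (xbar 0 i * xbar 1 j - xbar 1 i * xbar 0 j).
      by rewrite !CE; ring.
    by rewrite diag W0 subrr !mulr0 subr0.
  have [x0|nx0] := eqVneq (xbar 0 i) 0; last by apply: (mulfI nx0); rewrite e0 mulr0.
  have [x1|nx1] := eqVneq (xbar 1 i) 0; last by apply: (mulfI nx1); rewrite e1 mulr0.
  by rewrite CE x0 x1 !mul0r addr0.
(* in the basis of the columns i and j, the symmetric part of the block of B has the
   entries ii, jj and sij; Cramer's rule brings it back to the standard basis *)
have W2 : (xbar 0 i * xbar 1 j - xbar 1 i * xbar 0 j) ^+ 2 != 0 by rewrite expf_neq0.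
have ii := diag i; have jj := diag j; have sij := skew i j.
rewrite !CE in ii jj sij.
have B00 : B 0 0 = 0.
  apply: (mulfI W2); rewrite mulr0.
  move: (xbar 0 i) (xbar 1 i) (xbar 0 j) (xbar 1 j) (B 0 0) (B 0 1) (B 1 0) (B 1 1) ii jj sij => a b c d p q r s ii jj sij.
  rewrite [LHS](_ : _ = d ^+ 2 * (a * (p * a + q * b) + b * (r * a + s * b))
    + b ^+ 2 * (c * (p * c + q * d) + d * (r * c + s * d)) - b * d *
    (a * (p * c + q * d) + b * (r * c + s * d) + (c * (p * a + q * b) + d * (r * a + s * b)))); last by ring.
  by rewrite ii jj sij !mulr0 addr0 subrr.
have B11 : B 1 1 = 0.
  apply: (mulfI W2); rewrite mulr0.
  move: (xbar 0 i) (xbar 1 i) (xbar 0 j) (xbar 1 j) (B 0 0) (B 0 1) (B 1 0) (B 1 1) ii jj sij => a b c d p q r s ii jj sij.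
  rewrite [LHS](_ : _ = c ^+ 2 * (a * (p * a + q * b) + b * (r * a + s * b))
    + a ^+ 2 * (c * (p * c + q * d) + d * (r * c + s * d)) - a * c *
    (a * (p * c + q * d) + b * (r * c + s * d) + (c * (p * a + q * b) + d * (r * a + s * b)))); last by ring.
  by rewrite ii jj sij !mulr0 addr0 subrr.
have B01 : B 0 1 = - B 1 0.
  apply/eqP; rewrite -addr_eq0; apply/eqP/(mulfI W2); rewrite mulr0.
  move: (xbar 0 i) (xbar 1 i) (xbar 0 j) (xbar 1 j) (B 0 0) (B 0 1) (B 1 0) (B 1 1) ii jj sij => a b c d p q r s ii jj sij.
  rewrite [LHS](_ : _ = - 2 * d * c * (a * (p * a + q * b) + b * (r * a + s * b))
    - 2 * a * b * (c * (p * c + q * d) + d * (r * c + s * d)) + (a * d + b * c) *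
    (a * (p * c + q * d) + b * (r * c + s * d) + (c * (p * a + q * b) + d * (r * a + s * b)))); last by ring.
  by rewrite ii jj sij !mulr0 addr0 subrr.
have Bsign : B 1 0 ^+ 2 = 1.
  have o00 : B 1 0 ^+ 2 + B ord_max 0 ^+ 2 = 1.
    by move/matrixP/(_ 0 0): oB; rewrite !mxE sum3 !mxE B00 => /= h; lra.
  have o11 : B 1 0 ^+ 2 + B ord_max 1 ^+ 2 = 1.
    by move/matrixP/(_ 1 1): oB; rewrite !mxE sum3 !mxE B11 B01 => /= h; lra.
  have o01 : B ord_max 0 * B ord_max 1 = 0.
    by move/matrixP/(_ 0 1): oB; rewrite !mxE sum3 !mxE B00 B11 => /= h; lra.
  by move/eqP: o01; rewrite mulf_eq0 => /orP[|] /eqP e;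
    [move: o00|move: o11]; rewrite e expr0n addr0.
have [e Be] : exists e : bool, B 1 0 = (-1) ^+ e.
  move/eqP: Bsign; rewrite sqrf_eq1 => /orP[] /eqP ->; by [exists false|exists true].
exists e; rewrite -Be; apply/matrixP => k l.
by rewrite CE [RHS]mxE planar_skew_entry B00 B01 B11; ring.
Qed.

End Rigidity.

Section RigidMotion.
Context {R : realType} {N : nat} (xbar : config R N).
Hypothesis xbar_horizontal : horizontal xbar.
Local Notation E := (config R N).
Local Notation Jx := (J R *m xbar).

(** The amplitudes a and b have the Gram matrix of xbar and a^T b is skew, so that (a, b)
is congruent to (xbar, J xbar) or to (xbar, - J xbar). *)
Lemma rigid_harmonic_motion (w : R) (a b : E) : w != 0 ->
  (forall t, let x := cos (w * t) *: a + sin (w * t) *: b in x^T *m x = xbar^T *m xbar) ->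
  exists (S : 'M[R]_3) (e : bool), orthogonal_mx S /\
    forall t, cos (w * t) *: a + sin (w * t) *: b = S *m (expJ (w * ((-1) ^+ e * t)) *m xbar).
Proof.
move=> w0 gram; set P := xbar^T *m xbar in gram.
have gramE c s : c ^+ 2 + s ^+ 2 = 1 ->
    c ^+ 2 *: (a^T *m a) + s ^+ 2 *: (b^T *m b) + (c * s) *: (a^T *m b + b^T *m a) = P.
  move=> /unit_vector_angle[u [-> ->]]; rewrite -(gram (u / w)) mulrCA mulfV// mulr1.
  move: (cos u) (sin u) => {}c {}s.
  have -> : (c *: a + s *: b)^T = c *: a^T + s *: b^T by rewrite linearD/= !linearZ.
  rewrite mulmxDl !mulmxDr -!scalemxAl -!scalemxAr !scalerA -!expr2.
  by rewrite scalerDr [s * c]mulrC -!addrA; congr (_ + _); rewrite addrC -!addrA.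
have aa : a^T *m a = P.
  by rewrite -(gramE 1 0) ?expr0n ?expr1n ?addr0// mulr0 !scale0r scale1r !addr0.
have bb : b^T *m b = P.
  by rewrite -(gramE 0 1) ?expr0n ?expr1n ?add0r// mul0r !scale0r scale1r add0r addr0.
(* any angle whose sine and cosine are both nonzero will do *)
have ab : a^T *m b + b^T *m a = 0.
  have h : (3 / 5) ^+ 2 + (4 / 5) ^+ 2 = 1 :> R by field.
  have := gramE _ _ h; rewrite aa bb -scalerDl h scale1r => /eqP.
  rewrite -[X in _ == X]addr0 (inj_eq (addrI P)) scaler_eq0 => /orP[|/eqP//].
  by rewrite gt_eqF// mulr_gt0// divr_gt0.
have [S1 oS1 aE] : exists2 S : 'M[R]_3, orthogonal_mx S & a = S *m xbar.
  by apply: gram_congruent; rewrite aa.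
have [S2 oS2 bE] : exists2 S : 'M[R]_3, orthogonal_mx S & b = S *m xbar.
  by apply: gram_congruent; rewrite bb.
have [_ oS1' _] := orthogonal_mx_inv oS1.
have oB : orthogonal_mx (S1^T *m S2).
  by apply: orthogonal_mxM => //; rewrite /orthogonal_mx trmxK.
have CE : xbar^T *m (S1^T *m S2 *m xbar) = a^T *m b.
  by rewrite aE bE trmx_mul !mulmxA.
have [|e Ce] := planar_skew_gram xbar_horizontal oB.
  rewrite /= CE trmx_mul trmxK; apply/eqP; rewrite -addr_eq0 addrC; exact/eqP.
rewrite CE in Ce.
have [S oS SP] : exists2 S : 'M[R]_3, orthogonal_mx S &
    row_mx a ((-1) ^+ e *: b) = S *m row_mx xbar Jx.
  apply: gram_congruent; rewrite !tr_row_mx !mul_col_row.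
  have -> : ((-1) ^+ e *: b)^T = (-1) ^+ e *: b^T by rewrite linearZ.
  rewrite aa -!scalemxAl -!scalemxAr scalerA -expr2 sqrr_sign scale1r bb.
  rewrite (rotated_gram xbar_horizontal) Ce scalerA -expr2 sqrr_sign scale1r.
  have -> : b^T *m a = - (a^T *m b) by apply/eqP; rewrite -addr_eq0 addrC ab.
  by rewrite Ce scalerN scalerA -expr2 sqrr_sign scale1r skew_gram.
move: SP; rewrite mul_mx_row => /eq_row_mx[Sa Sb].
exists S, e; split=> // t.
rewrite expJ_horizontal// mulmxDr -!scalemxAr -Sa -Sb scalerA mulrCA.
case: e {Ce Sb}; rewrite ?expr0 ?expr1 ?mul1r ?mulr1// !mulN1r cosN sinN mulrN1 opprK//.
Qed.

End RigidMotion.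

(** * Minimizers *)

Section Minimizers.
Context {R : realType} {N : nat} (m : 'I_N -> R) (xbar : config R N).
Hypothesis m_gt0 : forall i, 0 < m i.
Context (omega varpi : R).
Hypothesis xbar_centered : centered m xbar.
Hypothesis xbar_horizontal : horizontal xbar.
Local Notation E := (config R N).
Local Notation Dl := (Delta m xbar).
Local Notation W := (omega + varpi).
Local Notation ybar := (rotating omega (fun=> xbar)).
Local Notation freq n := (n%:R * omega).

(** Newton's equations at time 0: a uniform rotation is the zeroth mode in a rotating
frame. *)
Lemma Delta_xbar_of_newton : newton_solution m (rotating W (fun=> xbar)) ->
  Dl xbar = W ^+ 2 *: xbar.
Proof.
move=> [_ _ nwt].
have e : rotating W (fun=> xbar) = rotating W (vmode 0 (xbar, 0)).
  by apply/funext => t; rewrite /rotating /vmode mul0r cos0 sin0 scale1r scale0r addr0.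
have acc : derive1 (derive1 (rotating W (fun=> xbar))) 0 = - (W ^+ 2 *: xbar).
  rewrite e; have [_ ->] := rotating_mode_twice_derivable W 0 (xbar, 0).
  rewrite /rotating /vmode !mul0r mulr0 cos0 sin0 scale0r addr0 scale1r/=.
  rewrite !scale0r !add0r -(scalemxAr W (J R)) horizontalJJ// !scalerN scalerA -expr2.
  by rewrite expJ_horizontal ?cos0 ?sin0 ?scale1r ?scale0r ?addr0//;
    rewrite /horizontal linearN/= linearZ/= xbar_horizontal scaler0 oppr0.
apply/matrixP => k i; have /matrixP/(_ k 0) := nwt 0 i.
rewrite acc mxE [in LHS]mxE /acceleration summxE => /eqP; rewrite eqr_oppLR => /eqP ->.
have x0 : rotating W (fun=> xbar) 0 = xbar.
  by rewrite /rotating mulr0 expJ_horizontal// cos0 sin0 scale1r scale0r addr0.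
rewrite x0 mxE -sumrN; apply: eq_bigr => j _.
by rewrite mxE [X in _ = - (_ * X)]mxE [X in _ = - (_ * (X + _))]mxE [X in _ = - (_ * (_ + X))]mxE
  [in RHS]mxE -mulrN opprB.
Qed.

Lemma is_derive_entry (M : R -> E) (D : E) (t : R) k i :
  derivable M t 1 /\ derive1 M t = D -> is_derive t 1 (fun s => M s k i) (D k i).
Proof.
move=> [/[dup] dM /derivable_mxP dMki eD]; apply: DeriveDef; first exact: dMki.
by rewrite -eD derive1E derive_mx// mxE.
Qed.

(** In the inertial frame Dmode is d/dt, so the equation for the amplitudes is
-x'' = Delta x. *)
Lemma null_loop_ode n (u : nat -> E * E) (y : R -> E) :
  (forall t, y t = \sum_(k < n) vmode (freq k) (u k) t) ->
  (forall k, (k < n)%N ->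
     Dmode varpi (freq k) (Dmode varpi (freq k) (u k)) = - pDelta m xbar (u k)) ->
  exists x' : R -> E, forall k i (t : R),
    is_derive t 1 (fun s => rotating varpi y s k i) (x' t k i) /\
    is_derive t 1 (fun s => x' s k i) (- Dl (rotating varpi y t) k i).
Proof.
move=> yE uE; pose z (v : nat -> E * E) (t : R) : E := \sum_(k < n) rotating varpi (vmode (freq k) (v k)) t.
have dz (v : nat -> E * E) (k : 'I_3) (i : 'I_N) (t : R) : is_derive t 1 (fun s => z v s k i)
    (z (fun k => Dmode varpi (freq k) (v k)) t k i).
  have h (j : 'I_n) := is_derive_entry k i (is_derive_rotating_mode varpi (freq j) (v j) t).
  apply: eq_is_derive (is_derive_sum h) _ _.
    by move=> s; rewrite fct_sumE /z summxE.
  by rewrite /z summxE.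
have xE t : rotating varpi y t = z u t.
  by rewrite /rotating yE mulmx_sumr.
have ddE t : z (fun k => Dmode varpi (freq k) (Dmode varpi (freq k) (u k))) t = - Dl (z u t).
  rewrite DeltaE /z mulmx_suml -sumrN; apply: eq_bigr => k _.
  rewrite uE// -DeltaE /rotating Delta_mulmx -mulmxN; congr (_ *m _).
  by rewrite /vmode DeltaD !DeltaZ opprD !scalerN.
exists (z (fun k => Dmode varpi (freq k) (u k))) => k i t; split.
  by apply: eq_is_derive (dz u k i t) _ _ => // s; rewrite xE.
by apply: eq_is_derive (dz _ k i t) _ _ => //; rewrite ddE xE [LHS]mxE.
Qed.

Hypothesis W_neq0 : W != 0.
Hypothesis Delta_xbar : Dl xbar = W ^+ 2 *: xbar.

(** Constant shape turns Delta x into a multiple of x, and the linear equation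
-x'' = Delta x into that of a harmonic oscillator. *)
Lemma null_loop_rigid n (u : nat -> E * E) (y : R -> E) :
  (forall t, centered m (y t)) ->
  (forall t i j, mutual_distance (y t) i j = mutual_distance xbar i j) ->
  (forall t, y t = \sum_(k < n) vmode (freq k) (u k) t) ->
  (forall k, (k < n)%N ->
     Dmode varpi (freq k) (Dmode varpi (freq k) (u k)) = - pDelta m xbar (u k)) ->
  same_motion varpi ybar y.
Proof.
move=> yc yr yE uE; have [x' dx] := null_loop_ode yE uE.
set x := rotating varpi y in dx.
have gram t : (x t)^T *m x t = xbar^T *m xbar.
  apply: (gram_of_distances m_gt0) => //; first exact: centered_mulmx.
  by move=> i j; rewrite /x /rotating mutual_distance_orthogonal ?yr//; exact: expJ_orthogonal.
have xE t : x t = cos (W * t) *: x 0 + sin (W * t) *: (W^-1 *: x' 0).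
  apply/matrixP => k i.
  have -> : x t k i = cos (W * t) * x 0 k i + sin (W * t) * (x' 0 k i / W).
    apply: (@harmonic_oscillator _ W (fun s => x s k i) (fun s => x' s k i)) => // s.
      by have [] := dx k i s.
    have [_ h] := dx k i s; apply: eq_is_derive h _ _ => //.
    by rewrite (Delta_congruent Delta_xbar (gram s)) [X in - X = _]mxE mulNr.
  by move: (x 0) (x' 0) => p q; rewrite !mxE [W^-1 * _]mulrC.
have [|S [e [oS SP]]] := rigid_harmonic_motion xbar_horizontal (a := x 0) (b := W^-1 *: x' 0) W_neq0.
  by move=> t /=; rewrite -xE.
exists S, e; split=> // t; rewrite -/x xE SP; congr (_ *m _).
rewrite /rotating !expJ_horizontal//; last first.
  by apply: horizontalD; apply: horizontalZ => //; exact: horizontalJ.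
rewrite mulrDl cosD sinD !mulmxDr -!scalemxAr horizontalJJ//.
move: (cos _) (sin _) (cos _) (sin _) (J R *m xbar) => c s c' s' z.
by apply/matrixP => k i; rewrite !mxE; ring.
Qed.

End Minimizers.

Theorem proposition8 (R : realType) (N : nat) (m : 'I_N -> R)
    (omega T varpi : R) (xbar : config R N) (G : set (symmetry R N))
    (m_gt0 : forall i, 0 < m i)
    (omega_gt0 : 0 < omega)
    (T_def : T = 2 * pi / omega)
    (omega_varpi_neq0 : omega + varpi != 0)
    (xbar_centered : centered m xbar)
    (xbar_horizontal : horizontal xbar)
    (xbar_central : central_configuration m xbar)
    (xbar_newton :
       newton_solution m (rotating (omega + varpi) (fun=> xbar)))
    (G_subgroup : finite_subgroup G)
    (G_acts : acts_on_loops m T G)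
    (ybar_invariant : LambdaG m T G (rotating omega (fun=> xbar)))
    (lambdaG_eq1 : is_lambdaG m T varpi G xbar 1) :
  absolute_minimizer (action_functional m T varpi) (LambdaG m T G)
    (rotating omega (fun=> xbar)) /\
  forall y : R -> config R N,
    absolute_minimizer (action_functional m T varpi) (LambdaG m T G) y ->
    same_motion varpi (rotating omega (fun=> xbar)) y.
Proof.
have T_gt0 : 0 < T := period_gt0 omega_gt0 T_def.
have [xbar_free _] := xbar_central.
have Db := Delta_xbar_of_newton xbar_horizontal xbar_newton.
have [[y1 [Ly1 [t1 y1t] _ _]] lb] := lambdaG_eq1.
(* a zero xbar without collisions leaves at most one body, hence no nonzero centered
   configuration and no eigenvalue at all *)
have xbar_neq0 : xbar != 0.
  apply/eqP => x0; case/negP: y1t; apply/eqP.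
  have one (i j : 'I_N) : i = j.
    by apply/eqP; apply: contrapT => /negP /xbar_free; rewrite x0 !col0 eqxx.
  have [[_ /(_ t1)/centeredP cy _] _] := Ly1.
  have y0 : y1 t1 = 0.
    apply/matrixP => k i; rewrite [RHS]mxE; apply: (mulfI (lt0r_neq0 (m_gt0 i))).
    rewrite mulr0 -(cy k) (bigD1 i)//= big1 ?addr0// => j.
    by rewrite (one j i) eqxx.
  by rewrite /rotating y0 mulmx0.
have compat := symmetries_of_compatible m_gt0 omega_gt0 G_subgroup G_acts
  xbar_neq0 xbar_horizontal ybar_invariant.
have ge1 n u lam : admissible m omega (symmetries_of T G) n u -> u != 0 ->
    Dmode varpi (n%:R * omega) (Dmode varpi (n%:R * omega) u) = - lam *: pDelta m xbar u ->
    1 <= lam.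
  by move=> ua u0 /(admissible_eigenvalue omega_gt0 T_def G_subgroup ua u0); exact: lb.
have Aybar := action_ybar xbar_free omega_gt0 T_def xbar_horizontal Db ybar_invariant.1.
pose q (y : R -> config R N) := qform m xbar varpi T y (L2_deriv T y).
pose gap (y : R -> config R N) := Rintegral (@lebesgue_measure R) [set` `[0, T]] (fun t => shape_gap m xbar (y t)).
have q0 y : LambdaG m T G y -> 0 <= q y.
  move=> Ly; apply: (qform_ge0 m_gt0 xbar_free omega_gt0 T_def compat ge1).
  - exact: L2_derivP Ly.1.
  - by have [[_ cy _] _] := Ly.
  - exact: LambdaG_invariant Ly.
have cgap y : LambdaG m T G y -> continuous (fun t => shape_gap m xbar (y t)).
  move=> Ly; apply: continuous_shape_gap.
  exact: (@vH1_components_continuous _ _ _ _ omega_gt0 T_def _ _ (L2_derivP Ly.1)).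
have gap0 y : LambdaG m T G y -> 0 <= gap y.
  by move=> Ly; apply: int_ge0 => t _; exact: shape_gap_ge0.
have low y : LambdaG m T G y ->
    ((3 / 2 * Ubar m xbar * T + 2^-1 * q y + gap y)%:E <= action_functional m T varpi y)%E.
  by move=> Ly; exact: (action_lower_bound m_gt0 xbar_free varpi omega_gt0 T_def Ly.1).
split.
  split=> [|y Ly]; first exact: ybar_invariant.
  rewrite Aybar; apply: (le_trans _ (low y Ly)).
  by rewrite lee_fin -addrA lerDl addr_ge0 ?gap0// mulr_ge0 ?q0.
move=> y [Ly ymin].
have /(le_trans (low y Ly)) := ymin _ ybar_invariant.
rewrite Aybar lee_fin => le0.
have [qy gy] : q y = 0 /\ gap y = 0.
  have := q0 y Ly; have := gap0 y Ly; move: (q y) (gap y) le0 => a b; lra.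
have yc t : centered m (y t) by have [[_ cy _] _] := Ly.
have yr t i j : mutual_distance (y t) i j = mutual_distance xbar i j.
  have [[yp _ _] _] := Ly; have [n nT] := periodic_reduction t T_gt0.
  rewrite -(periodic_int yp n t); apply: (shape_gap_eq0 m_gt0 xbar_free).
  apply: (continuous_int_eq0 T_gt0 (cgap y Ly) _ gy nT).
  by move=> s; exact: shape_gap_ge0.
have [n [u [yE uE]]] := qform_eq0 m_gt0 xbar_free omega_gt0 T_def compat ge1
  (L2_derivP Ly.1) yc (LambdaG_invariant Ly) qy.
exact: (null_loop_rigid m_gt0 xbar_centered xbar_horizontal omega_varpi_neq0 Db yc yr yE uE).
Qed.
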